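(* Let $\ell\ge 1$ and $m,n\ge 0$ be integers. Encode a sequence of moves from $\{m_e\}\cup\{m_{i,j}:i,j\ge0\}$ as a lattice path in $\mathbb{Z}^2$, where $m_e$ corresponds to the increment $(1,-1)$ and $m_{i,j}$ corresponds to the increment $(-i,j)$. Then the sewing construction (start from a single oriented edge and apply the moves successively by the sewing rules) restricts to a bijection from paths of length $\ell-1$ from $(0,m)$ to $(n,0)$ that remain in the nonnegative quadrant $\mathbb{Z}_{\ge0}^2$ and have increments $(1,-1)$ and $(-i,j)$ with $i,j\ge0$, to bipolar-oriented planar maps with $\ell$ total edges and with $m+1$ and $n+1$ edges on the west and east boundaries respectively. A step of $(-i,j)$ in the walk corresponds to a face of degree $i+j+2$ in the planar map.
   Context: **Bipolar-oriented planar maps.** A planar map here is a finite connected planar graph $G$ without self-loops (multiple edges allowed), with two distinguished vertices, the south pole $S$ (bottom) and the north pole $N$ (top), incident to the same face, embedded in a closed disk with $S$ at the bottom and $N$ at the top of the boundary circle and all other vertices in the interior; maps are considered up to orientation-preserving homeomorphism (respecting all marked data). Within the disk there are two boundary faces, the western face $W$ and the eastern face $E$; all other faces are interior faces. A bipolar orientation is an acyclic orientation of the edges whose only source (vertex with no incoming edges) is $S$ and whose only sink (vertex with no outgoing edges) is $N$. Oriented edges are said to point north (upward). An upward (downward) edge of a vertex is an outgoing (incoming) edge. Each edge has a face on its west (left when facing north) and on its east. The boundary of each interior face consists of two directed paths from its minimum vertex to its maximum vertex, its west side and its east side; the degree of the face is its total number of boundary edges. The western (eastern) boundary of the map is the directed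 path from $S$ to $N$ bounding $W$ (bounding $E$). ''Face'' in the last sentence of the claim means interior face. **Marked bipolar maps.** A marked bipolar map is a bipolar-oriented planar map together with a start vertex on its western boundary which is not at the top, and an active vertex on its eastern boundary which is not at the bottom, such that the start vertex and every vertex below it on the western boundary has at most one downward edge, and the active vertex and every vertex above it on the eastern boundary has at most one upward edge. The edges on the western boundary below the start vertex and on the eastern boundary above the active vertex are called missing. They are boundaries of (open) interior faces that are part of the map, i.e. each missing edge is incident to an interior face, but they are regarded as not themselves belonging to the structure. A marked bipolar map is considered an (unmarked) bipolar-oriented planar map if the start vertex is the south pole and the active vertex is the north pole, equivalently if there are no missing edges. **Sewing rules.** The initial structure is a single oriented edge whose lower endpoint is the start vertex and whose upper endpoint is the active vertex. Each move adds exactly one (non-missing) edge. - Move $m_e$: sew an edge to the current marked bipolar map upwards from the active vertex, and move the active vertex to the upper endpoint of this edge. If the eastern boundary has a vertex above the active vertex, the new edge is sewn to (identified with) the southernmost missing edge on the eastern boundary, which thereby becomes non-missing; otherwise there is a new vertex, which becomes the top vertex. - Move $m_{i,j}$ ($i,j\ge0$): first sew in an open face with $i+1$ edges on its west side and $j+1$ edges on its east side, by sewing the top of the face to the current active vertex and the west side of the face to the eastern boundary of the marked bipolar map (going down from the active vertex); then sew an edge to the southernmost edge of the east side of the new face; the new active vertex is the upper endpoint of this edge. The other edges of the east side of the new face are missing. If there are fewer than $i+1$ edges on the eastern boundary below the old active vertex, the west side of the new face is sewn to as many of them as there are, starting from the top; the remaining western edges of the face are missing edges on the western boundary of the map, and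 the start vertex is then no longer at the bottom. *)

(* Defs.v *)
From mathcomp Require Import all_boot all_order fingroup perm all_algebra.

Set Implicit Arguments.
Unset Strict Implicit.
Unset Printing Implicit Defensive.

(* ------------------------------------------------------------------------ *)
(* Oriented maps in the disk, as combinatorial maps.                         *)
(*                                                                            *)
(* A dart (e, b) is an end of the oriented edge e, viewed as leaving its      *)
(* vertex: (e, true) is the lower end (the upward, outgoing direction), and   *)
(* (e, false) is the upper end (the downward direction).  The permutation     *)
(* [rot] sends a dart to the next one counterclockwise around its vertex, so  *)
(* vertices are the cycles of [rot].                                          *)
(*                                                                            *)
(* The poles are marked by corners: a dart d stands for the corner between d  *)
(* and [rot d], and the disk's boundary circle touches the south (north) pole *)
(* in the corner of [south] ([north]).  Thus [south] is the westernmost       *)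
(* upward dart of the south pole, and [north] the easternmost downward dart   *)
(* of the north pole.                                                         *)
(* ------------------------------------------------------------------------ *)

Record omap := OMap {
  edge : finType;
  rot : {perm (edge * bool)};
  south : edge * bool;
  north : edge * bool
}.

Definition flip (E : Type) (d : E * bool) : E * bool := (d.1, ~~ d.2).

Lemma flipK (E : Type) : involutive (@flip E).
Proof. by case=> e b; rewrite /flip /= negbK. Qed.

Definition flip_perm (E : finType) : {perm (E * bool)} :=
  perm (inv_inj (@flipK E)).

(* Sends a dart d to the next dart along the face on the left of d, keeping   *)
(* that face on the left: d |-> rot^-1 (flip d), as permutations compose from *)
(* left to right.                                                             *)
Definition next_in_face (E : finType) (r : {perm (E * bool)}) :
  {perm (E * bool)} := (flip_perm E * r^-1)%g.

Section OMap.
Variable M : omap.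

Definition dart := (edge M * bool)%type.
Implicit Types d x : dart.

Definition next d : dart := next_in_face (rot M) d.

Definition vertex d : {set dart} := porbit (rot M) d.
Definition face d : {set dart} := porbit (next_in_face (rot M)) d.
Definition vertices : {set {set dart}} := porbits (rot M).
Definition faces : {set {set dart}} := porbits (next_in_face (rot M)).

(* The western and eastern faces W and E of the disk form a single cycle of   *)
(* [next], which goes from [south] up along W to [north], then down along E   *)
(* back to [south].                                                           *)
Definition outer_face : {set dart} := face (south M).
Definition interior_faces : {set {set dart}} := faces :\ outer_face.

(* Listed from south to north, as upward darts.                               *)
Definition west_boundary : seq dart :=
  traject next (south M) (findex next (south M) (north M)).

(* Listed from north to south, as downward darts.                             *)
Definition east_boundary : seq dart :=
  traject next (north M) (findex next (north M) (south M)).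

Definition connected_map : Prop :=
  forall d x, connect [rel y z | (z == rot M y) || (z == flip y)] d x.

(* Euler's formula.                                                           *)
Definition genus0 : Prop := #|vertices| + #|faces| = #|edge M| + 2.

Definition no_loop : Prop := forall e, (e, false) \notin vertex (e, true).

(* The upper endpoint of e is the lower endpoint of e'.                       *)
Definition follows : rel (edge M) :=
  fun e e' => (e', true) \in vertex (e, false).

Definition acyclic_map : Prop := forall p, path.cycle follows p -> p = [::].

Definition is_source (v : {set dart}) : bool := [forall (d | d \in v), d.2].
Definition is_sink (v : {set dart}) : bool := [forall (d | d \in v), ~~ d.2].

Record bipolar_map : Prop := BipolarMap {
  bipolar_connected : connected_map;
  bipolar_planar : genus0;
  bipolar_no_loop : no_loop;
  bipolar_poles : north M \in outer_face;
  bipolar_acyclic : acyclic_map;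
  bipolar_source :
    forall v, v \in vertices -> is_source v = (v == vertex (south M));
  bipolar_sink :
    forall v, v \in vertices -> is_sink v = (v == vertex (north M))
}.

End OMap.

(* Equality of maps up to orientation-preserving homeomorphism of the disk    *)
(* respecting poles and edge orientations.                                    *)
Definition isomorphic (M M' : omap) : Prop :=
  exists2 f : edge M -> edge M', bijective f &
    let g (d : dart M) : dart M' := (f d.1, d.2) in
    [/\ forall d, g (rot M d) = rot M' (g d),
        g (south M) = south M' & g (north M) = north M'].

(* ------------------------------------------------------------------------ *)
(* Marked maps.  The start vertex is given by the dart of the western         *)
(* boundary that leaves it upwards, and the active vertex by the dart of the  *)
(* eastern boundary that leaves it downwards; these darts exist because the   *)
(* start vertex is not at the top and the active vertex not at the bottom.    *)
(* ------------------------------------------------------------------------ *)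

(* A state of the sewing construction: a marked map, together with the list   *)
(* of the faces sewn in so far, in chronological order, each given by a dart  *)
(* that has it on its left.                                                   *)
Record sewing := Sewing {
  base :> omap;
  start : dart base;
  active : dart base;
  sewn_faces : seq (dart base)
}.

Section Marked.
Variable M : sewing.

Definition missing_west : seq (dart M) :=
  take (index (start M) (west_boundary M)) (west_boundary M).
Definition missing_east : seq (dart M) :=
  take (index (active M) (east_boundary M)) (east_boundary M).

Record marked_bipolar_map : Prop := MarkedBipolarMap {
  marked_bipolar : bipolar_map M;
  marked_start : start M \in west_boundary M;
  marked_active : active M \in east_boundary M;
  marked_start_down : forall d, d \in rcons missing_west (start M) ->
    #|[set x in vertex d | ~~ x.2]| <= 1;
  marked_active_up : forall d, d \in rcons missing_east (active M) ->
    #|[set x in vertex d | x.2]| <= 1;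
  marked_missing : forall d, d \in missing_west ++ missing_east ->
    face (flip d) \in interior_faces M
}.

(* The start vertex is the south pole and the active vertex the north pole.   *)
Definition unmarked : Prop := start M = south M /\ active M = north M.

End Marked.

(* ------------------------------------------------------------------------ *)
(* Elementary surgeries.  Each adds one edge [None : option E] to the map.    *)
(* ------------------------------------------------------------------------ *)

Section Lift.
Variable E : finType.

Definition old (d : E * bool) : option E * bool := (Some d.1, d.2).
Definition new_up : option E * bool := (None, true).
Definition new_down : option E * bool := (None, false).

Definition lift_fun (r : {perm (E * bool)}) (d : option E * bool) :=
  if d is (Some e, b) then old (r (e, b)) else d.

Lemma lift_fun_inj (r : {perm (E * bool)}) : injective (lift_fun r).
Proof.
case=> [[e|] b] [[e'|] b'] //= [].
by move=> h1 h2; congr (Some _, _);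
   have /perm_inj[] : r (e, b) = r (e', b')
     by rewrite [LHS]surjective_pairing h1 h2 -surjective_pairing.
Qed.

(* [r] on the old darts, with the two new darts as fixed points.              *)
Definition lift_rot (r : {perm (E * bool)}) : {perm (option E * bool)} :=
  perm (@lift_fun_inj r).

End Lift.

Arguments new_up {E}.
Arguments new_down {E}.

(* If x is a fixed point of r, then [insert_after d x r] is r with x inserted *)
(* immediately after d in the cycle of d.                                     *)
Definition insert_after (T : finType) (d x : T) (r : {perm T}) : {perm T} :=
  (tperm d x * r)%g.

(* A new edge upwards from the north pole to a new vertex, which becomes the  *)
(* north pole and the active vertex.                                          *)
Definition add_top (M : sewing) : sewing :=
  @Sewing
    (OMap (insert_after (old (north M)) new_up (lift_rot (rot M)))
          (old (south M)) new_down)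
    (old (start M)) new_down (map (@old _) (sewn_faces M)).

(* A new edge downwards from the south pole to a new vertex, which becomes    *)
(* the south pole; start and active vertices are kept.                        *)
Definition add_bottom (M : sewing) : sewing :=
  @Sewing
    (OMap (insert_after (old (south M)) new_down (lift_rot (rot M)))
          new_up (old (north M)))
    (old (start M)) (old (active M)) (map (@old _) (sewn_faces M)).

(* A new edge drawn in E to the active vertex, from the vertex i.+1 edges     *)
(* below it on the eastern boundary.  It cuts off a new interior face, on the *)
(* left of [new_up].                                                          *)
Definition add_chord (i : nat) (M : sewing) : sewing :=
  let bottom := iter i.+1 (@next M) (active M) in
  @Sewing
    (OMap (insert_after (old (active M)) new_down
            (insert_after (old bottom) new_up (lift_rot (rot M))))
          (old (south M))
          (if active M == north M then new_down else old (north M)))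
    (old (start M)) new_down (rcons (map (@old _) (sewn_faces M)) new_up).

(* Splits the edge below the active vertex in two by a new vertex, which      *)
(* becomes the active vertex; the upper half is the new edge, hence missing.  *)
Definition split_active (M : sewing) : sewing :=
  let a := old (active M) in
  @Sewing
    (OMap (insert_after a new_up (lift_rot (rot M) ^ tperm a new_down)%g)
          (old (south M)) (tperm a new_down (old (north M))))
    (old (start M)) a (map (@old _) (sewn_faces M)).

(* ------------------------------------------------------------------------ *)
(* Sewing                                                                     *)
(* ------------------------------------------------------------------------ *)

Inductive move := MoveEdge | MoveFace (i j : nat).

Definition single_edge : sewing :=
  @Sewing (@OMap unit 1%g (tt, true) (tt, false)) (tt, true) (tt, false) [::].

(* If the active vertex is not at the top, the only thing that changes is the *)
(* active dart, which becomes the previous dart of the eastern boundary, i.e. *)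
(* the one that [next] sends to the current active dart.                      *)
Definition sew_edge (M : sewing) : sewing :=
  if active M == north M then add_top M
  else @Sewing M (start M) (flip (rot M (active M))) (sewn_faces M).

(* Let k be the number of edges of the eastern boundary below the active      *)
(* vertex.  The i.+1 - k (truncated) western edges of the new face that find  *)
(* no partner are put below the south pole, where they become missing edges   *)
(* of the western boundary; the east side of the face is then a chord,        *)
(* subdivided into j.+1 edges all of which but the southernmost are missing.  *)
Definition sew_face (i j : nat) (M : sewing) : sewing :=
  let k := findex (@next M) (active M) (south M) in
  iter j split_active (add_chord i (iter (i.+1 - k) add_bottom M)).

Definition sew_move (M : sewing) (mv : move) : sewing :=
  match mv with
  | MoveEdge => sew_edge M
  | MoveFace i j => sew_face i j M
  end.

Definition sew (w : seq move) : sewing := foldl sew_move single_edge w.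

(* ------------------------------------------------------------------------ *)
(* Lattice paths                                                              *)
(* ------------------------------------------------------------------------ *)

Local Open Scope ring_scope.

Definition increment (mv : move) : int * int :=
  match mv with
  | MoveEdge => (1, -1)
  | MoveFace i j => (- i%:Z, j%:Z)
  end.

(* A path with increments (1,-1) and (-i,j) is thus the same thing as its     *)
(* starting point and its sequence of moves.                                  *)
Lemma increment_inj : injective increment.
Proof.
move=> [|i j] [|i' j'] // /eqP; rewrite xpair_eqE => /andP[/eqP hi /eqP hj].
by case: (GRing.oppr_inj hi) hj => -> [->].
Qed.

(* The points visited after the starting point p.                             *)
Definition visited (p : int * int) (w : seq move) : seq (int * int) :=
  scanl (fun q mv => q + increment mv) p w.

Definition in_quadrant (p : int * int) : bool := (0 <= p.1) && (0 <= p.2).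

Definition quadrant_path (len : nat) (p q : int * int) (w : seq move) : Prop :=
  [/\ size w = len, all in_quadrant (p :: visited p w)
    & last p (visited p w) = q].

Definition face_degree (mv : move) : option nat :=
  if mv is MoveFace i j then Some (i + j + 2)%N else None.

(* Bipolar-oriented planar maps with l edges, and with a and b edges on the   *)
(* western and eastern boundaries.                                            *)
Definition bipolar_map_with (l a b : nat) (M : omap) : Prop :=
  [/\ bipolar_map M, #|edge M| = l, size (west_boundary M) = a
    & size (east_boundary M) = b].

(* Main.v *)
(* A marked map is followed by the cyclic list of the darts of its outer face,
   in which each surgery is a local edit; Euler characteristic is controlled
   because every surgery multiplies the rotation by transpositions.

   In a bipolar map each face has one lowest and one highest corner, and the
   upward darts around a vertex are consecutive: both follow by counting changes
   of direction at corners.  Hence the last move can be read off the map.  Let u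
   be the edge below the active vertex, directed upwards.  The last move was a
   face move exactly when u is not the westernmost upward dart of its lower end,
   and then the face on the left of u is the last one sewn in, its west and east
   sides giving i and j.  Undoing moves in this way proves both injectivity and
   surjectivity. *)

Require Import Defs.
From mathcomp Require Import all_boot all_order fingroup perm all_algebra.
From mathcomp Require Import zify.
(* Restores [rot], [next], etc., shadowed by their MathComp namesakes. *)
Import Defs.

Set Implicit Arguments.
Unset Strict Implicit.
Unset Printing Implicit Defensive.

(** * Permutations *)

(** The lemmas on what a surgery does to a marked map are equivalences: one direction carries the
    invariant along a path, the other undoes a move. To make both directions cheap, bipolarity is
    restated without paths: acyclicity becomes a height function on vertices, and connectedness the
    constancy of invariant predicates.

    The difficulty is that intermediate states have missing edges, which are nevertheless edges of
    the underlying map. With [A] the list of missing eastern edges, the number of moves is the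
    number of edges minus [size A] minus one. The abscissa is [size B], and a face move with
    [i <= size B] finds a partner for each western edge of the face, so a quadrant path never
    extends the map below the south pole and the start vertex stays there. The ordinate is
    [size A + m - size W], where [m - size W] counts the western edges still to be made. Hence its
    sign matters only when a new top vertex is created, and the end point (n, 0) forces [A] to be
    empty and the western boundary to have m + 1 edges. *)

Lemma fpath_all (T : eqType) (f : T -> T) (P : pred T) x p : fpath f x p -> P x ->
  (forall y, f y \in p -> P y -> P (f y)) -> all P (x :: p).
Proof.
elim: p x => [|y p IH] x /=; first by move=> _ ->.
case/andP => /eqP xy yp xd h; rewrite xd /=.
have yd : P y by rewrite -xy; apply: h; rewrite // xy mem_head.
by apply: IH yp yd _ => z zp; apply: h; rewrite in_cons zp orbT.
Qed.

Section Perms.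
Variables (T T' : finType).
Implicit Types (s : {perm T}) (h : T -> T').

Lemma porbit_homo s (s' : {perm T'}) h :
  (forall z, h (s z) \in porbit s' (h z)) ->
  forall y z, y \in porbit s z -> h y \in porbit s' (h z).
Proof.
move=> hs y z /porbitP[i ->]; elim: i => [|i IH]; first by rewrite expg0 perm1 porbit_id.
rewrite expgSr permM; move: (hs ((s ^+ i)%g z)).
by rewrite -!eq_porbit_mem => /eqP->; rewrite eq_porbit_mem.
Qed.

Lemma porbit_stable s U (P : T -> U) :
  (forall z, P (s z) = P z) -> forall y z, y \in porbit s z -> P y = P z.
Proof.
move=> hs y z /porbitP[i ->]; elim: i => [|i IH]; first by rewrite expg0 perm1.
by rewrite expgSr permM hs.
Qed.

Lemma porbit_step s z : s z \in porbit s z.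
Proof. exact: (mem_porbit s 1). Qed.

Lemma mem_porbit_step s y z : (s y \in porbit s z) = (y \in porbit s z).
Proof. by rewrite -!eq_porbit_mem -(porbit_perm s 1 y) expg1. Qed.

Lemma mem_porbit_stepr s y z : (y \in porbit s (s z)) = (y \in porbit s z).
Proof. by rewrite porbit_sym mem_porbit_step porbit_sym. Qed.

Lemma porbit_trans s y x z :
  y \in porbit s x -> x \in porbit s z -> y \in porbit s z.
Proof. by rewrite -!eq_porbit_mem => /eqP->. Qed.

Lemma porbit_fix s x y : s x = x -> (y \in porbit s x) = (y == x).
Proof.
move=> sx; apply/idP/eqP => [/porbitP[i ->]|->]; last exact: porbit_id.
by elim: i => [|i IH]; rewrite ?expg0 ?perm1 // expgS permM sx.
Qed.

Lemma porbit_inj_in s (s' : {perm T'}) h z : injective h ->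
  (forall y, y \in porbit s z -> h (s y) = s' (h y)) ->
  porbit s' (h z) = h @: porbit s z.
Proof.
move=> hI hs; have hi i : h ((s ^+ i)%g z) = (s' ^+ i)%g (h z).
  elim: i => [|i IH]; first by rewrite !expg0 !perm1.
  by rewrite !expgSr !permM hs ?mem_porbit // IH.
apply/setP => y; apply/porbitP/imsetP => [[i ->]|[x /porbitP[i ->] ->]].
  by exists ((s ^+ i)%g z); rewrite ?mem_porbit ?hi.
by exists i.
Qed.

Lemma porbit_inj s (s' : {perm T'}) h z : injective h ->
  (forall y, h (s y) = s' (h y)) -> porbit s' (h z) = h @: porbit s z.
Proof. by move=> hI hs; apply: porbit_inj_in. Qed.

Lemma card_porbits_bij s (s' : {perm T'}) h : bijective h ->
  (forall y, h (s y) = s' (h y)) -> #|porbits s'| = #|porbits s|.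
Proof.
move=> hb hs; have hI := bij_inj hb.
rewrite -(card_imset (porbits s) (imset_inj hI)); apply: eq_card => O.
apply/imsetP/imsetP => [[y _ ->]|[P /imsetP[x _ ->] ->]].
  case: hb => g gh hg; exists (porbit s (g y)); first exact: imset_f.
  by rewrite -(porbit_inj _ hI hs) hg.
by exists (h x); rewrite // (porbit_inj _ hI hs).
Qed.

End Perms.

Section Insert.
Variable T : finType.
Implicit Types (r : {perm T}).

(** [q] contracts [x] onto [d]. A step of the new permutation contracts to at most one step of [r],
    and a step of [r] is at most two steps of the new permutation, the detour going through [x]. *)
Lemma porbit_insert r d x : r x = x ->
  let q t := if t == x then d else t in
  x != d -> forall y z,
  (y \in porbit (tperm d x * r)%g z) = (q y \in porbit r (q z)).
Proof.
move=> rx q xd; set s := (tperm d x * r)%g.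
have sd : s d = x by rewrite permM tpermL.
have sx : s x = r d by rewrite permM tpermR.
have so z : z != d -> z != x -> s z = r z.
  by move=> zd zx; rewrite permM tpermD // eq_sym.
have rnx z : z != x -> r z != x.
  by apply: contraNneq => h; rewrite -h; apply/eqP/(@perm_inj _ r); rewrite h rx.
have qs z : q (s z) \in porbit r (q z).
  rewrite /q; case: (eqVneq z x) => [->|zx].
    by rewrite sx (negPf (rnx _ _)) ?porbit_step // eq_sym.
  case: (eqVneq z d) => [->|zd]; first by rewrite sd eqxx porbit_id.
  by rewrite so // (negPf (rnx _ _)) ?porbit_step.
have rs z : r z \in porbit s z.
  case: (eqVneq z x) => [->|zx]; first by rewrite rx porbit_id.
  case: (eqVneq z d) => [->|zd]; last by rewrite -so ?porbit_step.
  by rewrite -sx -sd !mem_porbit_step porbit_id.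
have qz z : q z \in porbit s z.
  rewrite /q; case: eqP => [->|_]; last exact: porbit_id.
  by rewrite -sd mem_porbit_stepr porbit_id.
move=> y z; apply/idP/idP; first exact: porbit_homo.
move/(porbit_homo (h := id) rs) => h.
apply: porbit_trans (qz z); apply: porbit_trans h.
by rewrite porbit_sym.
Qed.

(** The fixed point [x] is a cycle of its own, which the transposition merges with the cycle of
    [d]. *)
Lemma card_porbits_insert r d x : r x = x -> x != d ->
  #|porbits (tperm d x * r)%g|.+1 = #|porbits r|.
Proof.
move=> rx xd; have := porbits_mul_tperm r d x.
by rewrite (porbit_fix _ rx) eq_sym xd /= addn1; lia.
Qed.

Lemma card_porbits_split r d x : d \in porbit r x -> x != d ->
  #|porbits (tperm d x * r)%g| = #|porbits r|.+1.
Proof.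
by move=> dx xd; have := porbits_mul_tperm r d x; rewrite dx eq_sym xd /=; lia.
Qed.

End Insert.

(** * Darts and rotations of a map with one more edge *)

Section Lifts.
Variable E : finType.
Implicit Types (r : {perm (E * bool)}) (d : E * bool).

Lemma old_inj : injective (@old E).
Proof. by case=> e b [e' b'] [-> ->]. Qed.

Lemma old_eq d d' : (old d == old d') = (d == d').
Proof. exact: (inj_eq old_inj). Qed.

Lemma old_new_up d : (old d == new_up) = false. Proof. by case: d. Qed.
Lemma old_new_down d : (old d == new_down) = false. Proof. by case: d. Qed.
Lemma new_up_old d : (new_up == old d) = false. Proof. by case: d. Qed.
Lemma new_down_old d : (new_down == old d) = false. Proof. by case: d. Qed.
Lemma new_up_down : ((new_up : option E * bool) == new_down) = false. Proof. by []. Qed.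
Lemma new_down_up : ((new_down : option E * bool) == new_up) = false. Proof. by []. Qed.

Definition newE := (old_eq, old_new_up, old_new_down, new_up_old, new_down_old,
  new_up_down, new_down_up).

Lemma flip_old d : flip (old d) = old (flip d). Proof. by []. Qed.
Lemma flip_new_up : flip (new_up : option E * bool) = new_down. Proof. by []. Qed.
Lemma flip_new_down : flip (new_down : option E * bool) = new_up. Proof. by []. Qed.

Lemma lift_rot_old r d : lift_rot r (old d) = old (r d).
Proof. by rewrite permE /= -surjective_pairing. Qed.
Lemma lift_rot_new_up r : lift_rot r new_up = new_up.
Proof. by rewrite permE. Qed.
Lemma lift_rot_new_down r : lift_rot r new_down = new_down.
Proof. by rewrite permE. Qed.

Variant new_spec : option E * bool -> Type :=
| NewOld d : new_spec (old d)
| NewUp : new_spec new_up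
| NewDown : new_spec new_down.

Lemma new_dartP x : new_spec x.
Proof. by case: x => -[e|] b; [exact: (NewOld (e, b))|case: b; constructor]. Qed.

Lemma porbit_lift_old r d d' :
  (old d \in porbit (lift_rot r) (old d')) = (d \in porbit r d').
Proof.
rewrite (@porbit_inj _ _ r _ (@old E)) ?mem_imset //; try exact: old_inj.
by move=> y; rewrite lift_rot_old.
Qed.

Lemma card_porbits_lift r : #|porbits (lift_rot r)| = #|porbits r| + 2.
Proof.
pose liftS (P : {set E * bool}) := @old E @: P.
have hl d : porbit (lift_rot r) (old d) = liftS (porbit r d).
  by apply: porbit_inj; [exact: old_inj | move=> y; rewrite lift_rot_old].
have nimg (x : option E * bool) : (forall d, x != old d) ->
    porbit (lift_rot r) x \notin liftS @: porbits r.
  move=> hx; apply/imsetP => -[P /imsetP[d _ ->]]; rewrite -hl => /eqP.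
  by rewrite eq_porbit_mem hl => /imsetP[d' _ xd]; move: (hx d'); rewrite xd eqxx.
have -> : porbits (lift_rot r) = porbit (lift_rot r) new_up |:
    (porbit (lift_rot r) new_down |: liftS @: porbits r).
  apply/setP => O; rewrite !inE; apply/imsetP/idP => [[x _ ->]|].
    case: (new_dartP x) => [d||]; rewrite ?eqxx ?orbT //.
    by rewrite hl; apply/orP; right; apply/orP; right; rewrite !imset_f.
  case/or3P => [/eqP->|/eqP->|/imsetP[P /imsetP[d _ ->] ->]].
  - by exists new_up.
  - by exists new_down.
  - by exists (old d).
rewrite !cardsU1 in_setU1 negb_or nimg => [|d]; last by rewrite newE.
rewrite nimg => [|d]; last by rewrite newE.
rewrite eq_porbit_mem porbit_fix ?lift_rot_new_down // newE /=.
by rewrite card_imset; [rewrite !add1n addn2 | exact/imset_inj/old_inj].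
Qed.

(** For undoing a surgery: once its transpositions are cancelled the two new darts are fixed, and
    the remaining rotation comes from a map with one edge less. *)
Lemma unlift_rot (r1 : {perm (option E * bool)}) :
  r1 new_up = new_up -> r1 new_down = new_down -> exists r, r1 = lift_rot r.
Proof.
(* The default [d] is never reached: both new darts are fixed, so no old dart is sent to one of
   them. *)
move=> ru rd; pose f (d : E * bool) := if r1 (old d) is (Some e, b) then (e, b) else d.
have fE d : old (f d) = r1 (old d).
  rewrite /f; case Er: (r1 (old d)) => [[e|] b] //; exfalso.
  have : r1 (old d) = r1 (None, b) by rewrite Er; case: b {Er}.
  by move/perm_inj.
have fI : injective f.
  by move=> d d' h; apply/old_inj/(@perm_inj _ r1); rewrite -!fE h.
exists (perm fI); apply/permP => x.
by case: (new_dartP x) => [d||];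
  rewrite ?lift_rot_old ?permE -?fE ?permE ?lift_rot_new_up ?lift_rot_new_down.
Qed.

Lemma next_in_faceE r d : r (next_in_face r d) = flip d.
Proof. by rewrite /next_in_face permM permKV permE. Qed.

Lemma next_in_face_eq r d d' : (next_in_face r d == d') = (r d' == flip d).
Proof. by rewrite -(next_in_faceE r d) (inj_eq perm_inj) eq_sym. Qed.

(** A surgery multiplies the rotation on the left by transpositions. They stay on the left in the
    inverse of the face permutation, so the insertion lemmas count faces as well as vertices. *)
Lemma next_in_faceV r : (next_in_face r)^-1%g = (r * flip_perm E)%g.
Proof.
rewrite /next_in_face invMg invgK; congr (_ * _)%g.
by apply/eqP; rewrite eq_invg_mul; apply/eqP/permP => x; rewrite permM !permE flipK.
Qed.

End Lifts.

(** * Counting corners *)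

Section Transitions.
Variables (T : finType) (s : {perm T}).

Lemma porbit_transition (f : pred T) x z : x \in porbit s z -> f z -> ~~ f x ->
  exists2 y, y \in porbit s z & f y && ~~ f (s y).
Proof.
case/porbitP => i ->; elim: i => [|i IH] fz; first by rewrite expg0 perm1 fz.
rewrite expgSr permM => fx; case fi: (f ((s ^+ i)%g z)); last by apply: IH; rewrite ?fi.
by exists ((s ^+ i)%g z); rewrite ?mem_porbit // fi.
Qed.

Variables (A : pred T) (O : {set {set T}}).
Hypothesis OA : forall P, P \in O -> exists2 d, P = porbit s d & d \in A.

Let O_sub : O \subset [set porbit s d | d in A].
Proof. by apply/subsetP => P /OA[d -> dA]; apply: imset_f. Qed.

Lemma leq_card_orbits : #|O| <= #|A|.
Proof. exact: leq_trans (subset_leq_card O_sub) (leq_imset_card _ _). Qed.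

(** Pigeonhole: [A] meets every orbit in [O], so with no more points than there are orbits it has
    exactly one in each. *)
Lemma eq_card_orbits : #|A| <= #|O| -> {in A &, injective (porbit s)}.
Proof.
move=> AO; apply/imset_injP/eqP/eqP; rewrite eqn_leq leq_imset_card /=.
exact: leq_trans AO (subset_leq_card O_sub).
Qed.

End Transitions.

(** Bipolarity in a form that is easily carried through surgeries. The absence of loops follows from
    the rank. That [n] lies on the outer face is left out here, since the outer walk of [good] shows
    it. *)
Record core (E : finType) (r : {perm (E * bool)}) (s n : E * bool) : Prop := Core {
  core_conn : forall P : pred (E * bool), (forall d, P (r d) = P d) ->
    (forall d, P (flip d) = P d) -> forall d x, P d = P x;
  core_genus : #|porbits r| + #|porbits (next_in_face r)| = #|E| + 2;
  core_rank : exists2 rk : E * bool -> nat, forall d, rk (r d) = rk d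
    & forall e, rk (e, true) < rk (e, false);
  core_src : forall x, x \in porbit r s -> x.2;
  core_src_only : forall d, d \notin porbit r s ->
    exists2 x, x \in porbit r d & ~~ x.2;
  core_snk : forall x, x \in porbit r n -> ~~ x.2;
  core_snk_only : forall d, d \notin porbit r n ->
    exists2 x, x \in porbit r d & x.2
}.

Section Bipolar.
Variable M : omap.

Lemma connected_mapP : connected_map M <->
  forall P : pred (dart M), (forall d, P (rot M d) = P d) ->
    (forall d, P (flip d) = P d) -> forall d x, P d = P x.
Proof.
split=> [hc P hr hf d x | hP d x].
  apply: (@closed_connect _ _ P _ d x (hc d x)) => y z /= /orP[]/eqP->.
    by rewrite [RHS]hr.
  by rewrite [RHS]hf.
set e := (X in connect X).
(* The relation steps only forwards along [rot], but the cycles of a permutation are finite, so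
   going forwards reaches the whole vertex. *)
have rc y z : y \in porbit (rot M) z -> connect e z y.
  case/porbitP => i ->; elim: i => [|i IH]; first by rewrite expg0 perm1 connect0.
  rewrite expgSr permM; apply: connect_trans IH _.
  by apply: connect1; rewrite /e /= eqxx.
rewrite -(hP (connect e d) _ _ d) ?connect0 // => y.
  apply/idP/idP => h; apply: (connect_trans h); apply: rc; last exact: porbit_step.
  by rewrite porbit_sym porbit_step.
apply/idP/idP => h; apply: (connect_trans h); apply: connect1.
  by rewrite /e /= flipK eqxx orbT.
by rewrite /e /= eqxx orbT.
Qed.

Lemma acyclic_mapP : acyclic_map M <->
  exists2 rk : dart M -> nat, forall d, rk (rot M d) = rk d
    & forall e, rk (e, true) < rk (e, false).
Proof.
split=> [ac | [rk rkr rke] [|e p] //=]; last first.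
  have rkv d x : d \in porbit (rot M) x -> rk d = rk x.
    exact: (porbit_stable (P := rk)).
  have sub : subrel (@follows M) (relpre (fun e => rk (e, true)) ltn).
    by move=> x y; rewrite /follows => /rkv /= ->.
  move/(sub_path sub); rewrite -path_map.
  move/(order_path_min ltn_trans)/allP/(_ (rk (e, true))).
  by rewrite map_rcons mem_rcons inE eqxx ltnn => /(_ isT).
(* The height of a vertex is the number of edges that begin a directed path ending there. It
   increases strictly along [e], because [e] itself is counted at its upper end, and at its lower
   end only if there is a directed cycle. *)
pose S (d : dart M) := [set e | [exists e', connect (@follows M) e e'
  && (d \in vertex (e', false))]].
exists (fun d => #|S d|) => [d|e].
  apply: eq_card => e; rewrite !inE; apply: eq_existsb => e'.
  by rewrite /vertex mem_porbit_step.
apply: proper_card; apply/properP; split.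
  apply/subsetP => e1; rewrite !inE => /existsP[e' /andP[c1 c2]].
  apply/existsP; exists e; rewrite porbit_id andbT.
  by apply: connect_trans c1 (connect1 _); rewrite /follows.
exists e; rewrite !inE; first by apply/existsP; exists e; rewrite connect0 porbit_id.
apply/existsP => -[e' /andP[/connectP[p ep ->] c2]].
by have := ac (e :: p); rewrite /= rcons_path ep /= => /(_ c2).
Qed.

Lemma core_bipolar : bipolar_map M <->
  core (rot M) (south M) (north M) /\ north M \in outer_face M.
Proof.
have orbV d : vertex d \in vertices M by apply: imset_f.
split=> [[c1 c2 c3 c4 c5 c6 c7] | [[c1 c2 c3 c4 c5 c6 c7] c8]].
  split=> //; split=> //.
  - exact/connected_mapP.
  - exact/acyclic_mapP.
  - move=> x xs; have := c6 _ (orbV (south M)).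
    by rewrite eqxx => /forallP/(_ x)/implyP; apply.
  - move=> d ds; have := c6 _ (orbV d); rewrite eq_porbit_mem (negPf ds).
    by move/negbT/forallPn => [x]; rewrite negb_imply => /andP[]; exists x.
  - move=> x xs; have := c7 _ (orbV (north M)).
    by rewrite eqxx => /forallP/(_ x)/implyP; apply.
  - move=> d ds; have := c7 _ (orbV d); rewrite eq_porbit_mem (negPf ds).
    move/negbT/forallPn => [x]; rewrite negb_imply negbK => /andP[]; by exists x.
have ac := proj2 acyclic_mapP c3.
split=> //.
- exact/connected_mapP.
- move=> e; apply/negP => h; have := ac [:: e]; rewrite /= andbT.
  by rewrite /follows /vertex porbit_sym => /(_ h).
- move=> v /imsetP[d _ ->]; rewrite eq_porbit_mem; apply/forallP/idP.
    move=> h; case: (boolP (d \in _)) => // /c5[x xd]; have := h x.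
    by rewrite xd /= => ->.
  by move=> ds x; apply/implyP => xd; apply: c4; apply: porbit_trans ds.
- move=> v /imsetP[d _ ->]; rewrite eq_porbit_mem; apply/forallP/idP.
    move=> h; case: (boolP (d \in _)) => // /c7[x xd]; have := h x.
    by rewrite xd /= => /negbTE->.
  by move=> ds x; apply/implyP => xd; apply: c6; apply: porbit_trans ds.
Qed.

End Bipolar.

(* Every corner is a change of direction either around its vertex or along
   its face.  Acyclicity forces two changes along each face, and each vertex
   but the poles has two as well; Euler's formula leaves no room for more. *)
Section Corners.
Variables (E : finType) (r : {perm (E * bool)}) (s n : E * bool).
Hypothesis c : core r s n.
Notation nx := (next_in_face r).

(** Around a face whose darts all have the same direction the rank would be strictly monotone; an
    extremal dart and its successor contradict this. *)
Lemma face_not_constant b z : exists2 y, y \in porbit nx z & y.2 != b.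
Proof.
have [rk rkr rke] := core_rank c.
have rkn y : rk (nx y) = rk (flip y) by rewrite -rkr next_in_faceE.
case: (pickP [pred y in porbit nx z | y.2 != b]) => [y /andP[]|h]; first by exists y.
have {}h y : y \in porbit nx z -> y.2 = b.
  by move=> yz; move: (h y); rewrite /= yz /= => /negbFE/eqP.
exfalso; case: b h => h.
  case: (arg_maxnP rk (porbit_id nx z)) => y yz /(_ (nx y)).
  have yn : nx y \in porbit nx z by rewrite mem_porbit_step.
  move/(_ yn); rewrite /= rkn; have := rke y.1.
  by move: (h y yz); case: y {yz yn} => e [] //= _ lt; rewrite leqNgt lt.
case: (arg_minnP rk (porbit_id nx z)) => y yz /(_ (nx y)).
have yn : nx y \in porbit nx z by rewrite mem_porbit_step.
move/(_ yn); rewrite /= rkn; have := rke y.1.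
by move: (h y yz); case: y {yz yn} => e [] //= _ lt; rewrite leqNgt lt.
Qed.

Let UD := [pred d : E * bool | d.2 && ~~ (r d).2].
Let DU := [pred d : E * bool | ~~ d.2 && (r d).2].
Let fDU := [pred d : E * bool | ~~ d.2 && (nx d).2].
Let fUD := [pred d : E * bool | d.2 && ~~ (nx d).2].
Let inner := porbits r :\ porbit r s :\ porbit r n.

Let inner_mem P : P \in inner -> exists d,
  [/\ P = porbit r d, d \notin porbit r s & d \notin porbit r n].
Proof.
rewrite !inE => /and3P[Pn Ps /imsetP[d _ Pd]]; exists d.
by rewrite -!eq_porbit_mem -Pd.
Qed.

Let inner_UD P : P \in inner -> exists2 d, P = porbit r d & d \in UD.
Proof.
case/inner_mem => d [-> /(core_src_only c)[x xd xf] /(core_snk_only c)[y yd yt]].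
have: x \in porbit r y by rewrite porbit_sym in yd; apply: porbit_trans yd.
case/(porbit_transition (f := snd))=> // z zy zUD; exists z => //.
by apply/eqP; rewrite eq_sym eq_porbit_mem; apply: porbit_trans yd.
Qed.

Let inner_DU P : P \in inner -> exists2 d, P = porbit r d & d \in DU.
Proof.
case/inner_mem => d [-> /(core_src_only c)[x xd xf] /(core_snk_only c)[y yd yt]].
have: y \in porbit r x by rewrite porbit_sym in xd; apply: porbit_trans xd.
case/(porbit_transition (f := fun d => ~~ d.2)); rewrite ?negbK // => z zy.
rewrite negbK => zUD; exists z => //.
by apply/eqP; rewrite eq_sym eq_porbit_mem; apply: porbit_trans xd.
Qed.

Let faces_UD P : P \in porbits nx -> exists2 d, P = porbit nx d & d \in fUD.
Proof.
case/imsetP => d _ ->.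
have [x xd xt] := face_not_constant false d; have [y yd yt] := face_not_constant true d.
have: y \in porbit nx x by rewrite porbit_sym in xd; apply: porbit_trans xd.
case/(porbit_transition (f := snd)); first by case: (x.2) xt.
  by case: (y.2) yt.
move=> z zy zUD; exists z => //.
by apply/eqP; rewrite eq_sym eq_porbit_mem; apply: porbit_trans xd.
Qed.

Let faces_DU P : P \in porbits nx -> exists2 d, P = porbit nx d & d \in fDU.
Proof.
case/imsetP => d _ ->.
have [x xd xt] := face_not_constant true d; have [y yd yt] := face_not_constant false d.
have: y \in porbit nx x by rewrite porbit_sym in xd; apply: porbit_trans xd.
case/(porbit_transition (f := fun d => ~~ d.2)); first by case: (x.2) xt.
  by case: (y.2) yt.
move=> z zy; rewrite negbK => zUD; exists z => //.
by apply/eqP; rewrite eq_sym eq_porbit_mem; apply: porbit_trans xd.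
Qed.

Let card_inner : #|porbits r| <= #|inner| + 2.
Proof.
have h (A : {set {set E * bool}}) x : #|A| <= #|A :\ x| + 1.
  by rewrite (cardsD1 x A) addnC leq_add2l; case: (x \in A).
apply: leq_trans (h _ (porbit r s)) _; rewrite -[2]/(1 + 1) addnA leq_add2r.
exact: h.
Qed.

(** The corner between [d'] and [r d'] is a turn of the face exactly when both darts point the same
    way, since the face arrives along the reverse of [r d']. So every corner is counted once, and
    there are as many corners as darts. *)
Let card_corners : #|UD| + #|DU| + (#|fUD| + #|fDU|) = #|E| + #|E|.
Proof.
have -> : #|fUD| = #|[pred d : E * bool | ~~ d.2 && ~~ (r d).2]|.
  rewrite -(card_image (@perm_inj _ nx)); apply: eq_card => d.
  rewrite -[d](permKV nx) mem_image ?inE; last exact: perm_inj.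
  by rewrite next_in_faceE /= negbK andbC.
have -> : #|fDU| = #|[pred d : E * bool | d.2 && (r d).2]|.
  rewrite -(card_image (@perm_inj _ nx)); apply: eq_card => d.
  rewrite -[d](permKV nx) mem_image ?inE; last exact: perm_inj.
  by rewrite next_in_faceE /= andbC.
have -> : #|E| + #|E| = #|{: E * bool}| by rewrite card_prod card_bool muln2 addnn.
rewrite -(cardC [pred d : E * bool | d.2 == (r d).2]) addnC; congr (_ + _).
  rewrite addnC -cardUI [X in _ + X]eq_card0 ?addn0; last first.
    by move=> d; rewrite !inE; case: (d.2); case: ((r d).2).
  by apply: eq_card => d; rewrite !inE; case: (d.2); case: ((r d).2).
rewrite -cardUI [X in _ + X]eq_card0 ?addn0; last first.
  by move=> d; rewrite !inE; case: (d.2); case: ((r d).2).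
by apply: eq_card => d; rewrite !inE; case: (d.2); case: ((r d).2).
Qed.

(** The four lower bounds add up to at least 2(|V| - 2 + |F|) = 2|E|, which is the number of
    corners, so all of them are attained. *)
Let tight : [/\ #|UD| <= #|inner|, #|fUD| <= #|porbits nx|
  & #|fDU| <= #|porbits nx|].
Proof.
have h1 : #|inner| <= #|UD| := leq_card_orbits inner_UD.
have h2 : #|inner| <= #|DU| := leq_card_orbits inner_DU.
have h3 : #|porbits nx| <= #|fUD| := leq_card_orbits faces_UD.
have h4 : #|porbits nx| <= #|fDU| := leq_card_orbits faces_DU.
have h5 := core_genus c; move: card_corners card_inner => h6 h7.
split; lia.
Qed.

(** Counterclockwise around a vertex, an upward dart followed by a downward one is the westernmost
    upward dart. This uniqueness is what identifies darts when a move is undone. *)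
Lemma vertex_up_down d d' : d' \in porbit r d ->
  d.2 -> ~~ (r d).2 -> d'.2 -> ~~ (r d').2 -> d' = d.
Proof.
rewrite -eq_porbit_mem => /eqP dd' h1 h2 h3 h4; have [t _ _] := tight.
by apply: (eq_card_orbits inner_UD t) dd'; rewrite inE ?h1 ?h3.
Qed.

Lemma face_up_down d d' : d' \in porbit nx d ->
  d.2 -> ~~ (nx d).2 -> d'.2 -> ~~ (nx d').2 -> d' = d.
Proof.
rewrite -eq_porbit_mem => /eqP dd' h1 h2 h3 h4; have [_ t _] := tight.
by apply: (eq_card_orbits faces_UD t) dd'; rewrite inE ?h1 ?h3.
Qed.

Lemma face_down_up d d' : d' \in porbit nx d ->
  ~~ d.2 -> (nx d).2 -> ~~ d'.2 -> (nx d').2 -> d' = d.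
Proof.
rewrite -eq_porbit_mem => /eqP dd' h1 h2 h3 h4; have [_ _ t] := tight.
by apply: (eq_card_orbits faces_DU t) dd'; rewrite inE ?h1 ?h3.
Qed.

End Corners.

(** * The surgeries *)

Lemma tperm_if (T : finType) (x y z : T) :
  tperm x y z = if z == x then y else if z == y then x else z.
Proof. by rewrite permE. Qed.

Notation nx := (@next_in_face _).

Section Surgeries.
Variable E : finType.
Implicit Types (r : {perm (E * bool)}) (d : E * bool).

Definition top_rot n r := insert_after (old n) new_up (lift_rot r).
Definition chord_rot a b r :=
  insert_after (old a) new_down (insert_after (old b) new_up (lift_rot r)).
Definition split_rot a r :=
  insert_after (old a) new_up (lift_rot r ^ tperm (old a) new_down)%g.

Definition liftE := (lift_rot_old, lift_rot_new_up, lift_rot_new_down).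

Lemma top_rot_old n r d :
  top_rot n r (old d) = if d == n then new_up else old (r d).
Proof. by rewrite permM tperm_if !newE; case: eqP; rewrite liftE. Qed.
Lemma top_rot_up n r : top_rot n r new_up = old (r n).
Proof. by rewrite permM tpermR liftE. Qed.
Lemma top_rot_down n r : top_rot n r new_down = new_down.
Proof. by rewrite permM tperm_if !newE liftE. Qed.
Definition top_rotE := (top_rot_old, top_rot_up, top_rot_down).

Lemma chord_rot_old a b r d : chord_rot a b r (old d) =
  if d == a then new_down else if d == b then new_up else old (r d).
Proof.
rewrite permM tperm_if !newE; case: eqP => _; rewrite permM tperm_if !newE ?liftE //.
by case: eqP => _; rewrite liftE.
Qed.
Lemma chord_rot_up a b r : chord_rot a b r new_up = old (r b).
Proof. by rewrite permM tperm_if !newE permM tpermR liftE. Qed.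
Lemma chord_rot_down a b r : a != b -> chord_rot a b r new_down = old (r a).
Proof. by move=> ab; rewrite permM tpermR permM tperm_if !newE (negPf ab) liftE. Qed.

Lemma split_rot_old a r d : split_rot a r (old d) =
  if d == a then new_up else if r d == a then new_down else old (r d).
Proof.
rewrite permM tperm_if !newE; case: (eqVneq d a) => [_|da].
  by rewrite conjgE !permM tpermV !tperm_if !newE liftE !newE.
rewrite conjgE !permM tpermV [X in lift_rot r X]tperm_if !newE (negPf da) liftE.
by rewrite tperm_if !newE.
Qed.
Lemma split_rot_up a r : split_rot a r new_up = old a.
Proof.
rewrite permM tpermR conjgE !permM tpermV tpermL liftE tpermR.
by [].
Qed.
Lemma split_rot_down a r :
  split_rot a r new_down = if r a == a then new_down else old (r a).
Proof.
rewrite permM tperm_if !newE conjgE !permM tpermV tpermR liftE tperm_if !newE.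
by [].
Qed.

Lemma next_top_old n r d : nx (top_rot n r) (old d) =
  if nx r d == n then new_up else old (nx r d).
Proof.
apply/eqP; rewrite next_in_face_eq; case: (eqVneq (nx r d) n) => [<-|h].
  by rewrite top_rotE next_in_faceE.
by rewrite top_rotE (negPf h) next_in_faceE.
Qed.
Lemma next_top_up n r : nx (top_rot n r) new_up = new_down.
Proof. by apply/eqP; rewrite next_in_face_eq top_rotE. Qed.
Lemma next_top_down n r : nx (top_rot n r) new_down = old n.
Proof. by apply/eqP; rewrite next_in_face_eq top_rotE eqxx. Qed.

Section NextChord.
Variables (r : {perm (E * bool)}) (a b : E * bool).
Hypothesis ab : a != b.
Lemma next_chord_old d : nx (chord_rot a b r) (old d) =
  if nx r d == a then new_down else if nx r d == b then new_up else old (nx r d).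
Proof.
apply/eqP; rewrite next_in_face_eq; case: (eqVneq (nx r d) a) => [h|ha].
  by rewrite chord_rot_down // -h next_in_faceE.
case: (eqVneq (nx r d) b) => [<-|hb]; first by rewrite chord_rot_up next_in_faceE.
by rewrite chord_rot_old (negPf ha) (negPf hb) next_in_faceE.
Qed.
Lemma next_chord_up : nx (chord_rot a b r) new_up = old a.
Proof. by apply/eqP; rewrite next_in_face_eq chord_rot_old eqxx. Qed.
Lemma next_chord_down : nx (chord_rot a b r) new_down = old b.
Proof.
by apply/eqP; rewrite next_in_face_eq chord_rot_old [b == a]eq_sym (negPf ab) eqxx.
Qed.
End NextChord.

Lemma flip_neq d : (flip d == d) = false.
Proof. by case: d => e [] /=; rewrite /flip /= xpair_eqE andbF. Qed.

Lemma flip_eq (d d' : E * bool) : (flip d == flip d') = (d == d').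
Proof. exact: (inj_eq (inv_inj (@flipK E))). Qed.

Lemma next_split_old a r d : nx (split_rot a r) (old d) =
  if d == flip a then new_up else
  if nx r d == a then new_down else old (nx r d).
Proof.
apply/eqP; rewrite next_in_face_eq; case: (eqVneq d (flip a)) => [->|da].
  by rewrite split_rot_up flip_old flipK.
have fd : flip d != a by apply: contraNneq da => <-; rewrite flipK.
case: (eqVneq (nx r d) a) => [h|ha].
  have ra : r a = flip d by rewrite -h next_in_faceE.
  by rewrite split_rot_down ra (negPf fd).
by rewrite split_rot_old (negPf ha) next_in_faceE (negPf fd).
Qed.
Lemma next_split_up a r : nx (split_rot a r) new_up =
  if nx r (flip a) == a then new_down else old (nx r (flip a)).
Proof.
apply/eqP; rewrite next_in_face_eq; case: (eqVneq (nx r (flip a)) a) => [h|ha].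
  have ra : r a = a by rewrite -{1}h next_in_faceE flipK.
  by rewrite split_rot_down ra eqxx.
by rewrite split_rot_old (negPf ha) next_in_faceE flipK eqxx.
Qed.
Lemma next_split_down a r : nx (split_rot a r) new_down = old a.
Proof. by apply/eqP; rewrite next_in_face_eq split_rot_old eqxx. Qed.

(** Contracts the new edge into the old map: each new dart goes to an old dart at the vertex where
    it is attached. For a pendant edge both go to the pole, for a chord they go to its two
    corners. *)
Definition collapse (u v : E * bool) (x : option E * bool) :=
  if x is (Some e, b) then (e, b) else if x.2 then u else v.

Lemma collapse_old u v d : collapse u v (old d) = d. Proof. by case: d. Qed.
Lemma collapse_up u v : collapse u v new_up = u. Proof. by []. Qed.
Lemma collapse_down u v : collapse u v new_down = v. Proof. by []. Qed.
Definition collapseE := (collapse_old, collapse_up, collapse_down).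

Lemma vertex_top_old n r y z :
  (old y \in porbit (top_rot n r) (old z)) = (y \in porbit r z).
Proof. by rewrite porbit_insert ?liftE ?newE // porbit_lift_old. Qed.
Lemma vertex_top_up n r z :
  (new_up \in porbit (top_rot n r) (old z)) = (n \in porbit r z).
Proof. by rewrite porbit_insert ?liftE ?newE // eqxx porbit_lift_old. Qed.
Lemma vertex_top_down n r y :
  (y \in porbit (top_rot n r) new_down) = (y == new_down).
Proof. by rewrite porbit_fix // top_rotE. Qed.
Lemma vertex_top_downr n r z :
  (new_down \in porbit (top_rot n r) (old z)) = false.
Proof. by rewrite porbit_sym vertex_top_down newE. Qed.

Lemma vertex_chord r a b y z : (y \in porbit (chord_rot a b r) z) =
  (collapse b a y \in porbit r (collapse b a z)).
Proof.
have h x : (if (if x == new_down then old a else x) == new_up then old b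
  else if x == new_down then old a else x) = old (collapse b a x).
  by case: (new_dartP x) => [d||]; rewrite !newE ?eqxx ?newE ?collapseE.
rewrite porbit_insert ?newE //; last by rewrite permM tperm_if !newE liftE.
by rewrite porbit_insert ?newE ?liftE // !h porbit_lift_old.
Qed.

(** The dart that takes the place of [d] after a split: [new_down] replaces [a] at the upper vertex,
    while [old a] moves to the subdividing vertex. *)
Definition swap a d : option E * bool := if d == a then new_down else old d.

Lemma swap_tperm a d : swap a d = tperm (old a) new_down (old d).
Proof. by rewrite tperm_if !newE. Qed.

Lemma vertex_split r a y z :
  (swap a y \in porbit (split_rot a r) (swap a z)) = (y \in porbit r z).
Proof.
have fx : (lift_rot r ^ tperm (old a) new_down)%g new_up = new_up.
  by rewrite conjgE !permM tpermV !tperm_if !newE liftE !newE.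
rewrite porbit_insert ?newE //.
have h x : (swap a x == new_up) = false by rewrite /swap; case: ifP; rewrite ?newE.
rewrite !h -porbit_lift_old !swap_tperm.
rewrite (@porbit_inj _ _ (lift_rot r) _ (tperm (old a) new_down)) ?mem_imset //;
  try exact: perm_inj.
by move=> x; rewrite conjgE !permM tpermV tpermK.
Qed.

Lemma vertex_split_new r a y :
  (y \in porbit (split_rot a r) (old a)) = (y == old a) || (y == new_up).
Proof.
apply/idP/idP => [|/orP[]/eqP->]; last 2 first.
- exact: porbit_id.
- by have := porbit_step (split_rot a r) (old a); rewrite split_rot_old eqxx.
case/porbitP => i ->; elim: i => [|i IH]; first by rewrite expg0 perm1 eqxx.
rewrite expgSr permM; case/orP: IH => /eqP->.
  by rewrite split_rot_old !eqxx orbT.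
by rewrite split_rot_up eqxx.
Qed.

(** Case analysis by vertices: a dart of the split map is at an old vertex, or is one of the two
    darts of the subdividing vertex. *)
Variant split_spec a : option E * bool -> Type :=
| SplitSwap d : split_spec a (swap a d)
| SplitOld : split_spec a (old a)
| SplitNew : split_spec a new_up.

Lemma split_dartP a x : split_spec a x.
Proof.
case: (new_dartP x) => [d||]; last 2 first.
- by constructor.
- by have := SplitSwap a a; rewrite /swap eqxx.
case: (eqVneq d a) => [->|da]; first by constructor.
by have := SplitSwap a d; rewrite /swap (negPf da).
Qed.

Lemma swap_dir a d : ~~ a.2 -> (swap a d).2 = d.2.
Proof. by rewrite /swap; case: eqP => // -> /negPf->. Qed.

Lemma card_vertices_top n r : #|porbits (top_rot n r)| = #|porbits r| + 1.
Proof.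
have := card_porbits_insert (d := old n) (lift_rot_new_up r) isT.
by rewrite -/(insert_after _ _ _) -/(top_rot n r) card_porbits_lift; lia.
Qed.

(** Both new darts are inserted into the face of the corner at [n]: lifting adds two cycles and the
    two insertions absorb them. *)
Lemma card_faces_top n r : #|porbits (nx (top_rot n r))| = #|porbits (nx r)|.
Proof.
have e : (nx (top_rot n r))^-1%g = (tperm (old n) new_down *
    (tperm (old n) new_up * lift_rot (nx r)^-1))%g.
  rewrite !next_in_faceV; apply/permP => x; rewrite permM [flip_perm _ _]permE.
  case: (new_dartP x) => [d||]; rewrite ?top_rotE.
  - case: (eqVneq d n) => [->|dn]; rewrite permM tperm_if !newE ?eqxx ?(negPf dn).
      by rewrite permM tperm_if !newE liftE.
    by rewrite permM tperm_if !newE (negPf dn) liftE permM permE.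
  - by rewrite permM tperm_if !newE permM tpermR liftE permM permE.
  by rewrite permM tpermR permM tpermL liftE.
have h2 := card_porbits_insert (d := old n) (lift_rot_new_up (nx r)^-1) isT.
have h1 := @card_porbits_insert _ (tperm (old n) new_up * lift_rot (nx r)^-1)%g
  (old n) new_down.
rewrite -porbitsV e -[in RHS]porbitsV.
rewrite permM tperm_if !newE liftE in h1; have {}h1 := h1 erefl isT.
by move: h2; rewrite card_porbits_lift -h1 addn2 => -[].
Qed.

Lemma card_vertices_chord r a b :
  #|porbits (chord_rot a b r)| = #|porbits r|.
Proof.
have h2 := card_porbits_insert (d := old b) (lift_rot_new_up r) isT.
have h1 := @card_porbits_insert _ (tperm (old b) new_up * lift_rot r)%g
  (old a) new_down.
rewrite permM tperm_if !newE liftE in h1; have {}h1 := h1 erefl isT.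
by rewrite card_porbits_lift in h2; rewrite /chord_rot /insert_after; lia.
Qed.

(** Two of the three transpositions absorb the new darts into the face of [b]. The third joins two
    darts of that same face, because [a] lies on it, and so cuts it in two. *)
Lemma card_faces_chord r a b : a != b -> a \in porbit (nx r) b ->
  #|porbits (nx (chord_rot a b r))| = #|porbits (nx r)|.+1.
Proof.
move=> ab abF; have ba : (b == a) = false by rewrite eq_sym (negPf ab).
pose L := lift_rot (nx r)^-1.
have e : (nx (chord_rot a b r))^-1%g = (tperm (old a) new_down *
    (tperm (old b) new_down * (tperm (old b) new_up * L)))%g.
  rewrite !next_in_faceV; apply/permP => x; rewrite permM [flip_perm _ _]permE.
  case: (new_dartP x) => [d||]; rewrite ?(chord_rot_old, chord_rot_up, chord_rot_down) //.
  - case: (eqVneq d a) => [->|da].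
      by rewrite /L !permM !(tpermL, tpermR, tperm_if, newE, eqxx, liftE).
    case: (eqVneq d b) => [->|db]; rewrite /L !permM.
      by rewrite !(tpermL, tperm_if, newE, eqxx, ba, liftE).
    by rewrite !(tperm_if, newE, negPf da, negPf db) liftE next_in_faceV permM permE.
  - by rewrite /L !permM !(tpermR, tperm_if, newE) liftE next_in_faceV permM permE.
  by rewrite /L !permM tpermR !(tperm_if, newE, negPf ab) liftE next_in_faceV permM permE.
have Lu : L new_up = new_up by rewrite liftE.
have r2d : (tperm (old b) new_up * L)%g new_down = new_down.
  by rewrite permM tperm_if !newE liftE.
have h2 := card_porbits_insert (d := old b) Lu isT.
have h1 := card_porbits_insert (d := old b) r2d isT.
rewrite -porbitsV e card_porbits_split ?newE //.
  by move: h2; rewrite card_porbits_lift porbitsV -h1 addn2 => -[->].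
rewrite porbit_insert ?newE // eqxx porbit_insert ?newE //.
by rewrite porbit_lift_old porbitV.
Qed.

Lemma card_vertices_split r a : #|porbits (split_rot a r)| = #|porbits r| + 1.
Proof.
have fx : (lift_rot r ^ tperm (old a) new_down)%g new_up = new_up.
  by rewrite conjgE !permM tpermV !tperm_if !newE liftE !newE.
have := card_porbits_insert (d := old a) fx isT.
rewrite -/(insert_after _ _ _) -/(split_rot a r).
rewrite (@card_porbits_bij _ _ (lift_rot r) (lift_rot r ^ tperm (old a) new_down)%g
  (tperm (old a) new_down)).
- by rewrite card_porbits_lift addn2 addn1 => -[].
- by apply: injF_bij; apply: perm_inj.
by move=> x; rewrite conjgE !permM tpermV tpermK.
Qed.

(** Each of the two faces along the split edge receives one new dart, so here one transposition
    stands on each side of the face permutation; inverting moves the right one to the left. *)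
Lemma card_faces_split r a :
  #|porbits (nx (split_rot a r))| = #|porbits (nx r)|.
Proof.
have e : nx (split_rot a r) = (tperm (old (flip a)) new_up * lift_rot (nx r) *
    tperm (old a) new_down)%g.
  apply/permP => x; rewrite [RHS]permM [(_ * lift_rot _)%g _]permM
    (tperm_if (old (flip a)) new_up).
  case: (new_dartP x) => [d||]; rewrite ?(next_split_old, next_split_up, next_split_down).
  - rewrite !newE; case: eqP => _; first by rewrite liftE tperm_if !newE.
    by rewrite liftE tperm_if !newE.
  - by rewrite !newE eqxx liftE tperm_if !newE.
  by rewrite !newE liftE tpermR.
set s := (tperm _ _ * _)%g in e.
have sd : s^-1%g new_down = new_down.
  by apply/eqP; rewrite -(inj_eq (@perm_inj _ s)) permKV permM tperm_if !newE liftE.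
have h1 := card_porbits_insert (d := old a) sd isT.
have h2 := card_porbits_insert (d := old (flip a)) (lift_rot_new_up (nx r)) isT.
rewrite -porbitsV e invMg tpermV.
by move: h2; rewrite -/s -(porbitsV s) -h1 card_porbits_lift addn2 => -[].
Qed.

End Surgeries.

Arguments collapse : simpl never.
Arguments old : simpl never.

(** * Surgeries preserve and reflect bipolarity *)

Section CoreSurgeries.
Variable E : finType.
Implicit Types (r : {perm (E * bool)}) (d s n a b : E * bool).

Lemma old_eta (e : E) (b : bool) : (Some e, b) = old (e, b). Proof. by []. Qed.
Lemma up_eta : (None, true) = new_up :> option E * bool. Proof. by []. Qed.
Lemma down_eta : (None, false) = new_down :> option E * bool. Proof. by []. Qed.
Definition etaE := (old_eta, up_eta, down_eta).

(** After the surgery the old pole is an inner vertex, so the hypothesis that it was a sink has to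
    come from elsewhere; [good_untop] gets it from the uniqueness of up-down corners. *)
Lemma core_top r s n : s.2 -> (forall x, x \in porbit r n -> ~~ x.2) ->
  core (top_rot n r) (old s) new_down <-> core r s n.
Proof.
move=> su nd; split=> -[c1 c2 [rk c3 c3'] c4 c5 c6 c7]; split.
- move=> P Pr Pf d x; have := c1 (P \o collapse n n) _ _ (old d) (old x).
  rewrite /= !collapseE; apply => y /=.
    case: (new_dartP y) => [z||]; rewrite top_rotE ?collapseE ?Pr //.
    by case: eqP => [->|_]; rewrite ?collapseE ?Pr.
  by case: (new_dartP y) => [z||] //; rewrite flip_old ?collapseE ?Pf.
- by move: c2; rewrite card_vertices_top card_faces_top card_option; lia.
- exists (fun d => rk (old d)) => [d|e]; last exact: (c3' (Some e)).
  have := c3 (old d); rewrite top_rotE; case: eqP => [-> |//].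
  by have := c3 new_up; rewrite top_rotE => -> ->.
- by move=> x xs; apply: (c4 (old x)); rewrite vertex_top_old.
- move=> d ds; case: (c5 (old d)); first by rewrite vertex_top_old.
  move=> x; case: (new_dartP x) => [y||]; rewrite ?vertex_top_downr ?vertex_top_old //.
  by exists y.
- exact: nd.
- move=> d dn; case: (c7 (old d)); first by rewrite vertex_top_down newE.
  move=> x; case: (new_dartP x) => [y||]; rewrite ?vertex_top_downr ?vertex_top_old //.
    by exists y.
  by rewrite vertex_top_up porbit_sym (negPf dn).
- move=> P Pr Pf.
  have P1 : P new_up = P (old n) by rewrite -(Pr (old n)) top_rotE eqxx.
  have P2 : P new_down = P (old n) by rewrite -P1 -flip_new_up Pf.
  suff h x : P x = P (old n) by move=> d x; rewrite !h.
  case: (new_dartP x) => [d||] //;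
    apply: (c1 (P \o @old E) _ _ d n) => y /=; last exact: (Pf (old y)).
  rewrite -(Pr (old y)) top_rotE; case: eqP => [-> |//].
  by rewrite -(Pr new_up) top_rotE.
- by rewrite card_vertices_top card_faces_top card_option; lia.
(* The new top vertex is one above the old pole; all other heights are kept. *)
- exists (fun x => if x == new_down then (rk n).+1 else rk (collapse n n x)) => [x|[e|]].
  + case: (new_dartP x) => [d||]; rewrite top_rotE ?newE ?collapseE ?c3 ?eqxx //.
    by case: (eqVneq d n) => [->|_]; rewrite ?newE ?collapseE ?c3.
  + by rewrite !etaE !newE !collapseE c3'.
  by rewrite !etaE !newE eqxx collapseE.
- move=> x; case: (new_dartP x) => [d||]; rewrite ?vertex_top_downr //.
  by rewrite vertex_top_old; apply: c4.
- move=> x; case: (new_dartP x) => [d||].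
  + rewrite vertex_top_old => /c5[y yd yf]; exists (old y) => //.
    by rewrite vertex_top_old.
  + exists (old n); last by apply: nd; apply: porbit_id.
    by rewrite porbit_sym vertex_top_up porbit_id.
  + by exists new_down; rewrite ?porbit_id.
- by move=> x; rewrite vertex_top_down => /eqP->.
- move=> x; case: (new_dartP x) => [d||].
  + move=> _; case: (boolP (d \in porbit r n)) => [dn|/c7[y yd yf]]; last first.
      by exists (old y); rewrite ?vertex_top_old.
    by exists new_up; rewrite // vertex_top_up porbit_sym.
  + by exists new_up; rewrite ?porbit_id.
  + by rewrite porbit_id.
Qed.

(* The chord from b up to a will cut a :: B off the outer face. *)
Definition descends r a B b :=
  [/\ all (fun d => ~~ d.2) (a :: B), fpath (nx r) a B & nx r (last a B) = b].

Lemma descends_rank r a B b (rk : E * bool -> nat) : descends r a B b ->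
  (forall d, rk (r d) = rk d) -> (forall e, rk (e, true) < rk (e, false)) ->
  rk b < rk a.
Proof.
move=> [hd hp hb] rkr rke.
have step d : ~~ d.2 -> rk (nx r d) < rk d.
  rewrite -rkr next_in_faceE; case: d => e [] //= _; exact: rke.
elim: B a hd hp hb => [|c B IH] a /=; first by rewrite andbT => /step ? _ <-.
case/and3P => /step ac cd cB /andP[/eqP ca pB] hb; rewrite ca in ac.
by apply: ltn_trans ac; apply: IH; rewrite //= cd.
Qed.

Lemma descends_conn r a B b (P : pred (E * bool)) : descends r a B b ->
  (forall d, P (r d) = P d) -> (forall d, P (flip d) = P d) -> P a = P b.
Proof.
case=> _ pB <- Pr Pf.
have step d : P (nx r d) = P d by rewrite -Pr next_in_faceE Pf.
rewrite step; elim: B a pB => [|c B IH] a //= /andP[/eqP <- /IH <-].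
by rewrite step.
Qed.

Lemma descends_face r a B b : descends r a B b -> a \in porbit (nx r) b.
Proof.
case=> _ pB <-; rewrite porbit_sym mem_porbit_step.
elim: B a pB => [|c B IH] a /=; first by rewrite porbit_id.
by case/andP => /eqP <- /IH; rewrite mem_porbit_stepr.
Qed.

Lemma descends_up r a B b : descends r a B b -> (r b).2.
Proof.
case=> /allP dn pB <-; rewrite next_in_faceE /=; apply: dn.
exact: mem_last.
Qed.

(** The descending path stands in for the chord: it connects the same two vertices, keeps the lower
    one strictly below the upper one in rank, and puts both corners on one face. When the chord is
    removed, [a] and [r b] still give its ends a downward and an upward dart. *)
Lemma core_chord r s n a b B : a != b -> s.2 -> descends r a B b ->
  core (chord_rot a b r) (old s) (if a == n then new_down else old n) <-> core r s n.
Proof.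
move=> ab su H; have aF := descends_face H; have bU := descends_up H.
have ad : ~~ a.2 by case: H => /andP[].
have V := vertex_chord r a b.
have Vn x : (x \in porbit (chord_rot a b r) (if a == n then new_down else old n))
    = (collapse b a x \in porbit r n).
  by rewrite V; case: eqP => [->|_]; rewrite collapseE.
have rb z : b \in porbit r z -> r b \in porbit r z by rewrite mem_porbit_step.
split=> -[c1 c2 [rk c3 c3'] c4 c5 c6 c7]; split.
- move=> P Pr Pf d x; have Pab := descends_conn H Pr Pf.
  have := c1 (P \o collapse b a) _ _ (old d) (old x).
  rewrite /= !collapseE; apply => y /=.
    case: (new_dartP y) => [z||]; rewrite ?chord_rot_up ?chord_rot_down ?collapseE ?Pr //.
    rewrite chord_rot_old; case: eqP => [->|_]; rewrite ?collapseE //.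
    by case: eqP => [->|_]; rewrite ?collapseE ?Pr.
  case: (new_dartP y) => [z||]; rewrite ?flip_old ?flip_new_up ?flip_new_down ?collapseE //.
- move: c2; rewrite card_vertices_chord card_faces_chord // card_option; lia.
- exists (fun d => rk (old d)) => [d|e]; last exact: (c3' (Some e)).
  have := c3 (old d); rewrite chord_rot_old; case: eqP => [->|_].
    by have := c3 new_down; rewrite chord_rot_down // => -> ->.
  case: eqP => [->|//].
  by have := c3 new_up; rewrite chord_rot_up => -> ->.
- by move=> x xs; apply: (c4 (old x)); rewrite V !collapseE.
- move=> d ds; case: (c5 (old d)); first by rewrite V !collapseE.
  move=> x; case: (new_dartP x) => [y||] //; rewrite V !collapseE; first by exists y.
  by move=> ax _; exists a.
- by move=> x xn; apply: (c6 (old x)); rewrite Vn collapseE.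
- move=> d dn; case: (c7 (old d)).
    by move: dn; rewrite porbit_sym [_ \in porbit (chord_rot _ _ _) _]porbit_sym V
      !(fun_if (collapse b a)) !collapseE; case: eqP => [->|].
  move=> x; case: (new_dartP x) => [y||] //; rewrite V !collapseE; first by exists y.
  by move/rb => bx _; exists (r b).
- move=> P Pr Pf.
  have P1 : P new_up = P (old b).
    by rewrite -(Pr (old b)) chord_rot_old eq_sym (negPf ab) eqxx.
  have P2 : P new_down = P (old a) by rewrite -(Pr (old a)) chord_rot_old eqxx.
  have h d d' : P (old d) = P (old d').
    apply: (c1 (P \o @old E) _ _ d d') => y /=; last exact: (Pf (old y)).
    rewrite -(Pr (old y)) chord_rot_old; case: eqP => [->|_].
      by rewrite -(Pr new_down) chord_rot_down.
    by case: eqP => [->|//]; rewrite -(Pr new_up) chord_rot_up.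
  suff h' x : P x = P (old a) by move=> d x; rewrite !h'.
  by case: (new_dartP x) => [d||]; rewrite ?P1 ?P2.
- rewrite card_vertices_chord card_faces_chord // card_option; lia.
- have Hr := descends_rank H c3 c3'.
  exists (rk \o collapse b a) => [x|[e|]] /=.
  + case: (new_dartP x) => [d||]; rewrite ?chord_rot_up ?chord_rot_down ?collapseE ?c3 //.
    rewrite chord_rot_old; case: eqP => [->|_]; rewrite ?collapseE //.
    by case: eqP => [->|_]; rewrite ?collapseE ?c3.
  + exact: c3'.
  + exact: Hr.
- move=> x; rewrite V collapseE; case: (new_dartP x) => [d||] //; rewrite ?collapseE.
    by apply: c4.
  by move/c4; rewrite (negPf ad).
- move=> x; rewrite V collapseE => /c5[y yx yd]; exists (old y) => //.
  by rewrite V collapseE.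
- move=> x; rewrite Vn; case: (new_dartP x) => [d||] //; rewrite ?collapseE.
    by apply: c6.
  by move=> /rb /c6; rewrite bU.
- move=> x; rewrite Vn => /c7[y yx yd]; exists (old y) => //.
  by rewrite V collapseE.
Qed.

(** [swap] carries every old vertex along with the directions of its darts. The subdividing vertex
    has one downward and one upward dart, so it is neither a source nor a sink. *)
Lemma core_split r s n a : s.2 -> ~~ a.2 ->
  core (split_rot a r) (old s) (swap a n) <-> core r s n.
Proof.
move=> su ad; have V := vertex_split r a.
have sw d := @swap_dir E a d ad.
have swN z : (swap a z == old a) || (swap a z == new_up) = false.
  by rewrite /swap; case: (eqVneq z a) => [_|za]; rewrite !newE // (negPf za).
have VN z : (swap a z \in porbit (split_rot a r) (old a)) = false.
  by rewrite vertex_split_new swN.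
have Vn x : (x \in porbit (split_rot a r) new_up) = (x \in porbit (split_rot a r) (old a)).
  have := @mem_porbit_stepr _ (split_rot a r) x (old a).
  by rewrite split_rot_old eqxx.
have -> : old s = swap a s.
  by rewrite /swap; case: eqP su ad => // -> ->.
have rswap d : split_rot a r (swap a d) = swap a (r d).
  rewrite /swap; case: (eqVneq d a) => [->|da]; first by rewrite split_rot_down.
  by rewrite split_rot_old (negPf da).
have fa : (flip a).2 by [].
have ae : a = (a.1, false) by case: (a) ad => e [].
have et e : ((e, true) == a) = false by rewrite ae xpair_eqE andbF.
split=> -[c1 c2 [rk c3 c3'] c4 c5 c6 c7]; split.
- move=> P Pr Pf d x; have := c1 (P \o collapse a a) _ _ (swap a d) (swap a x).
  have cs y : collapse a a (swap a y) = y.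
    by rewrite /swap; case: eqP => [->|_]; rewrite collapseE.
  rewrite /= !cs; apply => y /=.
    case: (split_dartP a y) => [z||]; first by rewrite rswap !cs Pr.
      by rewrite split_rot_old eqxx !collapseE.
    by rewrite split_rot_up !collapseE.
  case: (new_dartP y) => [z||]; rewrite ?flip_old ?flip_new_up ?flip_new_down ?collapseE //.
- by move: c2; rewrite card_vertices_split card_faces_split card_option; lia.
- exists (fun d => rk (swap a d)) => [d|e]; first by rewrite -rswap c3.
  rewrite /swap et; case: (eqVneq (e, false) a) => [h|_]; last exact: (c3' (Some e)).
  have := c3' None; have := c3' (Some e); rewrite !etaE h.
  have := c3 (old a); rewrite split_rot_old eqxx => <-.
  exact: ltn_trans.
- by move=> x xs; rewrite -sw; apply: c4; rewrite V.
- move=> d ds; case: (c5 (swap a d)); first by rewrite V.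
  move=> x; case: (split_dartP a x) => [y||]; last 2 first.
  + by rewrite porbit_sym VN.
  + by rewrite porbit_sym Vn VN.
  by rewrite V sw; exists y.
- by move=> x xs; rewrite -sw; apply: c6; rewrite V.
- move=> d ds; case: (c7 (swap a d)); first by rewrite V.
  move=> x; case: (split_dartP a x) => [y||]; last 2 first.
  + by rewrite porbit_sym VN.
  + by rewrite porbit_sym Vn VN.
  by rewrite V sw; exists y.
- move=> P Pr Pf.
  have P1 : P new_up = P (old a) by rewrite -(Pr (old a)) split_rot_old eqxx.
  have P2 : P new_down = P (old a) by rewrite -P1 -flip_new_up Pf.
  have Ps y : P (swap a y) = P (old y) by rewrite /swap; case: eqP => [->|].
  have h d d' : P (swap a d) = P (swap a d').
    apply: (c1 (P \o swap a) _ _ d d') => y /=; first by rewrite -rswap Pr.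
    by rewrite !Ps -flip_old Pf.
  suff h' x : P x = P (old a) by move=> d x; rewrite !h'.
  by case: (split_dartP a x) => [d||] //; rewrite (h d a) Ps.
- by rewrite card_vertices_split card_faces_split card_option; lia.
(* Doubling the ranks makes room for the subdividing vertex, one below the upper end of the split
   edge. *)
- pose rk' x := if (x == old a) || (x == new_up) then (2 * rk a).-1
    else 2 * rk (collapse a a x).
  have rks d : rk' (swap a d) = 2 * rk d.
    by rewrite /rk' swN /swap; case: eqP => [->|_]; rewrite collapseE.
  have ltfa : rk (flip a) < rk a by rewrite ae; apply: c3'.
  exists rk' => [x|[e|]].
  + case: (split_dartP a x) => [d||]; first by rewrite rswap !rks c3.
      by rewrite split_rot_old eqxx /rk' eqxx orbT eqxx.
    by rewrite split_rot_up /rk' !eqxx orbT.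
  + rewrite !etaE /rk' !newE !orbF !collapseE.
    rewrite et; case: (eqVneq (e, false) a) => [h|_].
      by move: ltfa; rewrite -h /flip /=; lia.
    by have := c3' e; lia.
  + by rewrite !etaE /rk' !newE eqxx !collapseE /=; lia.
- move=> x; case: (split_dartP a x) => [d||]; last 2 first.
  + by rewrite porbit_sym VN.
  + by [].
  by rewrite V sw; apply: c4.
- move=> x; case: (split_dartP a x) => [d||]; last 2 first.
  + by exists (old a); rewrite ?porbit_id.
  + by exists (old a); rewrite // Vn porbit_id.
  by rewrite V => /c5[y yd yf]; exists (swap a y); rewrite ?V ?sw.
- move=> x; case: (split_dartP a x) => [d||].
  + by rewrite V sw; apply: c6.
  + by [].
  by rewrite porbit_sym Vn VN.
- move=> x; case: (split_dartP a x) => [d||]; last 2 first.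
  + by exists new_up; rewrite // vertex_split_new eqxx orbT.
  + by exists new_up; rewrite // porbit_id.
  by rewrite V => /c7[y yd yf]; exists (swap a y); rewrite ?V ?sw.
Qed.

End CoreSurgeries.

(** * Marked maps and their outer face *)

Notation oldS := (map (@old _)).
Notation all_up := (all (fun d : _ * bool => d.2)).
Notation all_down := (all (fun d : _ * bool => ~~ d.2)).

(* The outer face reads s :: W (western boundary, upwards), then A (missing
   eastern edges, downwards), then a :: B (the other eastern edges), so the
   lattice path is at abscissa size B.  The last two fields are the conditions
   on a missing edge: at its lower end, where it is the easternmost upward dart,
   it is the only one; and the face on its left is interior. *)
Record good (E : finType) (r : {perm (E * bool)}) (s n a : E * bool)
    (W A B : seq (E * bool)) : Prop := Good {
  good_core : core r s n;
  good_north : n = head a A;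
  good_path : fpath (nx r) s (rcons (W ++ A ++ a :: B) s);
  good_uniq : uniq (s :: W ++ A ++ a :: B);
  good_up : all_up (s :: W);
  good_down : all_down (A ++ a :: B);
  good_low : forall d, d \in A -> ~~ (r (flip d)).2;
  good_int : forall d, d \in A -> flip d \notin s :: W
}.

(** * The outer walk through a surgery *)

Section GoodSurgeries.
Variable E : finType.
Implicit Types (r : {perm (E * bool)}) (d s n a b : E * bool) (W A B p : seq (E * bool)).

Lemma all_up_old p : all_up (oldS p) = all_up p.
Proof. by rewrite all_map; apply: eq_all. Qed.

Lemma all_down_old p : all_down (oldS p) = all_down p.
Proof. by rewrite all_map; apply: eq_all. Qed.

Lemma mem_old d p : (old d \in oldS p) = (d \in p).
Proof. exact/mem_map/old_inj. Qed.

Lemma new_up_notin p : (new_up \in oldS p) = false.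
Proof. by apply/mapP => -[d _ /eqP]; rewrite newE. Qed.

Lemma new_down_notin p : (new_down \in oldS p) = false.
Proof. by apply/mapP => -[d _ /eqP]; rewrite newE. Qed.

Lemma uniq_old p : uniq (oldS p) = uniq p.
Proof. exact/map_inj_uniq/old_inj. Qed.

Lemma head_old d p : head (old d) (oldS p) = old (head d p).
Proof. by case: p. Qed.

Definition mem_oldE := (mem_old, new_up_notin, new_down_notin, uniq_old).

(** A surgery redirects only the steps that leave certain darts or enter certain darts. [P] and [Q]
    describe the others, so a walk survives on the old darts exactly when it avoids the redirected
    steps. *)
Lemma fpath_old (f : E * bool -> E * bool) f' (P Q : pred (E * bool)) :
  (forall d y, (f' (old d) == old y) = [&& f d == y, P d & Q y]) ->
  forall x p, fpath f' (old x) (oldS p) =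
    [&& fpath f x p, all P (belast x p) & all Q p].
Proof.
move=> h x p; elim: p x => [|y p IH] x //=; rewrite h IH.
by do !case: (_ == _) => //=; case: (P x) => //=; case: (Q y) => //=; rewrite ?andbF.
Qed.

Lemma next_top_eq r n d y : (nx (top_rot n r) (old d) == old y) =
  [&& nx r d == y, true & y != n].
Proof.
rewrite next_top_old /=; case: (eqVneq (nx r d) n) => [->|h].
  by rewrite newE [n == y]eq_sym andbN.
by rewrite newE; case: eqP => [<-|].
Qed.

Lemma next_chord_eq r a b d y : a != b ->
  (nx (chord_rot a b r) (old d) == old y) =
  [&& nx r d == y, true & (y != a) && (y != b)].
Proof.
move=> ab; rewrite next_chord_old //; case: (eqVneq (nx r d) a) => [->|ha].
  by rewrite newE; case: (eqVneq a y); rewrite ?andbF.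
case: (eqVneq (nx r d) b) => [->|hb].
  by rewrite newE; case: (eqVneq b y); rewrite ?andbF.
by rewrite newE; case: eqP => [<-|]; rewrite ?ha ?hb.
Qed.

Lemma next_split_eq r a d y : (nx (split_rot a r) (old d) == old y) =
  [&& nx r d == y, d != flip a & y != a].
Proof.
rewrite next_split_old; case: (eqVneq d (flip a)) => [->|h].
  by rewrite newE andbF.
case: (eqVneq (nx r d) a) => [->|ha].
  by rewrite newE; case: (eqVneq a y); rewrite ?andbF.
by rewrite newE; case: eqP => [<-|]; rewrite ?ha.
Qed.

Lemma all_neq (x : E * bool) p : all (fun y => y != x) p = (x \notin p).
Proof. by elim: p => //= y p ->; rewrite inE negb_or eq_sym. Qed.

Lemma last_old x p : last (old x) (oldS p) = old (last x p).
Proof. by rewrite last_map. Qed.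

Lemma rcons_head (T : Type) (p : seq T) y : exists t, rcons p y = head y p :: t.
Proof. by case: p => [|z p]; eexists. Qed.

Lemma all_true (T : Type) (p : seq T) : all (fun=> true) p.
Proof. by elim: p. Qed.

(** The outer walk makes a detour up and down the pendant edge. [new_up] lengthens the western
    boundary; among the surgeries used on quadrant paths only this one does so. *)
Lemma good_top r s n W B : s.2 -> (forall x, x \in porbit r n -> ~~ x.2) ->
  good (top_rot n r) (old s) new_down new_down (rcons (oldS W) new_up) [::]
    (old n :: oldS B) <-> good r s n n W [::] B.
Proof.
move=> su nd; have C := core_top su nd.
have U : uniq (old s :: rcons (oldS W) new_up ++ new_down :: old n :: oldS B)
    = uniq (s :: W ++ n :: B).
  rewrite -cat_cons -rcons_cons -cats1 -catA.
  rewrite (uniq_catCA (old s :: oldS W) [:: new_up; new_down] (oldS (n :: B))).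
  by rewrite -(map_cat (@old E) (s :: W) (n :: B)) /= -map_cons inE !mem_oldE.
(* Steps that enter [n] are redirected, so the two walks are compared under the assumption that [n]
   occurs only once. *)
suff P : uniq (s :: W ++ n :: B) ->
    fpath (nx (top_rot n r)) (old s) (rcons (rcons (oldS W) new_up ++
      new_down :: old n :: oldS B) (old s)) =
    fpath (nx r) s (rcons (W ++ n :: B) s).
  split=> -[c1 c2 c3 c4 c5 c6 c7 c8]; split=> //.
  - exact/C.
  - by rewrite -P -?U.
  - by rewrite -U.
  - by move: c5; rewrite -cats1 /= all_cat /= andbT all_up_old.
  - by move: c6; rewrite /= all_down_old.
  - exact/C.
  - by move: c3; rewrite /= P.
  - by rewrite /= -/(uniq (_ :: _)) U.
  - by rewrite -cats1 /= all_cat /= andbT all_up_old.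
  - by rewrite /= all_down_old.
rewrite /= cat_uniq mem_cat inE !negb_or => /and3P[/andP[sW /andP[sn sB]] _].
case/andP=> /andP[nW _] /andP[nB _].
rewrite cat_rcons rcons_cat cat_path /= rcons_cat cat_path /=.
rewrite next_top_up next_top_down !eqxx /= -map_rcons.
rewrite !(fpath_old (next_top_eq r n)) !all_true !all_neq nW mem_rcons inE.
rewrite negb_or [n == s]eq_sym sn nB !andbT /=; congr [&& _, _ & _].
rewrite last_old next_top_old; by case: (eqVneq (nx r _) n) => h; rewrite ?newE.
Qed.

(** On the outer walk the chord replaces [a :: B1], which becomes the west side of the new face.
    Those darts are invisible in the new outer walk, so uniqueness of the longer walk is a
    hypothesis. If [B2] is empty the chord starts at the south pole, where the walk continues with
    [s]. *)
Lemma good_chord r s n a b W A B1 B2 : a != b -> s.2 -> n = head a A ->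
  descends r a B1 b -> uniq (s :: W ++ A ++ a :: B1 ++ B2) -> b = head s B2 ->
  good (chord_rot a b r) (old s) (if a == n then new_down else old n) new_down
    (oldS W) (oldS A) (oldS B2) <-> good r s n a W A (B1 ++ B2).
Proof.
move=> ab su nA H U hb; have C := core_chord n ab su H.
have [dB1 pB1 lB1] := H.
have [t tE] := rcons_head B2 s; rewrite -hb in tE.
have hU : uniq (s :: W ++ A) by move: U; rewrite catA -cat_cons cat_uniq => /andP[].
have disj d : d \in s :: W ++ A -> d \notin a :: B1 ++ B2.
  move: U; rewrite catA -cat_cons cat_uniq => /and3P[_ + _].
  by move/hasPn => h dWA; apply: contraL dWA => /h.
have sWA : s \notin W ++ A by case/andP: hU.
have aWA : a \notin W ++ A.
  by apply/negP => h; have := disj a; rewrite !inE h orbT eqxx => /(_ isT).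
have bt : (b == s) || (b \in B2).
  by rewrite hb; case: (B2) => [|? ?]; rewrite /= ?inE eqxx ?orbT.
have bWA : b \notin W ++ A.
  case/orP: bt => [/eqP->//|bB2]; apply/negP => h.
  by have := disj b; rewrite !inE h orbT mem_cat bB2 !orbT => /(_ isT).
have aB : a \notin B1 ++ B2.
  by move: U; rewrite catA -cat_cons cat_uniq => /and3P[_ _ /= /andP[]].
have as_ : a != s by apply: contraNneq (disj s (mem_head _ _)) => <-; rewrite mem_head.
have at_ : a \notin t.
  have : a \notin rcons B2 s.
    by rewrite mem_rcons inE negb_or as_; move: aB; rewrite mem_cat negb_or => /andP[].
  by rewrite tE inE negb_or => /andP[].
have ubt : uniq (b :: t).
  rewrite -tE rcons_uniq; apply/andP; split.
    apply: contraT => /negbNE sB2; have := disj s (mem_head _ _).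
    by rewrite inE mem_cat sB2 !orbT.
  move: U; rewrite catA -cat_cons cat_uniq => /and3P[_ _].
  by rewrite cons_uniq cat_uniq => /andP[_ /and3P[]].
have U' : uniq (old s :: oldS W ++ oldS A ++ new_down :: oldS B2).
  have lE : old s :: oldS W ++ oldS A ++ new_down :: oldS B2
      = oldS (s :: W ++ A) ++ [:: new_down] ++ oldS B2 by rewrite /= map_cat -catA.
  rewrite lE uniq_catCA cat1s cons_uniq -map_cat mem_oldE uniq_old cat_uniq hU /=.
  move: U; rewrite catA -cat_cons cat_uniq => /and3P[_ _].
  rewrite cons_uniq cat_uniq => /and3P[_ _ /andP[_ ->]]; rewrite andbT.
  apply/hasPn => d dB; have := contraL (@disj d); apply.
  by rewrite inE mem_cat dB !orbT.
have low d : d \in A -> flip d \notin s :: W -> all_down (A ++ a :: B1 ++ B2) ->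
    (chord_rot a b r (old (flip d))).2 = (r (flip d)).2.
  move=> dA dsW /allP dn; have fd : (flip d).2.
    by apply: dn; rewrite mem_cat dA.
  rewrite chord_rot_old; case: eqP => [fa|_].
    by have := dn a; rewrite mem_cat mem_head orbT -fa fd => /(_ isT).
  case: eqP => [fb|//]; case/orP: bt => [/eqP bs|bB2].
    by rewrite fb bs mem_head in dsW.
  by have := dn b; rewrite !mem_cat inE mem_cat bB2 !orbT -fb fd => /(_ isT).
have P : fpath (nx (chord_rot a b r)) (old s)
      (rcons (oldS W ++ oldS A ++ new_down :: oldS B2) (old s)) =
    fpath (nx r) s (rcons (W ++ A ++ a :: B1 ++ B2) s).
  rewrite !catA -map_cat !rcons_cat !rcons_cons !rcons_cat !cat_path /= !cat_path.
  rewrite pB1 -map_rcons tE /= next_chord_down // lB1 !eqxx /=.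
  rewrite !(fpath_old (fun d y => next_chord_eq r d y ab)) !all_true /=.
  have hp (p : seq (E * bool)) : all (fun y => (y != a) && (y != b)) p
      = (a \notin p) && (b \notin p).
    by rewrite -!all_neq -all_predI.
  rewrite !hp aWA bWA at_; case/andP: ubt => -> _; rewrite !andbT /=.
  congr [&& _, _ & _]; first by rewrite cat_path.
  rewrite last_old next_chord_old //.
  by case: (eqVneq (nx r _) a) => [//|h]; case: ifP; rewrite newE.
have N : (if a == n then new_down else old n) = head new_down (oldS A).
  rewrite nA; case: (A) aWA => [|x A'] /=; first by rewrite eqxx.
  by rewrite mem_cat !inE !negb_or => /and3P[_ /negPf->].
have dn : all_down (new_down :: oldS B2) = all_down (a :: B2).
  by case/andP: dB1 => /= -> _; rewrite all_down_old.
split=> -[c1 c2 c3 c4 c5 c6 c7 c8].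
  have dn2 : all_down (A ++ a :: B1 ++ B2).
    move: c6 dB1; rewrite !all_cat all_down_old dn /= all_cat.
    by case/and3P => -> -> -> /andP[_ ->].
  have i d : d \in A -> flip d \notin s :: W.
    by move=> dA; have := c8 (old d); rewrite -map_cons flip_old !mem_oldE => ->.
  split=> //.
  - exact/C.
  - by rewrite -P.
  - by rewrite -all_up_old.
  - move=> d dA; have := c7 (old d); rewrite flip_old mem_oldE low //; last exact: i.
    by apply.
split=> //.
- exact/C.
- by rewrite P.
- by rewrite -map_cons all_up_old.
- move: c6; rewrite !all_cat all_down_old dn /= all_cat.
  by case/and3P => -> -> /andP[_ ->].
- by move=> _ /mapP[d dA ->]; rewrite flip_old low ?c7 ?c8.
- by move=> _ /mapP[d dA ->]; rewrite flip_old -map_cons mem_oldE c8.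
Qed.

(** The outer walk may meet the split edge only along [a], where it gains [new_down]; hence the
    condition on [flip a]. It also means that the missing half has an interior face on its left. *)
Lemma good_split r s n a W A B : n = head a A -> flip a \notin s :: W ->
  good (split_rot a r) (old s) (swap a n) (old a)
    (oldS W) (rcons (oldS A) new_down) (oldS B) <-> good r s n a W A B.
Proof.
move=> nA fa.
have lE : old s :: oldS W ++ rcons (oldS A) new_down ++ old a :: oldS B
    = oldS (s :: W ++ A) ++ [:: new_down] ++ oldS (a :: B).
  by rewrite cat_rcons /= map_cat -catA.
have U : uniq (old s :: oldS W ++ rcons (oldS A) new_down ++ old a :: oldS B)
    = uniq (s :: W ++ A ++ a :: B).
  rewrite lE uniq_catCA cat1s cons_uniq -map_cat mem_oldE uniq_old.
  by rewrite /= -catA.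
have D : all_down (rcons (oldS A) new_down ++ old a :: oldS B)
    = all_down (A ++ a :: B).
  by rewrite cat_rcons !all_cat all_down_old /= all_down_old.
have Up : all_up (old s :: oldS W) = all_up (s :: W) by rewrite -map_cons all_up_old.
have P : uniq (s :: W ++ A ++ a :: B) -> all_down (A ++ a :: B) ->
    fpath (nx (split_rot a r)) (old s)
      (rcons (oldS W ++ rcons (oldS A) new_down ++ old a :: oldS B) (old s))
    = fpath (nx r) s (rcons (W ++ A ++ a :: B) s).
  move=> u dn.
  have fN : flip a \notin s :: W ++ A ++ a :: B.
    rewrite -cat_cons mem_cat negb_or fa; apply/negP => /(allP dn).
    by move/allP: dn => /(_ a); rewrite mem_cat mem_head orbT => /(_ isT) /= ->.
  have faa p : {subset p <= s :: W ++ A ++ a :: B} -> flip a \notin p.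
    by move=> sub; apply: contra fN => /sub.
  rewrite cat_rcons !catA -map_cat !rcons_cat !cat_path /= !(fpath_old (next_split_eq r a)).
  rewrite -map_rcons next_split_down eqxx /= !(fpath_old (next_split_eq r a)).
  rewrite !all_neq.
  have -> : a \notin W ++ A.
    move: u; rewrite /= catA cat_uniq => /and4P[_ _ /hasPn/(_ a)].
    by rewrite mem_head => /(_ isT).
  have -> : a \notin rcons B s.
    move: u; rewrite mem_rcons inE negb_or /= catA cat_uniq mem_cat inE !negb_or.
    by case/andP=> /and3P[_ + _] /and3P[_ _ /= /andP[-> _]]; rewrite eq_sym => ->.
  have -> : flip a \notin belast s (W ++ A).
    apply: faa => x /mem_belast; rewrite !(inE, mem_cat).
    by case/or3P => ->; rewrite ?orbT.
  have -> : flip a \notin belast a (rcons B s).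
    apply: faa => x /mem_belast; rewrite !(inE, mem_cat, mem_rcons).
    by case/or3P => ->; rewrite ?orbT.
  rewrite !andbT; congr [&& _, _ & _]; first by rewrite cat_path.
  rewrite last_old next_split_old.
  case: (eqVneq (last s (W ++ A)) (flip a)) => [h|_].
    have : flip a \notin s :: W ++ A.
      apply: faa => x; rewrite !(inE, mem_cat).
      by case/or3P => ->; rewrite ?orbT.
    by rewrite -h mem_last.
  by case: (eqVneq (nx r _) a) => h; rewrite ?newE.
have N : uniq (s :: W ++ A ++ a :: B) ->
    swap a n = head (old a) (rcons (oldS A) new_down).
  rewrite nA /swap; case: (A) => [|x A'] /=; first by rewrite eqxx.
  case/andP => _; rewrite cat_uniq => /and3P[_ _ /andP[]].
  by rewrite mem_cat inE !negb_or => /and3P[_ /negPf-> _].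
have low d : (flip d).2 -> ~~ a.2 ->
    (split_rot a r (old (flip d))).2 = (r (flip d)).2.
  move=> fd ad; rewrite split_rot_old; case: (eqVneq (flip d) a) => [fe|_].
    by rewrite fe (negPf ad) in fd.
  by case: eqP => [->|//]; rewrite (negPf ad).
split=> -[c1 c2 c3 c4 c5 c6 c7 c8].
  rewrite U in c4; rewrite D in c6; rewrite Up in c5; rewrite P // in c3.
  have /andP[su _] := c5; have dA d : d \in A ++ a :: B -> ~~ d.2 by move/(allP c6).
  have ad : ~~ a.2 by apply: dA; rewrite mem_cat mem_head orbT.
  split=> //; first exact: (proj1 (@core_split _ r s n a su ad)).
    move=> d dn; have := c7 (old d); rewrite mem_rcons inE mem_oldE dn orbT flip_old low //.
      by apply.
    by apply: dA; rewrite mem_cat dn.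
  move=> d dn; have := c8 (old d).
  by rewrite mem_rcons inE mem_oldE dn orbT flip_old -map_cons mem_oldE; apply.
have /andP[su _] := c5; have dA d : d \in A ++ a :: B -> ~~ d.2 by move/(allP c6).
have ad : ~~ a.2 by apply: dA; rewrite mem_cat mem_head orbT.
split=> //.
- exact: (proj2 (@core_split _ r s n a su ad)).
- exact: N.
- by rewrite P.
- by rewrite U.
- by rewrite Up.
- by rewrite D.
- move=> x; rewrite mem_rcons inE => /orP[/eqP->|/mapP[d dn ->]].
    by rewrite flip_new_down split_rot_up.
  by rewrite flip_old low ?c7 //; apply: dA; rewrite mem_cat dn.
- move=> x; rewrite mem_rcons inE -map_cons => /orP[/eqP->|/mapP[d dn ->]].
    by rewrite flip_new_down mem_oldE.
  by rewrite flip_old mem_oldE c8.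
Qed.

End GoodSurgeries.

(** * Undoing the last move *)

Lemma porbit_fcycle (T : finType) (s : {perm T}) x p :
  fcycle s p -> x \in p -> porbit s x =i p.
Proof.
move=> sp xp y; apply/idP/idP => [/porbitP[i ->]|yp].
  elim: i => [|i IH]; first by rewrite expg0 perm1.
  by rewrite expgSr permM; apply: mem_fcycle IH.
have := fconnect_cycle sp xp y; rewrite yp => /iter_findex <-.
by rewrite -permX mem_porbit.
Qed.

Lemma fcycle_porbit (T : finType) (s : {perm T}) x :
  exists p, [/\ fcycle s (x :: p), uniq (x :: p) & porbit s x =i x :: p].
Proof.
have [p xp] : exists p, fingraph.orbit s x = x :: p.
  rewrite /fingraph.orbit.
  by case: (fingraph.order s x) (fingraph.order_gt0 s x) => // k; eexists.
have c : fcycle s (x :: p) by rewrite -xp; apply/cycle_orbit/perm_inj.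
exists p; split=> //; first by rewrite -xp orbit_uniq.
by apply: porbit_fcycle => //; apply: mem_head.
Qed.

Section GoodFacts.
Variables (E : finType) (r : {perm (E * bool)}) (s n a : E * bool).
Variables (W A B : seq (E * bool)).
Hypothesis g : good r s n a W A B.
Let c := good_core g.

Lemma good_south_up : s.2. Proof. by case/andP: (good_up g). Qed.

Lemma good_downP d : d \in A ++ a :: B -> ~~ d.2.
Proof. exact: (allP (good_down g)). Qed.

Lemma good_upP d : d \in s :: W -> d.2.
Proof. exact: (allP (good_up g)). Qed.

Lemma good_active_down : ~~ a.2.
Proof. by apply: good_downP; rewrite mem_cat mem_head orbT. Qed.

Lemma good_outer : porbit (nx r) s =i s :: W ++ A ++ a :: B.
Proof. by apply: porbit_fcycle (mem_head _ _); apply: (good_path g). Qed.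

Lemma good_paths : [/\ fpath (nx r) s W, nx r (last s W) = n,
  fpath (nx r) n (behead (A ++ a :: B)) & nx r (last a B) = s].
Proof.
move: (good_path g); rewrite rcons_cat cat_path => /andP[-> p2].
have nE : A ++ a :: B = n :: behead (A ++ a :: B) by rewrite (good_north g); case: (A).
move: p2; rewrite -cats1 nE /= cat_path /= andbT => /and3P[/eqP-> -> /eqP].
suff -> : last n (behead (A ++ a :: B)) = last a B by [].
by rewrite -(last_cons s) -nE last_cat.
Qed.

Lemma good_next_active : nx r a = head s B.
Proof.
move: (good_path g); rewrite catA rcons_cat cat_path /= => /and3P[_ _].
by have [t ->] := rcons_head B s; case/andP => /eqP.
Qed.

Lemma good_active_pred d A0 : A = rcons A0 d -> nx r d = a.
Proof.
move: (good_path g) => + AE; rewrite AE cat_rcons catA rcons_cat cat_path /=.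
by case/and3P => _ _ /andP[/eqP].
Qed.

Lemma good_rot_active d A0 : A = rcons A0 d -> r a = flip d.
Proof. by move/good_active_pred <-; rewrite next_in_faceE. Qed.

(** The outer walk turns down after the last dart of the western boundary, and a face has only one
    such turn. *)
Lemma outer_up_down y : y \in porbit (nx r) s -> y.2 -> ~~ (nx r y).2 -> nx r y = n.
Proof.
have [_ lW _ _] := good_paths => ys yu yd.
have nd : ~~ n.2 by apply: (core_snk c); apply: porbit_id.
have lu : (last s W).2 by apply: good_upP; apply: mem_last.
have yl : y \in porbit (nx r) (last s W).
  apply: porbit_trans ys _; rewrite porbit_sym good_outer -cat_cons mem_cat.
  by rewrite mem_last.
by rewrite (face_up_down c yl lu _ yu yd) lW.
Qed.

Lemma outer_down_up y : y \in porbit (nx r) s -> ~~ y.2 -> (nx r y).2 -> nx r y = s.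
Proof.
have [_ _ _ lB] := good_paths => ys yd yu.
have ld : ~~ (last a B).2.
  by apply: good_downP; rewrite mem_cat mem_last orbT.
have yl : y \in porbit (nx r) (last a B).
  apply: porbit_trans ys _; rewrite porbit_sym good_outer catA -cat_cons mem_cat.
  by rewrite mem_last orbT.
by rewrite (face_down_up c yl ld _ yd yu) lB // good_south_up.
Qed.

(** The dart before [u] on its face is [flip (r u)], which points down. So the face turns upwards at
    [u], whereas the outer face does this only at [s]. *)
Lemma notin_outer u : (r u).2 -> u.2 -> u != s -> u \notin porbit (nx r) s.
Proof.
move=> ru uu us; apply: contraNN us => uo.
set y := flip (r u); have ny : nx r y = u.
  by apply/eqP; rewrite next_in_face_eq /y flipK.
rewrite -ny; apply/eqP/outer_down_up; rewrite ?ny //.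
  by rewrite -mem_porbit_step ny.
by rewrite /y /= ru.
Qed.

(** The edge below the active vertex also starts the western boundary, and the source carries
    nothing else. A missing edge above it would have the outer face on its left, against [good_int],
    so its upper end is the north pole and carries nothing else either. Connectedness leaves only
    this edge. *)
Lemma good_single : flip a = s ->
  [/\ A = [::], W = [::], B = [::] & forall x, x = s \/ x = a].
Proof.
move=> us; have ra : r (nx r a) = s by rewrite next_in_faceE.
have su := good_south_up; have ad := good_active_down.
have nau : (nx r a).2.
  by apply: (core_src c); rewrite -ra mem_porbit_stepr porbit_id.
have ao : a \in porbit (nx r) s by rewrite good_outer inE !mem_cat mem_head !orbT.
have nas : nx r a = s by apply: outer_down_up.
have rs : r s = s by rewrite -{1}nas.
have nsa : r (nx r s) = a by rewrite next_in_faceE -us flipK.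
have nsv : nx r s \in porbit r a by rewrite porbit_sym -{1}nsa mem_porbit_step porbit_id.
have A0 : A = [::].
  case/lastP EA: A => [//|A0 d]; exfalso; have rd := good_rot_active EA.
  have dA : d \in A by rewrite EA mem_rcons mem_head.
  have du : (flip d).2 by apply: good_downP; rewrite mem_cat dA.
  have dv : flip d \in porbit r a by rewrite -rd porbit_step.
  have low := good_low g dA; have int := good_int g dA.
  case nsu: (nx r s).2.
    have sd : nx r s = flip d.
      apply: (vertex_up_down c) => //; rewrite ?nsa //.
      by apply: porbit_trans nsv _; rewrite porbit_sym.
    have : flip d \in porbit (nx r) s by rewrite -sd mem_porbit_step porbit_id.
    rewrite good_outer -cat_cons mem_cat (negPf int) /=.
    by move/good_downP; rewrite du.
  have nn : nx r s = n by apply: outer_up_down; rewrite ?porbit_id ?nsu.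
  suff : ~~ (flip d).2 by rewrite du.
  apply: (core_snk c); rewrite -nn.
  by apply: porbit_trans dv _; rewrite porbit_sym.
have an : n = a by rewrite (good_north g) A0.
have nsd : ~~ (nx r s).2 by apply: (core_snk c); rewrite an.
have nsn : nx r s = a by rewrite -an; apply: outer_up_down; rewrite ?porbit_id.
have ra' : r a = a by rewrite -{1}nsn.
have mem x : (x == s) || (x == a) = true.
  have h := core_conn c (P := fun y => (y == s) || (y == a)) _ _ x s.
  rewrite h ?eqxx // => d; first by rewrite -{1}rs -{1}ra' !(inj_eq perm_inj).
  by rewrite -us -{2}[a]flipK !flip_eq orbC.
have : uniq (s :: W ++ A ++ a :: B) := good_uniq g.
rewrite A0 /= mem_cat inE !negb_or cat_uniq => /and3P[/and3P[sW sa sB] _].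
rewrite /= => /and3P[/norP[aW _] aB _].
split=> //.
- case: (W) sW aW => [|x W'] //; rewrite !inE !negb_or => /andP[xs _] /andP[xa _].
  by have := mem x; rewrite ![x == _]eq_sym (negPf xs) (negPf xa).
- case: (B) sB aB => [|x W'] //; rewrite !inE !negb_or => /andP[xs _] /andP[xa _].
  by have := mem x; rewrite ![x == _]eq_sym (negPf xs) (negPf xa).
by move=> x; case/orP: (mem x) => /eqP->; [left|right].
Qed.

(** Undoing an edge move: its edge is pendant at the north pole and can be deleted, or it can be
    declared missing, for which its left face must be interior. If [u] were on the western boundary,
    its upper end would be the north pole with no other edge, or would carry a missing edge with the
    outer face on its left, against [good_int]. *)
Lemma good_pop : ~~ (r (flip a)).2 -> flip a != s -> exists b B',
  [/\ B = b :: B', r b = flip a &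
  A = [::] /\ r a = a \/ good r s n b W (rcons A a) B'].
Proof.
set u := flip a => ru us; have ad := good_active_down.
have rb : r (nx r a) = u by rewrite next_in_faceE.
have ao : a \in porbit (nx r) s by rewrite good_outer inE !mem_cat mem_head !orbT.
have nau : ~~ (nx r a).2.
  apply/negP => nau; have sE := outer_down_up ao ad nau.
  move/negP: ru; apply; apply: (core_src c).
  by rewrite mem_porbit_step -rb mem_porbit_step sE porbit_id.
case EB: B => [|b B'].
  by move: nau; rewrite good_next_active EB /= good_south_up.
have nab : nx r a = b by rewrite good_next_active EB.
exists b, B'; rewrite -nab; split=> //; rewrite nab.
case: (boolP ((A == [::]) && (r a == a))) => [/andP[/eqP-> /eqP->]|h]; [by left|right].
have uu : u.2 by [].
have int : u \notin s :: W.
  apply/negP => uW; have uo : u \in porbit (nx r) s.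
    by rewrite good_outer -cat_cons mem_cat uW.
  have nua : r (nx r u) = a by rewrite next_in_faceE flipK.
  have nuv : nx r u \in porbit r a by rewrite porbit_sym -{1}nua mem_porbit_step porbit_id.
  have nun : ~~ (nx r u).2 -> nx r u = n by exact: outer_up_down.
  case/lastP EA: A h => [|A0 d] h.
    have an : n = a by rewrite (good_north g) EA.
    have nud : ~~ (nx r u).2 by apply: (core_snk c); rewrite an.
    by move: h; rewrite -{1}an -(nun nud) nua -an eqxx.
  have rd := good_rot_active EA.
  have dA : d \in A by rewrite EA mem_rcons mem_head.
  have du : (flip d).2 by apply: good_downP; rewrite mem_cat dA.
  have dv : flip d \in porbit r a by rewrite -rd porbit_step.
  have low := good_low g dA; have dint := good_int g dA.
  case nuu: (nx r u).2.
    have sd : nx r u = flip d.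
      apply: (vertex_up_down c) => //; rewrite ?nua //.
      by apply: porbit_trans nuv _; rewrite porbit_sym.
    have : flip d \in porbit (nx r) s by rewrite -sd mem_porbit_step.
    rewrite good_outer -cat_cons mem_cat (negPf dint) /=.
    by move/good_downP; rewrite du.
  have nn := nun (negbT nuu).
  suff : ~~ (flip d).2 by rewrite du.
  apply: (core_snk c); rewrite -nn.
  by apply: porbit_trans dv _; rewrite porbit_sym.
have lE : rcons A a ++ b :: B' = A ++ a :: B by rewrite cat_rcons EB.
split; rewrite ?lE //; try by case: g.
- by rewrite (good_north g); case: (A).
- by move=> d; rewrite mem_rcons inE => /orP[/eqP->//|]; apply: (good_low g).
- by move=> d; rewrite mem_rcons inE => /orP[/eqP->//|]; apply: (good_int g).
Qed.

(** The face on the left of [u] continues upwards, so the east side of the last face has an edge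
    above [u]. At the active vertex both that edge and the lowest missing edge are the westernmost
    upward dart, the latter by [good_low]; [vertex_up_down] identifies them, and the active vertex
    has no further darts. *)
Lemma good_open : (r (flip a)).2 -> flip a != s -> (nx r (flip a)).2 ->
  exists A0, [/\ A = rcons A0 (flip (nx r (flip a))),
    r a = nx r (flip a) & r (nx r (flip a)) = a].
Proof.
set u := flip a => ru us nuu.
have nua : r (nx r u) = a by rewrite next_in_faceE flipK.
have nuv : nx r u \in porbit r a by rewrite porbit_sym -{1}nua mem_porbit_step porbit_id.
case/lastP EA: A => [|A0 d].
  have an : n = a by rewrite (good_north g) EA.
  by have := core_snk c (x := nx r u); rewrite nuu an nuv => /(_ isT).
have rd := good_rot_active EA.
have dA : d \in A by rewrite EA mem_rcons mem_head.
have du : (flip d).2 by apply: good_downP; rewrite mem_cat dA.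
have dv : flip d \in porbit r a by rewrite -rd porbit_step.
have ad := good_active_down.
have sd : nx r u = flip d.
  apply: (vertex_up_down c) => //; rewrite ?nua //; last exact: (good_low g).
  by apply: porbit_trans nuv _; rewrite porbit_sym.
by exists A0; rewrite sd flipK rd; split=> //; rewrite -sd.
Qed.

End GoodFacts.

(** * Recognizing a marked map as the result of a surgery *)

Section Removal.
Variable E : finType.

Lemma oldP (x : option E * bool) : x != new_up -> x != new_down ->
  exists d, x = old d.
Proof. by case: (new_dartP x) => [d||] // _ _; exists d. Qed.

Lemma oldSP (p : seq (option E * bool)) :
  new_up \notin p -> new_down \notin p -> exists q, p = oldS q.
Proof.
elim: p => [|x p IH]; first by exists [::].
rewrite !inE !negb_or ![_ == x]eq_sym => /andP[xu pu] /andP[xd pd].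
by have [d ->] := oldP xu xd; have [q ->] := IH pu pd; exists (d :: q).
Qed.

Lemma tperm_mulK (T : finType) (x y : T) (p : {perm T}) :
  (tperm x y * (tperm x y * p))%g = p.
Proof. by rewrite mulgA tperm2 mul1g. Qed.

(** The hypotheses describe a pendant edge at the north pole attached to a vertex where it is the
    westernmost upward edge. *)
Lemma good_untop (r : {perm (option E * bool)}) s W B b :
  good r s new_down new_down W [::] (b :: B) ->
  r new_down = new_down -> r b = new_up -> ~~ (r new_up).2 -> s != new_up ->
  exists r0 s0 n0 W0 B0, [/\ r = top_rot n0 r0, s = old s0,
    [/\ W = rcons (oldS W0) new_up, b = old n0 & B = oldS B0] &
    good r0 s0 n0 n0 W0 [::] B0].
Proof.
move=> g rd rb ru su.
have sU := good_south_up g; have U := good_uniq g.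
have [s0 sE] : exists d, s = old d.
  by apply: oldP => //; apply: contraTneq sU => ->.
have bd : ~~ b.2 by apply: (good_downP g); rewrite !inE eqxx orbT.
have [n0 bE] : exists d, b = old d.
  apply: oldP; first by apply: contraNneq bd => ->.
  move: U; rewrite /= cat_uniq => /and3P[_ _ /and3P[_ /= + _]].
  by rewrite inE negb_or eq_sym => /andP[].
have [W1 WE] : exists W1, W = rcons W1 new_up.
  have [_ + _ _] := good_paths g; move/eqP.
  rewrite next_in_face_eq rd; case/lastP: (W) => [|W1 x] /=.
    by rewrite -flip_new_up flip_eq eq_sym (negPf su).
  rewrite last_rcons -flip_new_up flip_eq => /eqP <-; by exists W1.
have [W0 W0E] : exists q, W1 = oldS q.
  move: U; rewrite WE /= cat_uniq rcons_uniq => /and3P[_ /andP[uW _] /andP[+ _]].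
  rewrite /= negb_or mem_rcons inE negb_or => /andP[/andP[_ dW] _].
  exact: oldSP.
have [B0 B0E] : exists q, B = oldS q.
  apply: oldSP.
    by apply/negP => h; have := good_downP g (d := new_up); rewrite !inE h !orbT => /(_ isT).
  move: U; rewrite /= cat_uniq => /and3P[_ _ /and3P[_ /= + _]].
  by rewrite inE negb_or => /andP[].
pose r1 := (tperm b new_up * r)%g.
have bu : (b == new_up) = false by rewrite bE newE.
have [r0 r0E] : exists r0, r1 = lift_rot r0.
  apply: unlift_rot; rewrite permM; first by rewrite tpermR rb.
  by rewrite tperm_if !newE bE newE rd.
have rE : r = top_rot n0 r0.
  by rewrite /top_rot /insert_after -r0E -bE tperm_mulK.
exists r0, s0, n0, W0, B0; split=> //; first by rewrite WE W0E.
(* An upward dart at [n0] would produce an up-down corner at this vertex besides that of [new_up],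
   so [n0] was a sink. *)
have nv x : x \in porbit r0 n0 -> ~~ x.2.
  move=> xn; apply/negP => xu.
  have rn : ~~ (r0 n0).2.
    by have := top_rot_up n0 r0; rewrite -rE => h; move: ru; rewrite h.
  have nx' : n0 \in porbit r0 x by rewrite porbit_sym.
  have nd0 : ~~ n0.2 by move: bd; rewrite bE.
  have [y yx /andP[yu ryd]] := porbit_transition (f := snd) nx' xu nd0.
  have yn : y != n0 by apply: contraTneq yu => ->.
  have ry : r (old y) = old (r0 y) by rewrite rE top_rot_old (negPf yn).
  have : old y = new_up.
    apply: (vertex_up_down (good_core g)) => //; last by rewrite ry.
    by rewrite rE porbit_sym vertex_top_up porbit_sym; apply: porbit_trans yx xn.
  by move/eqP; rewrite newE.
have sU0 : s0.2 by move: sU; rewrite sE.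
apply: (proj1 (@good_top E r0 s0 n0 W0 B0 sU0 nv)).
by move: g; rewrite rE sE WE W0E bE B0E.
Qed.

(** The active vertex has only the darts [a] and [new_up], so it can be smoothed out, joining the
    missing edge to the edge below it. *)
Lemma good_unsplit (r : {perm (option E * bool)}) s n a W A B :
  good r s n a W (rcons A new_down) B -> r a = new_up -> r new_up = a ->
  flip a \notin s :: W ->
  exists r0 s0 n0 a0 W0 A0 B0, [/\ r = split_rot a0 r0, s = old s0, n = swap a0 n0,
    [/\ a = old a0, W = oldS W0, A = oldS A0 & B = oldS B0] &
    good r0 s0 n0 a0 W0 A0 B0].
Proof.
move=> g ra ru fa.
have sU := good_south_up g; have ad := good_active_down g.
have U : uniq (new_down :: (s :: W) ++ A ++ a :: B).
  rewrite (catA (s :: W)) -cat1s uniq_catCA cat1s -catA -cat_rcons.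
  exact: (good_uniq g).
have /andP[dL _] := U; move: dL; rewrite !(in_cons, mem_cat) !negb_or.
have UL : uniq ((s :: W) ++ A ++ a :: B) by case/andP: U.
case/and5P => ds dW dA da dB.
have int : new_up \notin s :: W.
  by have := good_int g (d := new_down); rewrite mem_rcons mem_head => /(_ isT).
move: int; rewrite inE negb_or => /andP[us uW].
have uA : new_up \notin A.
  apply/negP => h; have := good_downP g (d := new_up).
  by rewrite mem_cat mem_rcons inE h !orbT => /(_ isT).
have uB : new_up \notin B.
  apply/negP => h; have := good_downP g (d := new_up).
  by rewrite mem_cat inE h !orbT => /(_ isT).
have au : a != new_up by apply: contraNneq ad => ->.
have [s0 sE] : exists d, s = old d by apply: oldP; rewrite eq_sym.
have [a0 aE] : exists d, a = old d by apply: oldP; rewrite // eq_sym.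
have [W0 WE] := oldSP uW dW; have [A0 AE] := oldSP uA dA.
have [B0 BE] := oldSP uB dB.
pose t := tperm a new_down.
pose r1 := ((tperm a new_up * r) ^ t)%g.
have ax : (a == new_down) = false by rewrite aE newE.
have [r0 r0E] : exists r0, r1 = lift_rot r0.
  apply: unlift_rot; rewrite /r1 conjgE !permM tpermV.
    rewrite /t (tperm_if a _ new_up) newE [new_up == a]eq_sym (negPf au) tpermR ra.
    by rewrite tperm_if newE eq_sym (negPf au).
  by rewrite tpermR tpermL ru tpermL.
have rE : r = split_rot a0 r0.
  rewrite /split_rot /insert_after -r0E -aE /r1 -/t -conjgM.
  by rewrite tperm2 conjg1 tperm_mulK.
pose n0 := head a0 A0.
have nE : n = swap a0 n0.
  have := good_north g; rewrite AE /n0 /swap => ->.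
  have : a0 \notin A0.
    move: UL; rewrite catA cat_uniq => /and3P[_ /hasPn h _].
    apply/negP => a0A; have /negP := h a (mem_head _ _); apply.
    by rewrite mem_cat AE aE mem_oldE a0A orbT.
  case: (A0) => [|x A'] /=; first by rewrite eqxx.
  by rewrite inE negb_or eq_sym => /andP[/negPf->].
exists r0, s0, n0, a0, W0, A0, B0; split=> //.
have fa0 : flip a0 \notin s0 :: W0.
  by move: fa; rewrite aE sE WE flip_old -map_cons mem_oldE.
apply: (proj1 (@good_split E r0 s0 n0 a0 W0 A0 B0 (erefl _) fa0)).
by move: g; rewrite rE sE nE aE WE AE BE.
Qed.

(** Since the face on the left of [new_up] turns down right after it, the east side of this face is
    the single edge [new_up]. Deleting the edge returns the west side [a0 :: D0] to the eastern
    boundary. *)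
Lemma good_unchord (r : {perm (option E * bool)}) s n W A B :
  good r s n new_down W A B -> (r new_up).2 -> s != new_up ->
  ~~ (nx r new_up).2 ->
  exists r0 s0 n0 a0 b0 W0 A0 D0, exists B0,
  [/\ [/\ a0 != b0, r = chord_rot a0 b0 r0 & s = old s0],
    n = if a0 == n0 then new_down else old n0,
    [/\ W = oldS W0, A = oldS A0 & B = oldS B0],
    [/\ descends r0 a0 D0 b0, n0 = head a0 A0 & b0 = head s0 B0] &
    good r0 s0 n0 a0 W0 A0 (D0 ++ B0)].
Proof.
move=> g ru su nud.
have sU := good_south_up g; have c := good_core g; have ad := good_active_down g.
have uo : new_up \notin porbit (nx r) s by apply: (notin_outer g); rewrite // eq_sym.
have U : uniq (new_down :: (s :: W) ++ A ++ B).
  by rewrite (catA (s :: W)) -cat1s uniq_catCA cat1s -catA; apply: (good_uniq g).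
have /andP[dL _] := U; move: dL; rewrite !(in_cons, mem_cat) !negb_or.
have UL : uniq ((s :: W) ++ A ++ B) by case/andP: U.
case/and4P => ds dW dA dB.
have := uo; rewrite (good_outer g) !(in_cons, mem_cat) !negb_or.
case/and5P => us uW uA _ uB.
have [s0 sE] : exists d, s = old d by apply: oldP; rewrite eq_sym.
have [W0 WE] := oldSP uW dW; have [A0 AE] := oldSP uA dA.
have [B0 BE] := oldSP uB dB.
have dO : new_down \in porbit (nx r) s.
  by rewrite (good_outer g) !(in_cons, mem_cat) eqxx !orbT.
have [p [cp up pE]] := fcycle_porbit (nx r) new_up.
have dp : new_down \notin new_up :: p.
  rewrite -pE; apply: contra uo => h; apply: porbit_trans dO; by rewrite porbit_sym.
case: p cp up pE dp => [|a1 p] cp up pE dp.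
  by move: cp nud; rewrite /= andbT => /eqP->.
move: cp => /= /andP[/eqP na1 pp]; rewrite na1 in nud.
have [a0 aE] : exists d, a1 = old d.
  apply: oldP; first by apply: contraNneq nud => ->.
  by move: dp; rewrite !in_cons !negb_or [_ == a1]eq_sym => /and3P[].
have [D0 DE] : exists q, p = oldS q.
  apply: oldSP; first by move: up; rewrite /= in_cons negb_or => /and3P[/andP[]].
  by move: dp; rewrite !in_cons !negb_or => /and3P[].
move: pp; rewrite rcons_path => /andP[pp /eqP lp].
(* A face turns upwards only once, and this face does so on entering [new_up], so the rest of it
   descends. *)
have dn : all (fun d => ~~ d.2) (a1 :: p).
  apply: (@fpath_all _ (nx r) (fun d => ~~ d.2) _ _ pp nud) => y yp yd; apply/negP => yu.
  have y0E : nx r (flip (r new_up)) = new_up.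
    by apply/eqP; rewrite next_in_face_eq flipK.
  have : y = flip (r new_up).
    apply: (face_down_up c) => //; last 2 first.
    - by rewrite /= ru.
    - by rewrite y0E.
    by rewrite -mem_porbit_step -mem_porbit_stepr y0E pE !in_cons yp !orbT.
  move=> yE; move: yp up; rewrite yE y0E /= => h.
  by rewrite inE h orbT.
have nab : nx r new_down = head s B := good_next_active g.
pose b0 := head s0 B0.
have bE : head s B = old b0 by rewrite sE BE head_old.
have rb : r (old b0) = new_up by rewrite -bE -nab next_in_faceE.
have ra : r (old a0) = new_down by rewrite -aE -na1 next_in_faceE.
have ab : a0 != b0.
  by apply: contraTneq isT => h; move: ra; rewrite h rb => /eqP; rewrite newE.
pose r1 := (tperm (old b0) new_up * (tperm (old a0) new_down * r))%g.
have ba : (b0 == a0) = false by rewrite eq_sym (negPf ab).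
have [r0 r0E] : exists r0, r1 = lift_rot r0.
  apply: unlift_rot; rewrite !permM.
    by rewrite tpermR tperm_if !newE ba rb.
  by rewrite (tperm_if (old b0)) !newE tpermR ra.
have rE : r = chord_rot a0 b0 r0.
  by rewrite /chord_rot /insert_after -r0E !tperm_mulK.
pose n0 := head a0 A0.
have a0o : old a0 \notin porbit (nx r) s.
  apply: contra uo => h; apply: porbit_trans h; rewrite -aE porbit_sym pE.
  by rewrite !inE eqxx orbT.
have nE : n = if a0 == n0 then new_down else old n0.
  have := good_north g; rewrite AE /n0 => ->.
  have : a0 \notin A0.
    by move: a0o; rewrite (good_outer g) !(in_cons, mem_cat) !negb_or AE mem_oldE => /and5P[].
  case: (A0) => [|x A'] /=; first by rewrite eqxx.
  by rewrite inE negb_or => /andP[/negPf->].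
have H : descends r0 a0 D0 b0.
  split; first by move: dn; rewrite aE DE -map_cons all_down_old.
    move: pp; rewrite aE DE rE (fpath_old (fun d y => next_chord_eq r0 d y ab)).
    by case/and3P.
  move: lp; rewrite aE DE last_old rE next_chord_old //.
  case: (eqVneq (nx r0 _) a0) => [_|_] //; case: (eqVneq (nx r0 _) b0) => [//|_].
  by move/eqP; rewrite newE.
exists r0, s0, n0, a0, b0, W0, A0, D0, B0; split=> //.
have sU0 : s0.2 by move: sU; rewrite sE.
have U0 : uniq (s0 :: W0 ++ A0 ++ a0 :: D0 ++ B0).
  have e : old s0 :: oldS W0 ++ oldS A0 ++ old a0 :: oldS D0 ++ oldS B0
      = oldS (s0 :: W0 ++ A0 ++ a0 :: D0 ++ B0) by rewrite /= !map_cat /= map_cat.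
  rewrite -uniq_old -e -aE -WE -AE -BE -DE -sE.
  have -> : s :: W ++ A ++ a1 :: p ++ B = (s :: W ++ A) ++ (a1 :: p) ++ B.
    by rewrite /= -catA.
  rewrite uniq_catCA cat_uniq; move: UL; rewrite catA => ->.
  move: up; rewrite cons_uniq => /andP[_ ->]; rewrite andTb andbT.
  apply/hasPn => x xL; apply: contra uo => xp.
  have : x \in porbit (nx r) s.
    rewrite (good_outer g); move: xL; rewrite !(in_cons, mem_cat).
    by case/orP => [/or3P[]|] ->; rewrite ?orbT.
  apply: porbit_trans; rewrite porbit_sym pE inE xp orbT //.
apply: (proj1 (@good_chord E r0 s0 n0 a0 b0 W0 A0 D0 B0 ab sU0 (erefl _) H U0 (erefl _))).
by move: g; rewrite -nE -rE -sE -WE -AE -BE.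
Qed.

End Removal.

(** * Isomorphisms *)

Definition dmap (E E' : Type) (f : E -> E') (d : E * bool) : E' * bool := (f d.1, d.2).

Section Transport.
Variables (E E' : finType) (f : E -> E').
Hypothesis fb : bijective f.
Variables (r : {perm (E * bool)}) (r' : {perm (E' * bool)}).
Hypothesis fr : forall d, dmap f (r d) = r' (dmap f d).
Notation g := (dmap f).

Lemma dmap_bij : bijective g.
Proof.
case: fb => h fh hf; exists (dmap h) => -[e b]; first by rewrite /dmap /= fh.
by rewrite /dmap /= hf.
Qed.

Let gI : injective g := bij_inj dmap_bij.

Lemma dmap_flip d : g (flip d) = flip (g d). Proof. by []. Qed.

Lemma dmap_next d : g (nx r d) = nx r' (g d).
Proof. by apply/esym/eqP; rewrite next_in_face_eq -fr next_in_faceE. Qed.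

Lemma dmap_porbit d x : (g d \in porbit r' (g x)) = (d \in porbit r x).
Proof. by rewrite (porbit_inj _ gI fr) mem_imset. Qed.

Lemma core_dmap s n : core r s n -> core r' (g s) (g n).
Proof.
case=> c1 c2 [rk c3 c3'] c4 c5 c6 c7; have [h gh hg] := dmap_bij.
have hr d : h (r' d) = r (h d) by apply: gI; rewrite hg fr hg.
have hf d : h (flip d) = flip (h d) by apply: gI; rewrite hg dmap_flip hg.
split.
- move=> P Pr Pf d x; have := c1 (P \o g) _ _ (h d) (h x); rewrite /= !hg; apply.
    by move=> y; rewrite /= fr Pr.
  by move=> y; apply: (Pf (g y)).
- rewrite (card_porbits_bij dmap_bij fr) (card_porbits_bij dmap_bij dmap_next) c2.
  by rewrite (bij_eq_card fb).
- exists (rk \o h) => [d|e] /=; first by rewrite hr c3.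
  have he b : h (e, b) = ((h (e, b)).1, b).
    by rewrite [LHS]surjective_pairing; congr (_, _); exact: (congr1 snd (hg (e, b))).
  have := hf (e, true); rewrite (he true) /flip /= => ->; exact: c3'.
- by move=> x xs; have := c4 (h x); rewrite -dmap_porbit hg => /(_ xs); rewrite -{2}(hg x).
- move=> d; rewrite -(hg d) dmap_porbit => /c5[x xd xf]; exists (g x) => //.
  by rewrite dmap_porbit.
- by move=> x xs; have := c6 (h x); rewrite -dmap_porbit hg => /(_ xs); rewrite -{2}(hg x).
- move=> d; rewrite -(hg d) dmap_porbit => /c7[x xd xf]; exists (g x) => //.
  by rewrite dmap_porbit.
Qed.

Lemma good_dmap s n a W A B : good r s n a W A B ->
  good r' (g s) (g n) (g a) (map g W) (map g A) (map g B).
Proof.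
case=> c1 c2 c3 c4 c5 c6 c7 c8; split.
- exact: core_dmap.
- by rewrite c2; case: (A).
- rewrite -map_cons -!map_cat -map_rcons path_map; apply: sub_path c3 => x y /=.
  by rewrite -dmap_next => /eqP->.
- by rewrite -map_cons -!map_cat -map_cons map_inj_uniq.
- by rewrite -map_cons all_map; apply: sub_all c5.
- by rewrite -map_cons -!map_cat all_map; apply: sub_all c6.
- by move=> _ /mapP[d dA ->]; rewrite -dmap_flip -fr c7.
- by move=> _ /mapP[d dA ->]; rewrite -dmap_flip -map_cons mem_map ?c8.
Qed.

End Transport.

(** The rotation, poles and active dart after a move depend only on those before it, so isomorphism
    of states ignores [start] and [sewn_faces]. *)
Definition iso_by (M N : sewing) (f : edge M -> edge N) : Prop :=
  [/\ forall d, dmap f (rot M d) = rot N (dmap f d), dmap f (south M) = south N,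
   dmap f (north M) = north N & dmap f (active M) = active N].

Definition siso (M N : sewing) : Prop :=
  exists2 f : edge M -> edge N, bijective f & iso_by f.

Lemma siso_trans N M P : siso M N -> siso N P -> siso M P.
Proof.
case=> f fb [f1 f2 f3 f4] [h hb [h1 h2 h3 h4]]; exists (h \o f).
  exact: bij_comp.
have c d : dmap (h \o f) d = dmap h (dmap f d) by [].
by split=> [d|||]; rewrite !c ?f1 ?h1 ?f2 ?f3 ?f4.
Qed.

Lemma siso_sym M N : siso M N -> siso N M.
Proof.
case=> f [h fh hf] [f1 f2 f3 f4]; exists h; first by exists f.
have c : cancel (dmap f) (dmap h) by case=> e b; rewrite /dmap /= fh.
have c' : cancel (dmap h) (dmap f) by case=> e b; rewrite /dmap /= hf.
split; rewrite -?f2 -?f3 -?f4 ?c // => d.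
by apply: (can_inj c); rewrite f1 !c'.
Qed.

Lemma dmap_old (E E' : finType) (f : E -> E') d :
  dmap (ssrfun.omap f) (old d) = old (dmap f d).
Proof. by []. Qed.
Lemma dmap_new_up (E E' : finType) (f : E -> E') : dmap (ssrfun.omap f) new_up = new_up.
Proof. by []. Qed.
Lemma dmap_new_down (E E' : finType) (f : E -> E') :
  dmap (ssrfun.omap f) new_down = new_down.
Proof. by []. Qed.
Definition dmapE := (dmap_old, dmap_new_up, dmap_new_down).


Lemma omap_bij (E E' : Type) (f : E -> E') : bijective f -> bijective (ssrfun.omap f).
Proof.
by case=> h fh hf; exists (ssrfun.omap h) => -[e|] //=; rewrite ?fh ?hf.
Qed.

Lemma omap_ofP (E E' : finType) (F : option E -> option E') : bijective F ->
  F None = None -> exists2 f : E -> E', bijective f &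
    forall e, F (Some e) = Some (f e).
Proof.
case=> H FH HF F0; have H0 : H None = None by rewrite -F0 FH.
have FS e : exists e', F (Some e) == Some e'.
  by case Fe: (F (Some e)) => [e'|]; [exists e'|have := FH (Some e); rewrite Fe H0].
have HS e : exists e', H (Some e) == Some e'.
  by case Fe: (H (Some e)) => [e'|]; [exists e'|have := HF (Some e); rewrite Fe F0].
have fE e : F (Some e) = Some (xchoose (FS e)) by apply/eqP/(xchooseP (FS e)).
have hE e : H (Some e) = Some (xchoose (HS e)) by apply/eqP/(xchooseP (HS e)).
exists (fun e => xchoose (FS e)) => //; exists (fun e => xchoose (HS e)) => e.
  by apply: Some_inj; rewrite -hE -fE FH.
by apply: Some_inj; rewrite -fE -hE HF.
Qed.

(** Takes the lower corner of the chord as a parameter, because a congruence has to match the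
    corners of two maps. *)
Definition chord_at (M : sewing) (b : dart M) : sewing :=
  @Sewing (OMap (chord_rot (active M) b (rot M)) (old (south M))
      (if active M == north M then new_down else old (north M)))
    (old (start M)) new_down (rcons (map (@old _) (sewn_faces M)) new_up).

Lemma add_chordE i M : add_chord i M = chord_at (iter i.+1 (@next M) (active M)).
Proof. by []. Qed.

(** * Surgeries respect isomorphism *)

Section Congruence.
Variables (M N : sewing).

Lemma siso_top : siso M N -> siso (add_top M) (add_top N).
Proof.
case=> f fb [f1 f2 f3 f4]; exists (ssrfun.omap f); first exact: omap_bij.
have gI := bij_inj (dmap_bij fb).
split=> [x|||]; rewrite ?dmapE ?f2 //=.
rewrite -!/(top_rot _ _); case: (new_dartP x) => [d||]; rewrite !dmapE.
- rewrite !top_rot_old -f3 (inj_eq gI) -f1; by case: ifP; rewrite !dmapE.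
- by rewrite !top_rot_up dmapE f1 f3.
by rewrite !top_rot_down.
Qed.

Lemma siso_chord b b' (f : edge M -> edge N) : bijective f -> iso_by f ->
  dmap f b = b' -> active M != b -> siso (chord_at b) (chord_at b').
Proof.
move=> fb [f1 f2 f3 f4] <- ab; exists (ssrfun.omap f); first exact: omap_bij.
have gI := bij_inj (dmap_bij fb).
split=> [x|||]; rewrite ?dmapE ?f2 //=; last first.
  by rewrite -f4 -f3 (inj_eq gI); case: ifP; rewrite dmapE.
case: (new_dartP x) => [d||]; rewrite !dmapE -f4.
- rewrite !chord_rot_old !(inj_eq gI) -f1.
  by case: ifP => _; [|case: ifP => _]; rewrite !dmapE.
- by rewrite !chord_rot_up dmapE f1.
by rewrite !chord_rot_down ?(inj_eq gI) // dmapE f1.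
Qed.

Lemma siso_split : siso M N -> siso (split_active M) (split_active N).
Proof.
case=> f fb [f1 f2 f3 f4]; exists (ssrfun.omap f); first exact: omap_bij.
have gI := bij_inj (dmap_bij fb).
split=> [x|||] /=; rewrite ?dmapE ?f2 ?f4 //=; last first.
  rewrite -!swap_tperm /swap -f4 -f3 (inj_eq gI).
  by case: ifP; rewrite dmapE.
rewrite -!/(split_rot _ _); case: (new_dartP x) => [d||]; rewrite !dmapE -f4.
- rewrite !split_rot_old -f1 !(inj_eq gI).
  by case: ifP => _; [|case: ifP => _]; rewrite !dmapE.
- by rewrite !split_rot_up dmapE.
by rewrite !split_rot_down -f1 (inj_eq gI); case: ifP; rewrite !dmapE.
Qed.

End Congruence.

Definition sgood (M : sewing) (W A B : seq (dart M)) : Prop :=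
  good (rot M) (south M) (north M) (active M) W A B.

Definition shift_active (M : sewing) : sewing :=
  @Sewing M (start M) (flip (rot M (active M))) (sewn_faces M).

(** * Surgeries can be cancelled up to isomorphism *)

Section Cancel.
Variables (M N : sewing).

Lemma dmap_omap (E E' : finType) (F : option E -> option E') (f : E -> E') :
  F None = None -> (forall e, F (Some e) = Some (f e)) ->
  forall x, dmap F x = dmap (ssrfun.omap f) x.
Proof. by move=> F0 FS [[e|] b]; rewrite /dmap /= ?FS ?F0. Qed.

Lemma siso_top_inj : active M = north M -> active N = north N ->
  siso (add_top M) (add_top N) -> siso M N.
Proof.
move=> aM aN [F Fb [F1 F2 F3 F4]].
(* [new_down] is the active dart on both sides, so [F] fixes the new edge and restricts to the old
   ones. *)
have [f fb Ff] := omap_ofP Fb (congr1 fst F4); exists f => //.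
have E := dmap_omap (congr1 fst F4) Ff; have gI := bij_inj (dmap_bij fb).
have n1 : dmap f (north M) = north N.
  have := F1 (old (north M)); rewrite !E -!/(top_rot _ _) dmap_old.
  rewrite !top_rot_old eqxx dmap_new_up.
  by case: eqP => [//|_] /eqP; rewrite newE.
split=> [d|||] //; last by rewrite aM aN.
  case: (eqVneq d (north M)) => [->|dn].
    have := F1 new_up; rewrite !E -!/(top_rot _ _) !dmap_new_up !top_rot_up n1.
    by rewrite dmap_old => /old_inj.
  have := F1 (old d); rewrite !E -!/(top_rot _ _) dmap_old !top_rot_old.
  by rewrite -n1 (inj_eq gI) (negPf dn) dmap_old => /old_inj.
by apply: old_inj; rewrite -dmap_old -E F2.
Qed.

Lemma siso_chord_inj (b : dart M) (b' : dart N) : active M != b -> active N != b' ->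
  siso (chord_at b) (chord_at b') -> siso M N.
Proof.
move=> ab ab' [F Fb [F1 F2 F3 F4]].
have [f fb Ff] := omap_ofP Fb (congr1 fst F4); exists f => //.
have E := dmap_omap (congr1 fst F4) Ff; have gI := bij_inj (dmap_bij fb).
have a1 : dmap f (active M) = active N.
  have := F1 (old (active M)); rewrite !E /= dmap_old !chord_rot_old eqxx.
  rewrite dmap_new_down; case: eqP => [//|_].
  by case: eqP => _ /eqP; rewrite newE.
have b1 : dmap f b = b'.
  have := F1 (old b); rewrite !E /= dmap_old !chord_rot_old [b == _]eq_sym (negPf ab) eqxx.
  rewrite dmap_new_up; case: eqP => [_ /eqP|_]; first by rewrite newE.
  by case: eqP => [//|_] /eqP; rewrite newE.
split=> [d|||] //.
- case: (eqVneq d (active M)) => [->|da].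
    have := F1 new_down; rewrite !E /= !dmap_new_down !chord_rot_down // dmap_old a1.
    exact: old_inj.
  case: (eqVneq d b) => [->|db].
    have := F1 new_up; rewrite !E /= !dmap_new_up !chord_rot_up // dmap_old b1.
    exact: old_inj.
  have := F1 (old d); rewrite !E /= dmap_old !chord_rot_old -a1 -b1 !(inj_eq gI).
  by rewrite (negPf da) (negPf db) dmap_old => /old_inj.
- by apply: old_inj; rewrite -dmap_old -E F2.
move: F3; rewrite E /= -a1.
case: (eqVneq (active M) (north M)) => [->|aM].
  by rewrite dmap_new_down; case: (eqVneq _ (north N)) => [//|_] /eqP; rewrite newE.
rewrite dmap_old; case: (eqVneq _ (north N)) => [_ /eqP|_ /old_inj //].
by rewrite newE.
Qed.

Lemma siso_split_inj : siso (split_active M) (split_active N) -> siso M N.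
Proof.
case=> F Fb [F1 F2 F3 F4].
(* Here the active dart is an old one; the new edge is recognized as its successor around the
   subdividing vertex. *)
have Fu : dmap F new_up = new_up.
  have := F1 (old (active M)); rewrite /= in F4 *; rewrite F4.
  by rewrite -!/(split_rot _ _) !split_rot_old !eqxx.
have [f fb Ff] := omap_ofP Fb (congr1 fst Fu); exists f => //.
have E := dmap_omap (congr1 fst Fu) Ff; have gI := bij_inj (dmap_bij fb).
have a1 : dmap f (active M) = active N.
  by apply: old_inj; rewrite -dmap_old -E F4.
split=> [d|||] //.
- case: (eqVneq d (active M)) => [->|da].
    have := F1 new_down; rewrite !E -!/(split_rot _ _) !dmap_new_down !split_rot_down.
    rewrite -a1; case: (eqVneq (rot M _) (active M)) => [->|rm].
      by rewrite dmap_new_down; case: eqP => [->//|_ /eqP]; rewrite newE.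
    rewrite dmap_old; case: eqP => [_ /eqP|_]; first by rewrite newE.
    exact: old_inj.
  have := F1 (old d); rewrite !E -!/(split_rot _ _) dmap_old !split_rot_old.
  rewrite -a1 (inj_eq gI) (negPf da).
  case: (eqVneq (rot M _) (active M)) => [->|rm].
    by rewrite dmap_new_down; case: eqP => [->//|_ /eqP]; rewrite newE.
  rewrite dmap_old; case: eqP => [_ /eqP|_]; first by rewrite newE.
  exact: old_inj.
- by apply: old_inj; rewrite -dmap_old -E F2.
move: F3; rewrite E /= -!swap_tperm /swap -a1.
case: (eqVneq (north M) (active M)) => [->|aM].
  by rewrite dmap_new_down; case: (eqVneq (north N) _) => [//|_] /eqP; rewrite newE.
rewrite dmap_old; case: (eqVneq (north N) _) => [_ /eqP|_ /old_inj //].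
by rewrite newE.
Qed.

Lemma siso_shift : siso M N -> siso (shift_active M) (shift_active N).
Proof.
case=> f fb [f1 f2 f3 f4]; exists f => //; split=> //=.
by rewrite dmap_flip f1 f4.
Qed.

Lemma siso_shift_inj : siso (shift_active M) (shift_active N) -> siso M N.
Proof.
case=> f fb [f1 f2 f3 f4]; exists f => //; split=> //=.
apply: (@perm_inj _ (rot N)); rewrite -f1; apply: (inv_inj (@flipK _)).
by rewrite -dmap_flip f4.
Qed.

End Cancel.

Lemma sgood_siso M N W A B : siso M N -> sgood (M := M) W A B -> exists W' A' B',
  [/\ sgood (M := N) W' A' B', size W' = size W, size A' = size A,
   size B' = size B & #|edge N| = #|edge M|].
Proof.
case=> f fb [f1 f2 f3 f4] g.
exists (map (dmap f) W), (map (dmap f) A), (map (dmap f) B).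
rewrite !size_map (bij_eq_card fb); split=> //.
by rewrite /sgood -f2 -f3 -f4; apply: good_dmap.
Qed.

Section ActiveIter.
Variables (E : finType) (r : {perm (E * bool)}) (s n a : E * bool).
Variables (W A B : seq (E * bool)).
Hypothesis g : good r s n a W A B.

Lemma fpath_last (f : E * bool -> E * bool) x p :
  fpath f x p -> last x p = iter (size p) f x.
Proof. by move/fpathE => {1}->; rewrite last_traject. Qed.

Lemma good_active_path : fpath (nx r) a (rcons B s).
Proof. by move: (good_path g); rewrite catA rcons_cat cat_path => /and3P[]. Qed.

Lemma good_findex : findex (nx r) a s = (size B).+1.
Proof.
have lB := fpath_last good_active_path; rewrite last_rcons size_rcons in lB.
rewrite {1}lB findex_iter //.
have c : fcycle (nx r) (s :: W ++ A ++ a :: B) := good_path g.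
rewrite (order_cycle c (good_uniq g)); last by rewrite !(in_cons, mem_cat) eqxx !orbT.
by rewrite /= !size_cat /=; lia.
Qed.

Lemma good_descends B1 B2 : B = B1 ++ B2 ->
  [/\ descends r a B1 (head s B2), iter (size B1).+1 (nx r) a = head s B2 &
   a != head s B2].
Proof.
move=> BE; move: good_active_path; rewrite BE rcons_cat.
have [t ->] := rcons_head B2 s; rewrite cat_path /= => /and3P[p1 /eqP p2 _].
have := good_down g; rewrite all_cat BE -cat_cons all_cat => /and3P[_ d1 _].
split; first by split.
  by rewrite /= -(fpath_last p1).
have := good_uniq g; rewrite cons_uniq !mem_cat in_cons !negb_or.
case/andP => /and4P[_ _ sa _]; rewrite catA cat_uniq cons_uniq => /and4P[_ _ aB _].
rewrite BE mem_cat negb_or in aB; case/andP: aB => _ aB.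
case: (B2) aB => [|b B3] /=; first by rewrite eq_sym sa.
by rewrite in_cons negb_or => /andP[].
Qed.

End ActiveIter.

(** There are [(size B).+1] edges below the active vertex, so all [i.+1] western edges of the face
    find a partner and [add_bottom] is never applied. *)
Lemma sew_faceE i j M W A B : sgood (M := M) W A B -> i <= size B ->
  sew_face i j M = iter j split_active (add_chord i M).
Proof.
move=> g iB; rewrite /sew_face (good_findex g).
by have -> : i.+1 - (size B).+1 = 0 by lia.
Qed.

Lemma sew_edge_top M W B : sgood (M := M) W [::] B -> sew_edge M = add_top M.
Proof. by move/good_north => /= e; rewrite /sew_edge e eqxx. Qed.

Lemma sew_edge_shift M W A B : sgood (M := M) W A B -> A != [::] ->
  sew_edge M = shift_active M.
Proof.
move=> g A0; rewrite /sew_edge (good_north g); case: ifP => [/eqP aE|//].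
have := good_uniq g; rewrite cons_uniq catA cat_uniq => /and4P[_ _ /hasPn h _].
have := h (active M) (mem_head _ _); rewrite {1}aE /= mem_cat.
by case: (A) A0 => [//|x A'] _; rewrite /= mem_head orbT.
Qed.

(** The condition that a move from abscissa [k] leads to a nonnegative abscissa. *)
Definition move_ok (mv : move) k := if mv is MoveFace i _ then i <= k else true.

Lemma siso_iter_split j M N : siso M N ->
  siso (iter j split_active M) (iter j split_active N).
Proof. by elim: j => //= j IH /IH; apply: siso_split. Qed.

Lemma iso_by_iter (M N : sewing) (f : edge M -> edge N) k : iso_by f ->
  dmap f (iter k (@next M) (active M)) = iter k (@next N) (active N).
Proof.
case=> f1 _ _ f4; elim: k => //= k <-; exact: (dmap_next f1).
Qed.

Lemma siso_move M N W A B mv : siso M N -> sgood (M := M) W A B ->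
  move_ok mv (size B) -> siso (sew_move M mv) (sew_move N mv).
Proof.
move=> MN g; have [W' [A' [B' [g' _ sA sB _]]]] := sgood_siso MN g.
case: mv => [_|i j /= iB] /=.
  case: (A) g sA g' => [|x A0] g; last first.
    case: (A') => // y A1 _ g'; rewrite (sew_edge_shift g) // (sew_edge_shift g') //.
    exact: siso_shift.
  move/size0nil => -> g'; rewrite (sew_edge_top g) (sew_edge_top g').
  exact: siso_top.
rewrite (sew_faceE j g) // (sew_faceE j g') ?sB //; apply: siso_iter_split.
case: MN => f fb fi; rewrite !add_chordE.
apply: (siso_chord fb fi); first exact: (iso_by_iter i.+1 fi).
have [_ iE ab] := good_descends g (esym (cat_take_drop i B)).
by rewrite size_takel // in iE; rewrite -iE in ab.
Qed.

(** * Undoing a whole move *)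

Definition sewing_of (E : finType) (r : {perm (E * bool)}) (s n a : E * bool) : sewing :=
  @Sewing (@OMap E r s n) s a [::].

(** Surgeries produce edge types of the form [option E]. Renaming a chosen edge to [None] makes the
    removal lemmas applicable to any map. *)
Lemma relabel (N : sewing) (e0 : edge N) : exists (E : finType)
    (r : {perm (option E * bool)}) s n a,
  exists2 h : edge N -> option E, bijective h /\ h e0 = None &
    @iso_by N (sewing_of r s n a) h.
Proof.
pose E : finType := {x : edge N | x != e0}.
pose h (x : edge N) : option E := insub x.
pose k (y : option E) : edge N := oapp val e0 y.
have hk : cancel k h.
  case=> [y|] /=; first exact: valK.
  by rewrite /h insubF ?eqxx.
have kh : cancel h k.
  by move=> x; rewrite /h /k; case: insubP => [u _ ux|/negbNE/eqP xe] /=; rewrite ?ux ?xe.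
have hb : bijective h by exists k.
have fI : injective (fun d => dmap h (rot N (dmap k d))).
  move=> x y /(bij_inj (dmap_bij hb))/perm_inj; apply: bij_inj.
  by apply: dmap_bij; exists h.
exists E, (perm fI), (dmap h (south N)), (dmap h (north N)), (dmap h (active N)), h.
  by split=> //; rewrite /h insubF ?eqxx.
by split=> // d /=; rewrite permE /dmap /= !kh -surjective_pairing.
Qed.

Lemma dmap_down (E E' : finType) (h : E -> option E') (a : E * bool) :
  h a.1 = None -> ~~ a.2 -> dmap h a = new_down.
Proof. by rewrite /dmap => -> /negPf->. Qed.

(** The equations cover both kinds of edge move: redoing the move lowers the ordinate
    [size A - size W] by one and adds one to the number of non-missing edges. *)
Lemma unsew_edge (N : sewing) W A B : sgood (M := N) W A B ->
  ~~ (rot N (flip (active N))).2 -> flip (active N) != south N ->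
  exists (M : sewing) W' A' B', [/\ sgood (M := M) W' A' B',
    siso (sew_edge M) N, size B = (size B').+1,
    (size A + size W').+1 = size A' + size W /\ size W' <= size W &
    #|edge N| + size A' = (#|edge M| + size A).+1].
Proof.
move=> g ru us; have [b [B' [BE rb [[A0 ra]|g']]]] := good_pop g ru us; last first.
  exists (@Sewing N (start N) b (sewn_faces N)), W, (rcons A (active N)), B'.
  rewrite BE size_rcons; split=> //=; try lia.
  rewrite (@sew_edge_shift (@Sewing N (start N) b (sewn_faces N)) _ _ _ g').
    exists id; first by exists id.
    by split=> [d|||] /=; rewrite /dmap -?surjective_pairing //= rb flipK.
  by case: (A).
subst A; have [E [r [s [n [a [h [hb h0] hi]]]]]] := relabel (active N).1.
have [h1 h2 h3 h4] := hi; have gI := bij_inj (dmap_bij hb).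
have ad : dmap h (active N) = new_down.
  exact: dmap_down h0 (good_active_down g).
have au : dmap h (flip (active N)) = new_up by rewrite dmap_flip ad.
have /= aE : a = new_down by rewrite -ad h4.
have nE : n = new_down.
  by move: h3 => /=; rewrite (good_north g) /= ad => ->.
have := good_dmap hb h1 g; rewrite BE h2 h3 h4 /= aE nE => g1.
have [||||r0 [s0 [n0 [W0 [B0 [rE sE [WE bE B0E] g0]]]]]] := good_untop g1.
- by rewrite -{1}ad -(h1 (active N)) ra.
- by rewrite -(h1 b) rb au.
- by rewrite -au -(h1 (flip _)).
- by move: us; rewrite -(inj_eq gI) au h2 eq_sym.
exists (sewing_of r0 s0 n0 n0), W0, [::], B0.
have sB : size B' = size B0 by rewrite -(size_map (dmap h)) B0E size_map.
have sW : size W = (size W0).+1 by rewrite -(size_map (dmap h)) WE size_rcons size_map.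
rewrite sB sW /= !addn0 add0n; split=> //.
  rewrite (@sew_edge_top (sewing_of r0 s0 n0 n0) _ _ g0).
  apply/siso_sym; exists h => //; split=> [d|||] /=.
  - by rewrite (h1 d) /= rE.
  - by rewrite h2 /= sE.
  - by rewrite h3 /= nE.
  by rewrite h4 /= aE.
by rewrite (bij_eq_card hb) card_option.
Qed.

(** Each missing edge on the east side of the last face is a split to be undone, whence an induction
    on [size A]. When the face turns down right after the edge below the active vertex, a chord
    remains, and [i] is the length of its west side minus one. *)
Lemma unsew_face (N : sewing) W A B : sgood (M := N) W A B ->
  (rot N (flip (active N))).2 -> flip (active N) != south N ->
  exists (M : sewing) i j W' A' B', [/\ sgood (M := M) W' A' B',
    siso (iter j split_active (add_chord i M)) N, size B' = size B + i,
    size A = size A' + j /\ size W' = size W &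
    #|edge N| = (#|edge M| + j).+1].
Proof.
have [k Ak] := ubnP (size A); elim: k N W A B Ak => // k IH N W A B Ak g ru us.
case nu : (nx (rot N) (flip (active N))).2.
  have [A0 [AE ra rx]] := good_open g ru us nu; set x := nx _ _ in nu AE ra rx.
  have [E [r [s [n [a [h [hb h0] hi]]]]]] := relabel x.1.
  have [h1 h2 h3 h4] := hi; have gI := bij_inj (dmap_bij hb).
  have xu : dmap h x = new_up by rewrite /dmap h0 nu.
  have xd : dmap h (flip x) = new_down by rewrite dmap_flip xu.
  have := good_dmap hb h1 g; rewrite AE h2 h3 h4 /= map_rcons xd => g1.
  have us1 : flip a != s by rewrite -[a]h4 -[s]h2 -dmap_flip (inj_eq gI).
  have u1 : r (flip a) = dmap h (rot N (flip (active N))) by rewrite h1 dmap_flip h4.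
  have [|||r0 [s0 [n0 [a0 [W0 [A1 [B0 [rE sE nE [aE WE A1E BE] g0]]]]]]]] :=
      good_unsplit g1.
  - by rewrite -[a]h4 -[r _]h1 ra xu.
  - by rewrite -xu -[r _]h1 rx -[a]h4.
  - have uo : flip a \notin porbit (nx r) s.
      apply: (notin_outer g1) => //; first by rewrite u1.
      exact: (good_active_down g1).
    by move: uo; rewrite (good_outer g1) -cat_cons mem_cat negb_or => /andP[].
  have ad0 : ~~ a0.2 by have := good_active_down g1; rewrite aE.
  have [|||M [i [j [W' [A' [B' [gM iM sB [sA sW] cE]]]]]]] :=
      IH (sewing_of r0 s0 n0 a0) W0 A1 B0 _ g0.
  - move: Ak; rewrite AE size_rcons ltnS -(size_map (dmap h)) A1E size_map.
    exact: leq_trans.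
  - have : (r (flip a)).2 by rewrite u1.
    by rewrite rE aE flip_old /= split_rot_old flip_neq; case: eqP.
  - by move: us1; rewrite aE sE flip_old old_eq.
  exists M, i, j.+1, W', A', B'; split=> //.
  - rewrite iterS; apply: siso_trans (siso_split iM) _.
    apply/siso_sym; exists h => //; split=> [d|||] /=.
    + by rewrite (h1 d) /= rE.
    + by rewrite h2 /= sE.
    + by rewrite h3 /= nE swap_tperm.
    by rewrite h4 /= aE.
  - by rewrite sB -(size_map (@old E)) -BE size_map.
  - split; last by rewrite sW -(size_map (@old E)) -WE size_map.
    by rewrite size_rcons -(size_map (dmap h)) A1E size_map sA addnS.
  by rewrite (bij_eq_card hb) card_option cE /= addnS.
have [E [r [s [n [a [h [hb h0] hi]]]]]] := relabel (active N).1.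
have [h1 h2 h3 h4] := hi; have gI := bij_inj (dmap_bij hb).
have ad : dmap h (active N) = new_down.
  exact: dmap_down h0 (good_active_down g).
have au : dmap h (flip (active N)) = new_up by rewrite dmap_flip ad.
have /= aE : a = new_down by rewrite -ad h4.
have := good_dmap hb h1 g; rewrite h2 h3 h4 /= aE => g1.
have [|||r0 [s0 [n0 [a0 [b0 [W0 [A0 [D0 [B0 [[ab rE sE] nE [WE AE BE] [H n0E b0E] g0]]]]]]]]]] :=
    good_unchord g1.
- by rewrite -au -[r _]h1.
- by move: us; rewrite -(inj_eq gI) au h2 eq_sym.
- by rewrite -au -[nx r _](dmap_next h1) /dmap /= nu.
pose M := sewing_of r0 s0 n0 a0.
exists M, (size D0), 0, W0, A0, (D0 ++ B0); split=> //.
- have [_ iE _] := good_descends g0 (erefl _).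
  rewrite /= add_chordE [iter _ _ _]iE -b0E.
  apply/siso_sym; exists h => //; split=> [d|||] /=.
  + by rewrite (h1 d) /= rE.
  + by rewrite h2 /= sE.
  + by rewrite h3 /= nE.
  by rewrite h4 /= aE.
- by rewrite size_cat addnC -(size_map (@old E) B0) -BE size_map.
- by rewrite addn0 -(size_map (dmap h)) AE size_map -(size_map (dmap h) W) WE size_map.
by rewrite (bij_eq_card hb) card_option addn0.
Qed.

(** * Tracking the faces *)

(** By the count, the list represents every face but the outer one. A count follows a surgery more
    easily than a converse inclusion would. *)
Record faces_of (E : finType) (r : {perm (E * bool)}) (s : E * bool)
    (ds : seq (E * bool)) : Prop := FacesOf {
  faces_uniq : uniq [seq porbit (nx r) d | d <- ds];
  faces_inner : forall d, d \in ds -> d \notin porbit (nx r) s;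
  faces_count : (size ds).+1 = #|porbits (nx r)|
}.

Section OldFaces.
Variables (E : finType) (r : {perm (E * bool)}) (r' : {perm (option E * bool)}).
Variable ds : seq (E * bool).
Hypothesis H : forall d y, d \in ds -> y \in porbit (nx r) d ->
  nx r' (old y) = old (nx r y).

Lemma old_face d : d \in ds -> porbit (nx r') (old d) = @old E @: porbit (nx r) d.
Proof.
move=> dd; apply: porbit_inj_in; first exact: old_inj.
by move=> y yd; rewrite (H dd yd).
Qed.

Lemma old_faces : [seq porbit (nx r') d | d <- oldS ds]
  = [seq @old E @: (F : {set E * bool}) | F <- [seq porbit (nx r) d | d <- ds]].
Proof. by rewrite -!map_comp; apply/eq_in_map => d dd /=; apply: old_face. Qed.

Lemma uniq_old_faces : uniq [seq porbit (nx r') d | d <- oldS ds]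
  = uniq [seq porbit (nx r) d | d <- ds].
Proof. by rewrite old_faces map_inj_uniq //; apply/imset_inj/old_inj. Qed.

Lemma card_old_faces : [seq #|porbit (nx r') d| | d <- oldS ds]
  = [seq #|porbit (nx r) d| | d <- ds].
Proof.
rewrite -map_comp; apply/eq_in_map => d dd /=.
by rewrite old_face // card_imset //; apply: old_inj.
Qed.

Lemma new_up_old_face d : d \in ds -> new_up \notin porbit (nx r') (old d).
Proof.
by move=> dd; rewrite old_face //; apply/imsetP => -[y _ /eqP]; rewrite newE.
Qed.

End OldFaces.

(** * The list of interior faces through each surgery *)

Section Stages.
Variables (E : finType) (r : {perm (E * bool)}) (s n a : E * bool).
Variables (W A B ds : seq (E * bool)).
Hypotheses (g : good r s n a W A B) (f : faces_of r s ds).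

Let outer_mem := good_outer g.

(** Surgeries redirect steps entering darts of the outer walk, and no step inside an interior face
    does so. Hence interior faces survive, apart from the one adjacent to a split edge. *)
Lemma inner_next d y z : d \in ds -> y \in porbit (nx r) d ->
  z \in s :: W ++ A ++ a :: B -> nx r y != z.
Proof.
move=> dd yd; rewrite -outer_mem => zo; apply: contraNneq (faces_inner f dd) => yz.
rewrite porbit_sym in yd; apply: porbit_trans yd _.
by rewrite -mem_porbit_step yz.
Qed.

Lemma top_next d y : d \in ds -> y \in porbit (nx r) d ->
  nx (top_rot n r) (old y) = old (nx r y).
Proof.
move=> dd yd; rewrite next_top_old (negPf (inner_next dd yd _)) //.
rewrite (good_north g) in_cons !mem_cat; case: (A) => [|x A'] /=.
  by rewrite in_cons eqxx !orbT.
by rewrite in_cons eqxx !orbT.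
Qed.

Lemma faces_top : A = [::] ->
  faces_of (top_rot n r) (old s) (oldS ds).
Proof.
move=> A0; have an : n = a by rewrite (good_north g) A0.
have g' : good r s n n W [::] B by rewrite {2}an -A0.
have gT := (proj2 (@good_top _ r s n W B (good_south_up g)
  (fun x => @core_snk _ _ _ _ (good_core g) x))) g'.
split.
- by rewrite (uniq_old_faces top_next) (faces_uniq f).
- move=> _ /mapP[d dd ->]; rewrite (good_outer gT).
  have := faces_inner f dd; rewrite outer_mem A0 an !(in_cons, mem_cat, mem_rcons).
  rewrite !newE !mem_oldE !negb_or /=.
  by case/and4P => -> -> -> ->.
by rewrite size_map (faces_count f) card_faces_top.
Qed.

Section Chord.
Variables (B1 B2 : seq (E * bool)).
Hypothesis BE : B = B1 ++ B2.
Let b := head s B2.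
Let r' := chord_rot a b r.

Let H : descends r a B1 b := let: And3 h _ _ := good_descends g BE in h.
Let ab : a != b := let: And3 _ _ h := good_descends g BE in h.

Lemma chord_good : good r' (old s) (if a == n then new_down else old n) new_down
  (oldS W) (oldS A) (oldS B2).
Proof.
apply: (proj2 (@good_chord _ r s n a b W A B1 B2 ab (good_south_up g)
  (good_north g) H _ _)) => //; last by rewrite -BE.
by rewrite -BE; apply: good_uniq g.
Qed.

Let bo : b \in s :: W ++ A ++ a :: B.
Proof.
by rewrite BE /b; case: (B2) => [|x p]; rewrite !(in_cons, mem_cat) eqxx ?orbT.
Qed.

Lemma chord_next d y : d \in ds -> y \in porbit (nx r) d ->
  nx r' (old y) = old (nx r y).
Proof.
move=> dd yd; rewrite next_chord_old // !(negPf (inner_next dd yd _)) //.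
by rewrite !(in_cons, mem_cat) eqxx !orbT.
Qed.

Lemma chord_new_face : [/\ fcycle (nx r') (new_up :: oldS (a :: B1)),
  uniq (new_up :: oldS (a :: B1)) & all_down (oldS (a :: B1))].
Proof.
case: (H) => d1 p1 l1; rewrite all_down_old cons_uniq !mem_oldE.
have := good_uniq g; rewrite BE catA cons_uniq => /andP[sN].
rewrite cat_uniq => /and3P[_ _ ub].
have : uniq ((a :: B1) ++ B2) := ub; rewrite cat_uniq => /and3P[uB hB _].
have bB : b \notin a :: B1.
  rewrite /b; case: (B2) hB => [|x p] hB /=.
    apply: contra sN => sB; rewrite mem_cat -cat_cons.
    by rewrite [s \in (a :: B1) ++ _]mem_cat sB orbT.
  by apply/negP => xB; case/hasP: hB; exists x; rewrite ?mem_head.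
split=> //; rewrite /r' /= next_chord_up eqxx rcons_path.
have nab := fun d y => next_chord_eq r d y ab.
rewrite (fpath_old nab) p1 last_old /= next_chord_old // l1.
rewrite [b == a]eq_sym (negPf ab) !eqxx all_true /=.
rewrite andbT; apply/allP => y yB; apply/andP; split.
  by apply: contraTneq yB => ->; case/andP: uB.
by apply: contraNneq bB => <-; rewrite in_cons yB orbT.
Qed.

Lemma faces_chord : faces_of r' (old s) (rcons (oldS ds) new_up).
Proof.
have [cF uF _] := chord_new_face.
have mF := porbit_fcycle cF (mem_head _ _).
split.
- rewrite map_rcons rcons_uniq (uniq_old_faces chord_next) (faces_uniq f) andbT.
  apply/mapP => -[_ /mapP[d dd ->] Fd].
  by have := new_up_old_face chord_next dd; rewrite -Fd porbit_id.
- move=> x; rewrite mem_rcons in_cons (good_outer chord_good).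
  case/orP => [/eqP->|/mapP[d dd ->]].
    by rewrite !(in_cons, mem_cat) !newE !mem_oldE.
  have := faces_inner f dd; rewrite outer_mem BE !(in_cons, mem_cat).
  rewrite !newE !mem_oldE !negb_or /=.
  by case/and4P => -> -> -> /andP[_ /andP[_ ->]].
rewrite size_rcons size_map (faces_count f) card_faces_chord //.
exact: descends_face H.
Qed.

Lemma chord_flip_up : (r' new_up).2.
Proof. by rewrite chord_rot_up; apply: (descends_up H). Qed.

End Chord.

Section Split.
Variables (ds0 U D : seq (E * bool)).
Let u := flip a.
Hypotheses (dsE : ds = rcons ds0 u) (ru : (r u).2).
Hypotheses (cF : fcycle (nx r) (u :: U ++ D)) (uF : uniq (u :: U ++ D)).
Hypotheses (D0 : D != [::]).
Let r' := split_rot a r.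

Let uo : u \notin porbit (nx r) s.
Proof. by apply: (faces_inner f); rewrite dsE mem_rcons mem_head. Qed.

Lemma split_good :
  good r' (old s) (swap a n) (old a) (oldS W) (rcons (oldS A) new_down) (oldS B).
Proof.
apply: (proj2 (good_split r B (good_north g) _)) => //.
by move: uo; rewrite outer_mem -cat_cons mem_cat negb_or => /andP[].
Qed.

(** Inside interior faces the split redirects only the step leaving [flip a], and by [faces_uniq]
    this dart lies on the last face alone. *)
Lemma split_next d y : d \in ds0 -> y \in porbit (nx r) d ->
  nx r' (old y) = old (nx r y).
Proof.
move=> dd yd; have dds : d \in ds by rewrite dsE mem_rcons in_cons dd orbT.
rewrite next_split_old (negPf (inner_next dds yd _)); last first.
  by rewrite !(in_cons, mem_cat) eqxx !orbT.
case: eqP => // yu; have := faces_uniq f.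
rewrite dsE map_rcons rcons_uniq => /andP[/mapP[]]; exists d => //.
by apply/eqP; rewrite eq_porbit_mem /u -yu.
Qed.

Let aN : a \notin u :: U ++ D.
Proof.
rewrite -(porbit_fcycle cF (mem_head _ _)) porbit_sym.
apply: contra uo => /porbit_trans; apply.
by rewrite outer_mem !(in_cons, mem_cat) eqxx !orbT.
Qed.

Lemma split_face : fcycle (nx r') (old u :: (new_up :: oldS U) ++ oldS D) /\
  uniq (old u :: (new_up :: oldS U) ++ oldS D).
Proof.
have lE : old u :: (new_up :: oldS U) ++ oldS D
    = [:: old u] ++ [:: new_up] ++ oldS (U ++ D) by rewrite /= map_cat.
split; last first.
  rewrite lE uniq_catCA !cat1s -map_cons cons_uniq !mem_oldE.
  exact: uF.
have [x [p xE]] : exists x p, U ++ D = x :: p.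
  by case: (U) => [|x p]; [case: (D) D0 => // x p _|]; eexists; eexists.
rewrite lE xE; move: cF uF aN; rewrite xE /= => /andP[/eqP ux pF].
rewrite !in_cons !negb_or => /and3P[/andP[_ uxp] _ _] /and3P[_ ax ap].
rewrite next_split_old eqxx next_split_up ux [x == a]eq_sym (negPf ax) !eqxx /=.
rewrite -map_rcons (fpath_old (next_split_eq r a)) pF !all_neq /=.
rewrite belast_rcons in_cons negb_or mem_rcons in_cons negb_or ap andbT.
move: uF; rewrite xE cons_uniq in_cons negb_or => /andP[-> _].
by rewrite eq_sym flip_neq.
Qed.

Lemma split_flip_up : (r' (flip (old a))).2.
Proof.
rewrite flip_old split_rot_old flip_neq; case: eqP => [ra|//].
by have := good_active_down g; rewrite -ra ru.
Qed.

Lemma faces_split : faces_of r' (old s) (rcons (oldS ds0) (flip (old a))).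
Proof.
have [cF' uF'] := split_face.
have mF := porbit_fcycle cF' (mem_head _ _).
split.
- rewrite map_rcons rcons_uniq (uniq_old_faces split_next); apply/andP; split.
    apply/mapP => -[_ /mapP[d dd ->] Fd].
    have := new_up_old_face split_next dd; rewrite -Fd flip_old -/u mF.
    by rewrite !in_cons eqxx orbT.
  by have := faces_uniq f; rewrite dsE map_rcons rcons_uniq => /andP[].
- move=> x; rewrite flip_old -map_rcons (good_outer split_good) => /mapP[d dd ->].
  have := faces_inner f; rewrite dsE => /(_ d dd); rewrite outer_mem.
  rewrite !(in_cons, mem_cat, mem_rcons) !newE !mem_oldE !negb_or /=.
  by case/and4P => -> -> -> /andP[-> ->].
by rewrite size_rcons size_map card_faces_split -(faces_count f) dsE size_rcons.
Qed.

End Split.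
End Stages.

(** The invariant of the states along a quadrant path. The start vertex is always the south pole,
    since no edge is ever put below it. *)
Record sewn_inv (M : sewing) (W A B : seq (dart M)) : Prop := SewnInv {
  inv_good : sgood W A B;
  inv_start : start M = south M;
  inv_faces : faces_of (rot M) (south M) (sewn_faces M)
}.

(* The state after the j-th subdivision of the chord of a move m_{i,_}: the
   lower half of the chord keeps its edge, so the face just sewn in lies on the
   left of [flip (active N)] throughout. *)
Record face_stage (i j : nat) (degs : seq nat) (N : sewing)
    (W A B : seq (dart N)) : Prop := FaceStage {
  stage_inv : sewn_inv W A B;
  stage_rot : (rot N (flip (active N))).2;
  stage_face : exists U D, [/\ fcycle (@next N) (flip (active N) :: U ++ D),
    uniq (flip (active N) :: U ++ D), all_up U /\ all_down D &
    size U = j /\ size D = i.+1];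
  stage_sewn : exists2 ds, sewn_faces N = rcons ds (flip (active N)) &
    [seq #|face d| | d <- ds] = degs
}.

Lemma stage_chord i M W A B : sewn_inv (M := M) W A B -> i <= size B ->
  exists W' A' B', [/\ face_stage (N := add_chord i M) i 0
      [seq #|face d| | d <- sewn_faces M] W' A' B',
    size W' = size W, size A' = size A & size B = size B' + i].
Proof.
case=> g st f iB; have BE := esym (cat_take_drop i B).
have [_ iE _] := good_descends g BE; rewrite size_takel // in iE.
exists (map (@old _) W), (map (@old _) A), (map (@old _) (drop i B)).
rewrite !size_map size_drop subnK //; split=> //.
change (add_chord i M) with (chord_at (iter i.+1 (@next M) (active M))).
rewrite [iter _ _ _]iE; split.
- by split; [exact: (chord_good g BE) | rewrite /= st | exact: (faces_chord g f BE)].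
- exact: (chord_flip_up g BE).
- have [c u d] := chord_new_face g BE.
  exists [::], (map (@old _) (active M :: take i B)); split=> //.
  by rewrite size_map /= size_takel.
exists (map (@old _) (sewn_faces M)) => //.
exact: (card_old_faces (chord_next g f BE)).
Qed.

Lemma stage_split i j degs N W A B : face_stage (N := N) i j degs W A B ->
  exists W' A' B', [/\ face_stage (N := split_active N) i j.+1 degs W' A' B',
    size W' = size W, size A' = (size A).+1 & size B' = size B].
Proof.
case=> [[g st f] ru [U [D [cF uF [Uu Dd] [sU sD]]]] [ds dsE dsD]].
have D0 : D != [::] by rewrite -size_eq0 sD.
exists (map (@old _) W), (rcons (map (@old _) A) new_down), (map (@old _) B).
rewrite size_rcons !size_map; split=> //.
have [cF' uF'] := split_face g f dsE cF uF D0.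
split.
- split; last first.
  + by rewrite /= dsE map_rcons; apply: (faces_split g f dsE cF uF D0).
  + by rewrite /= st.
  by have := split_good g f dsE; rewrite swap_tperm.
- exact: (split_flip_up g ru).
- exists (new_up :: map (@old _) U), (map (@old _) D); split=> //=.
    by rewrite all_up_old all_down_old.
  by rewrite !size_map sU.
exists (map (@old _) ds); first by rewrite /= dsE map_rcons.
by rewrite -dsD; apply: (card_old_faces (split_next g f dsE)).
Qed.

Lemma stage_face_move i j M W A B : sewn_inv (M := M) W A B -> i <= size B ->
  exists W' A' B', [/\ face_stage (N := sew_face i j M) i j
      [seq #|face d| | d <- sewn_faces M] W' A' B',
    size W' = size W, size A' = size A + j & size B = size B' + i].
Proof.
move=> h iB; rewrite (sew_faceE j (inv_good h) iB).
elim: j => [|j [W' [A' [B' [st sW sA sB]]]]].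
  by have [W' [A' [B' [st sW sA sB]]]] := stage_chord h iB;
    exists W', A', B'; rewrite addn0.
have [W2 [A2 [B2 [st2 sW2 sA2 sB2]]]] := stage_split st.
by exists W2, A2, B2; rewrite sW2 sA2 sB2 sW sA addnS -sB.
Qed.

Lemma stage_not_south i j degs N W A B : face_stage (N := N) i j degs W A B ->
  flip (active N) != south N.
Proof.
case=> [[g st f] _ _ [ds dsE _]].
have := faces_inner f (d := flip (active N)); rewrite dsE mem_rcons mem_head.
by move/(_ isT); apply: contraNneq => ->; rewrite porbit_id.
Qed.

(** Reads [i] and [j] off the map in a way that isomorphisms preserve, which is what injectivity
    needs. *)
Lemma stage_count i j degs N W A B : face_stage (N := N) i j degs W A B ->
  #|[set x in face (flip (active N)) | x.2]| = j.+1 /\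
  #|[set x in face (flip (active N)) | ~~ x.2]| = i.+1.
Proof.
case=> [[g _ _] _ [U [D [cF uF [Uu Dd] [sU sD]]]] _].
have mF := porbit_fcycle cF (mem_head _ _).
have fu : (flip (active N)).2 := good_active_down g.
move: uF; rewrite cons_uniq mem_cat negb_or cat_uniq => /and3P[/andP[uU _] Uu' /andP[_ Du']].
split.
  rewrite -sU -[RHS]/(size (flip (active N) :: U)).
  rewrite -(card_uniqP (_ : uniq (flip (active N) :: U))); last by rewrite /= uU.
  apply: eq_card => x; rewrite inE mF in_cons mem_cat in_cons.
  case: eqP => [->|_]; first by rewrite fu.
  case xU: (x \in U) => /=; first by rewrite (allP Uu).
  by case xD: (x \in D) => //=; apply/negbTE/(allP Dd).
rewrite -sD -(card_uniqP Du').
apply: eq_card => x; rewrite inE mF in_cons mem_cat.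
case xD: (x \in D); first by rewrite (allP Dd) // !orbT.
rewrite orbF; apply/andP => -[/orP[/eqP->|/(allP Uu) ->//]].
by rewrite fu.
Qed.

Lemma stage_degree i j degs N W A B : face_stage (N := N) i j degs W A B ->
  #|face (flip (active N))| = i + j + 2.
Proof.
case=> [_ _ [U [D [cF uF _ [sU sD]]]] _].
rewrite (eq_card (porbit_fcycle cF (mem_head _ _))) (card_uniqP uF) /= size_cat sU sD.
by lia.
Qed.

(** At the source all darts point up, so the direction of the next dart does not reveal the
    westernmost one, which is [south]; hence the second condition. *)
Definition face_move_last (N : sewing) : bool :=
  (rot N (flip (active N))).2 && (flip (active N) != south N).

Lemma stage_last i j degs N W A B : face_stage (N := N) i j degs W A B ->
  face_move_last N.
Proof.
by move=> h; rewrite /face_move_last (stage_not_south h) (stage_rot h).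
Qed.

Lemma siso_face_move_last M N : siso M N -> face_move_last M = face_move_last N.
Proof.
case=> f fb [f1 f2 f3 f4]; rewrite /face_move_last -f4 -f2 -dmap_flip -f1.
by rewrite (inj_eq (bij_inj (dmap_bij fb))).
Qed.

Lemma siso_face_count M N (b : bool) : siso M N ->
  #|[set x in face (flip (active M)) | x.2 == b]|
  = #|[set x in face (flip (active N)) | x.2 == b]|.
Proof.
case=> f fb [f1 f2 f3 f4]; have [h gh hg] := dmap_bij fb.
rewrite -(card_imset _ (can_inj gh)); apply: eq_card => x.
have fE y : (dmap f y \in face (flip (active N))) = (y \in face (flip (active M))).
  by rewrite -f4 -dmap_flip; exact: (dmap_porbit fb (dmap_next f1)).
apply/imsetP/idP => [[y + ->]|]; first by rewrite !inE fE.
rewrite inE -{1}(hg x) fE => /andP[hx xb]; exists (h x); last by rewrite hg.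
by rewrite inE hx; move: xb; rewrite -{1}(hg x).
Qed.

(** Besides the missing edges there is the edge below the active vertex: distinct downward darts
    belong to distinct edges. *)
Lemma sgood_edges M W A B : sgood (M := M) W A B -> size A < #|edge M|.
Proof.
move=> g; have dn d : d \in rcons A (active M) -> ~~ d.2.
  rewrite mem_rcons in_cons => h; apply: (good_downP g).
  by rewrite mem_cat in_cons; case/orP: h => ->; rewrite ?orbT.
have : uniq [seq d.1 | d <- rcons A (active M)].
  rewrite map_inj_in_uniq => [|[e b] [e' b'] /dn + /dn + /= ->].
    have := good_uniq g; rewrite cons_uniq -cat_rcons catA cat_uniq cat_uniq.
    by case/andP => _ /andP[/and3P[]].
  by move=> /= /negPf-> /negPf->.
move/card_uniqP; rewrite size_map size_rcons => <-; exact: max_card.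
Qed.

(** The disjunction bounds the western boundary: it grows only when no missing edge is left, and
    then the ordinate after the move is [m - size W']. *)
Lemma edge_inv M W A B : sewn_inv (M := M) W A B -> exists W' A' B',
  [/\ sewn_inv (M := sew_edge M) W' A' B', ~~ face_move_last (sew_edge M) &
   [/\ size B' = (size B).+1, (size A' + size W).+1 = size A + size W',
     A' = [::] \/ size W' = size W,
     #|edge (sew_edge M)| + size A = (#|edge M| + size A').+1 &
     [seq #|face d| | d <- sewn_faces (sew_edge M)]
     = [seq #|face d| | d <- sewn_faces M]]].
Proof.
case=> g st f; case/lastP EA: A => [|A0 d].
  rewrite EA in g; rewrite (sew_edge_top g).
  have aE := good_north g; rewrite /= in aE.
  have gT := (proj2 (@good_top _ (rot M) (south M) (north M) W B (good_south_up g)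
    (fun x => @core_snk _ _ _ _ (good_core g) x))).
  have g' : good (rot M) (south M) (north M) (north M) W [::] B.
    by move: g; rewrite /sgood -aE.
  exists (rcons (map (@old _) W) new_up), [::], (old (north M) :: map (@old _) B).
  rewrite /= size_rcons !size_map; split.
  - split; [exact: (gT g') | by rewrite /= st | exact: (faces_top g f erefl)].
  - rewrite /face_move_last /= flip_new_down.
    rewrite [_ new_up]top_rot_up negb_and /=.
    suff -> : ~~ (rot M (north M)).2 by [].
    by apply: (core_snk (good_core g)); rewrite mem_porbit_step porbit_id.
  split=> //; first by left.
    by rewrite card_option !addn0.
  exact: (card_old_faces (top_next g f)).
have A0' : A != [::] by rewrite EA; case: (A0).
rewrite (sew_edge_shift g A0'); rewrite EA in g.
have ra := good_rot_active g (erefl _).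
have dE : active (shift_active M) = d by rewrite /= ra flipK.
have lE : A0 ++ d :: active M :: B = rcons A0 d ++ active M :: B by rewrite cat_rcons.
exists W, A0, (active M :: B); rewrite size_rcons; split.
- split=> //; rewrite /sgood dE; split=> /=; rewrite ?lE; try by case: g.
  + by rewrite (good_north g); case: (A0).
  + by move=> x xA; apply: (good_low g); rewrite mem_rcons in_cons xA orbT.
  by move=> x xA; apply: (good_int g); rewrite mem_rcons in_cons xA orbT.
- rewrite /face_move_last dE negb_and.
  by rewrite (good_low g) // mem_rcons mem_head.
split=> //; first by right.
by rewrite addnS.
Qed.

(** The two kinds of edge move are told apart by their edge: a fresh one is pendant, with the outer
    face on both sides, while a formerly missing one has an interior face on its left. *)
Lemma sew_edge_inj M N W A B W' A' B' : sgood (M := M) W A B ->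
  sgood (M := N) W' A' B' -> siso (sew_edge M) (sew_edge N) -> siso M N.
Proof.
have mixed M1 M2 W1 A1 B1 W2 B2 : sgood (M := M1) W1 A1 B1 -> A1 != [::] ->
    sgood (M := M2) W2 [::] B2 -> ~ siso (sew_edge M2) (sew_edge M1).
  case/lastP: A1 => // A1 d g1 A0 g2; rewrite (sew_edge_top g2) (sew_edge_shift g1 A0).
  case=> f fb [f1 f2 f3 f4].
  have ra := good_rot_active g1 (erefl _).
  have rT : rot (add_top M2) (active (add_top M2)) = active (add_top M2).
    exact: top_rot_down.
  have := f1 (active (add_top M2)); rewrite rT f4 /= ra flipK => rd.
  have dA : d \in rcons A1 d by rewrite mem_rcons mem_head.
  have : nx (rot M1) (flip d) = d by apply/eqP; rewrite next_in_face_eq flipK -rd.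
  move=> nd; have : flip d \in porbit (nx (rot M1)) (south M1).
    rewrite -mem_porbit_step nd (good_outer g1) !(in_cons, mem_cat) dA.
    by rewrite !orbT.
  rewrite (good_outer g1) -cat_cons mem_cat (negPf (good_int g1 dA)) /=.
  move/(good_downP g1); rewrite /= negbK => d2.
  by have := good_downP g1 (d := d); rewrite mem_cat dA d2 => /(_ isT).
case: (eqVneq A [::]) => [-> |A0] g; case: (eqVneq A' [::]) => [->|A0'] g' h.
- rewrite (sew_edge_top g) (sew_edge_top g') in h.
  by apply: siso_top_inj h; rewrite ?(good_north g) ?(good_north g').
- by case: (mixed _ _ _ _ _ _ _ g' A0' g).
- by case: (mixed _ _ _ _ _ _ _ g A0 g'); apply: siso_sym.
rewrite (sew_edge_shift g A0) (sew_edge_shift g' A0') in h.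
exact: siso_shift_inj.
Qed.

Lemma siso_iter_split_inj j M N :
  siso (iter j split_active M) (iter j split_active N) -> siso M N.
Proof. by elim: j => //= j IH /siso_split_inj. Qed.

Lemma sew_move_inj M N mv mv' W A B W' A' B' :
  sewn_inv (M := M) W A B -> sewn_inv (M := N) W' A' B' ->
  move_ok mv (size B) -> move_ok mv' (size B') ->
  siso (sew_move M mv) (sew_move N mv') -> mv = mv' /\ siso M N.
Proof.
move=> hM hN; case: mv mv' => [|i j] [|i' j'] ok ok' h /=.
- by split=> //; apply: sew_edge_inj h; apply: inv_good; eassumption.
- have [? [? [? [_ e _]]]] := edge_inv hM.
  have [? [? [? [st _ _ _]]]] := stage_face_move j' hN ok'.
  by move: e; rewrite (siso_face_move_last h) (stage_last st).
- have [? [? [? [_ e _]]]] := edge_inv hN.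
  have [? [? [? [st _ _ _]]]] := stage_face_move j hM ok.
  by move: e; rewrite -(siso_face_move_last h) (stage_last st).
have [W1 [A1 [B1 [st _ _ _]]]] := stage_face_move j hM ok.
have [W2 [A2 [B2 [st' _ _ _]]]] := stage_face_move j' hN ok'.
have cset (P : sewing) b : [set x in face (flip (active P)) | x.2 == b]
    = [set x in face (flip (active P)) | if b then x.2 else ~~ x.2].
  by apply/setP => x; rewrite !inE; case: b; case: (x.2).
have := siso_face_count true h; have := siso_face_count false h.
rewrite !cset /= in h *.
have [-> ->] := stage_count st; have [-> ->] := stage_count st' => -[ii] [jj].
rewrite -ii -jj in ok' h *; split=> //.
rewrite (sew_faceE j (inv_good hM) ok) (sew_faceE j (inv_good hN) ok') in h.
have iB : i <= size B := ok; have iB' : i <= size B' := ok'.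
have {}h : siso (add_chord i M) (add_chord i N).
  exact: siso_iter_split_inj h.
rewrite !add_chordE in h; apply: siso_chord_inj h.
  have [_ iE ab] := good_descends (inv_good hM) (esym (cat_take_drop i B)).
  by rewrite size_takel // in iE; rewrite -iE in ab.
have [_ iE ab] := good_descends (inv_good hN) (esym (cat_take_drop i B')).
by rewrite size_takel // in iE; rewrite -iE in ab.
Qed.

(** * Lattice paths *)

Section Paths.
Local Open Scope ring_scope.

Definition end_point (p : int * int) (w : seq move) : int * int := last p (visited p w).

Definition path_in_quadrant (p : int * int) (w : seq move) : bool :=
  all in_quadrant (p :: visited p w).

Lemma visited_rcons p w mv :
  visited p (rcons w mv) = rcons (visited p w) (end_point p w + increment mv).
Proof. by elim: w p => //= mv' w IH p; rewrite IH. Qed.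

Lemma end_point_rcons p w mv :
  end_point p (rcons w mv) = end_point p w + increment mv.
Proof. by rewrite {1}/end_point visited_rcons last_rcons. Qed.

Lemma path_in_quadrant_rcons p w mv : path_in_quadrant p (rcons w mv) =
  path_in_quadrant p w && in_quadrant (end_point p w + increment mv).
Proof.
rewrite /path_in_quadrant visited_rcons /= all_rcons andbCA andbC -!andbA.
by do !bool_congr.
Qed.

End Paths.

Lemma sew_rcons w mv : sew (rcons w mv) = sew_move (sew w) mv.
Proof. by rewrite /sew -cats1 foldl_cat. Qed.

Lemma core_single : core (1%g : {perm (unit * bool)}) (tt, true) (tt, false).
Proof.
have p1 x y : (x \in porbit (1%g : {perm (unit * bool)}) y) = (x == y).
  by rewrite porbit_fix // perm1.
have V : porbits (1%g : {perm (unit * bool)}) =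
    [set porbit 1%g (tt, true); porbit 1%g (tt, false)].
  apply/setP => O; rewrite !inE; apply/imsetP/orP => [[[[] []] _ ->]|].
  - by left.
  - by right.
  by case=> /eqP->; eexists.
have nE d : nx (1%g : {perm (unit * bool)}) d = flip d.
  by rewrite -[LHS]perm1 next_in_faceE.
have F : porbits (nx (1%g : {perm (unit * bool)})) =
    [set porbit (nx (1%g : {perm (unit * bool)})) (tt, true)].
  apply/setP => O; rewrite inE; apply/imsetP/eqP => [[[[] []] _ -> //]|->].
    by apply/eqP; rewrite eq_porbit_mem -mem_porbit_step nE porbit_id.
  by eexists.
split.
- move=> P _ Pf; have h x : P x = P (tt, true).
    by case: x => [[] []] //; rewrite -(Pf (tt, true)).
  by move=> d x; rewrite !h.
- by rewrite V F cards1 cards2 card_unit eq_porbit_mem p1.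
- by exists (fun d => if d.2 then 0 else 1) => [d|[]] //; rewrite perm1.
- by move=> x; rewrite p1 => /eqP->.
- by move=> [[] []]; rewrite ?p1 // => _; exists (tt, false); rewrite ?p1.
- by move=> x; rewrite p1 => /eqP->.
- by move=> [[] []]; rewrite ?p1 // => _; exists (tt, true); rewrite ?p1.
Qed.

Lemma single_inv : sewn_inv (M := single_edge) [::] [::] [::].
Proof.
have nE d : nx (1%g : {perm (unit * bool)}) d = flip d.
  by rewrite -[LHS]perm1 next_in_faceE.
split=> //.
  by split; rewrite //= ?nE //; exact: core_single.
split=> //=; have := core_genus core_single.
suff -> : #|porbits (1%g : {perm (unit * bool)})| = 2.
  by rewrite card_unit (addnC 1) => /addnI ->.
have h (x : unit * bool) : porbit 1%g x = [set x].
  by apply/setP => y; rewrite inE porbit_fix ?perm1.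
rewrite /porbits (eq_card (_ : _ =i [set [set (x : unit * bool)] | x in predT])).
  by rewrite card_imset ?card_prod ?card_unit ?card_bool //; apply: set1_inj.
by move=> O; apply/imsetP/imsetP => -[x _ ->]; exists x.
Qed.

Lemma card_edge_face i j M W A B : sgood (M := M) W A B -> i <= size B ->
  #|edge (sew_face i j M)| = (#|edge M| + j).+1.
Proof.
move=> g iB; rewrite (sew_faceE j g iB).
elim: j => [|j IH]; first by rewrite addn0 card_option.
by rewrite iterS [LHS]card_option IH addnS.
Qed.

Section Forward.
Local Open Scope ring_scope.

Lemma add_int_pair (a b c d : int) : (a, b) + (c, d) = (a + c, b + d).
Proof. by []. Qed.

(** [W] omits the first western edge, so [m] is its final size. The number of non-missing edges is
    the number of moves plus one. *)
Lemma sew_inv m w : path_in_quadrant (0, Posz m) w ->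
  exists W A B : seq (dart (sew w)),
  [/\ sewn_inv (M := sew w) W A B,
    end_point (0, Posz m) w = (Posz (size B), Posz (size A + m) - Posz (size W)),
    (size W <= m)%N, #|edge (sew w)| = (size A + size w + 1)%N &
    [seq #|face d| | d <- sewn_faces (sew w)] = pmap face_degree w].
Proof.
elim/last_ind: w => [_|w mv IH].
  exists [::], [::], [::]; split=> //; first exact: single_inv.
  - by rewrite /end_point /= add0n GRing.subr0.
  - by rewrite card_unit.
rewrite path_in_quadrant_rcons sew_rcons end_point_rcons => /andP[/IH].
case=> [W [A [B [inv eE Wm cE fE]]]]; rewrite eE /in_quadrant => /andP[].
have -> : pmap face_degree (rcons w mv)
    = pmap face_degree w ++ pmap face_degree [:: mv] by rewrite -cats1 pmap_cat.
case: mv => [|i j] /= x0 y0.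
  have [W' [A' [B' [inv' _ [sB sA sW cE' fE']]]]] := edge_inv inv.
  exists W', A', B'; rewrite cats0 -fE size_rcons; split=> //.
  - by rewrite add_int_pair sB; congr (_, _); lia.
  (* Only here is the nonnegative ordinate used: with no missing edge left, it says that the longer
     western boundary still fits in [m]. *)
  - by case: sW => [A0|->//]; move: sA y0; rewrite A0 /=; lia.
  - by apply/eqP; rewrite -(eqn_add2r (size A)) cE' cE; apply/eqP; lia.
have iB : (i <= size B)%N by move: x0; lia.
have [W' [A' [B' [st sW sA sB]]]] := stage_face_move j inv iB.
have [ds dsE dsD] := stage_sewn st.
exists W', A', B'; rewrite size_rcons; split.
- exact: stage_inv st.
- by rewrite add_int_pair sB sW sA; congr (_, _); lia.
- by rewrite sW.
- by rewrite /= (card_edge_face j (inv_good inv) iB) cE sA; lia.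
rewrite dsE map_rcons dsD (stage_degree st) fE cats1.
by [].
Qed.

End Forward.

Lemma quadrant_pathP l p q w : quadrant_path l p q w <->
  [/\ size w = l, path_in_quadrant p w & end_point p w = q].
Proof. by []. Qed.

Lemma sew_inj (m : nat) w w' : size w = size w' ->
  path_in_quadrant (0%R, Posz m) w -> path_in_quadrant (0%R, Posz m) w' ->
  siso (sew w) (sew w') -> w = w'.
Proof.
have ok v mv W A B : path_in_quadrant (0%R, Posz m) (rcons v mv) ->
    end_point (0%R, Posz m) v
      = (Posz (size B), Posz (size A + m) - Posz (size W))%R ->
    move_ok mv (@size (dart (sew v)) B).
  rewrite path_in_quadrant_rcons => /andP[_ +] eE; rewrite eE /in_quadrant.
  by case: mv => [//|i j] /= /andP[] /=; lia.
elim/last_ind: w w' => [|w mv IH] w'; first by case: w'.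
case/lastP: w' => [|w' mv']; first by rewrite size_rcons.
rewrite !size_rcons => -[sz] Pw Pw'; rewrite !sew_rcons.
have [Qw Qw'] : path_in_quadrant (0%R, Posz m) w /\ path_in_quadrant (0%R, Posz m) w'.
  by move: Pw Pw'; rewrite !path_in_quadrant_rcons => /andP[-> _] /andP[-> _].
have [W [A [B [inv eE _ _ _]]]] := sew_inv Qw.
have [W' [A' [B' [inv' eE' _ _ _]]]] := sew_inv Qw'.
move=> h; have [-> /(IH _ sz Qw Qw') -> //] :=
  sew_move_inj inv inv' (ok _ _ _ _ _ _ _ Pw eE) (ok _ _ _ _ _ _ _ Pw' eE') h.
Qed.

(** Induction on the number of non-missing edges. Undoing a move never lengthens [W], so the bound
    by [m] persists and keeps the ordinates of the rebuilt path nonnegative. *)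
Lemma sew_surj m k N W A B : sgood (M := N) W A B ->
  #|edge N| = size A + k + 1 -> size W <= m ->
  exists2 w, size w = k /\ siso (sew w) N & path_in_quadrant (0%R, Posz m) w /\
    end_point (0%R, Posz m) w
      = (Posz (size B), Posz (size A + m) - Posz (size W))%R.
Proof.
elim: k N W A B => [|k IH] N W A B g cE Wm.
  case: (boolP (face_move_last N)) => [/andP[ru us]|].
    (* With a single non-missing edge, undoing a move would leave a map all of whose edges are
       missing, against [sgood_edges]. *)
    have [M [i [j [W' [A' [B' [g' _ _ [sA _] cE']]]]]]] := unsew_face g ru us.
    by have := sgood_edges g'; lia.
  rewrite negb_and negbK => h.
  case: (eqVneq (flip (active N)) (south N)) h => [us _|us]; last first.
    rewrite orbF => ru.
    have [M [W' [A' [B' [g' _ sB _ cE']]]]] := unsew_edge g ru us.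
    by have := sgood_edges g'; lia.
  have [A0 W0 B0 all2] := good_single g us.
  exists [::]; last first.
    by split=> //; rewrite A0 W0 B0 /end_point /= add0n GRing.subr0.
  split=> //.
  have dE : active N = ((active N).1, false).
    by have := good_active_down g; case: (active N) => e [].
  have sE : south N = ((active N).1, true) by rewrite -us {1}dE.
  have nE : north N = active N by rewrite (good_north g) A0.
  have eE e : e = (active N).1.
    by case: (all2 (e, true)) => [|/(congr1 fst) //]; rewrite sE => -[].
  exists (fun _ : unit => (active N).1).
    by exists (fun=> tt) => [[]|e] //; rewrite -eE.
  split=> [[[] b]|||]; rewrite /dmap /= ?nE ?sE -?dE //.
  rewrite perm1 /=; set x := (_, b).
  (* With only one edge, a dart is determined by its direction, and both poles preserve directions,
     so the rotation is trivial. *)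
  have h y : y.2 = (rot N y).2 -> y = rot N y.
    case: y => e c; case: (rot N (e, c)) => e' c' /= ->.
    by rewrite (eE e) (eE e').
  apply: h; rewrite /x; case: (b).
    rewrite -sE !(core_src (good_core g)) ?porbit_id //.
    by rewrite mem_porbit_step porbit_id.
  rewrite -dE -nE; have c := core_snk (good_core g).
  by rewrite !(negPf (c _ _)) // ?mem_porbit_step porbit_id.
case: (boolP (face_move_last N)) => [/andP[ru us]|].
  have [M [i [j [W' [A' [B' [g' iM sB [sA sW] cE']]]]]]] := unsew_face g ru us.
  have [||w [wk wM] [wP wE]] := IH _ _ _ _ g'; [lia | lia |].
  have iB : i <= size B' by lia.
  exists (rcons w (MoveFace i j)).
    rewrite size_rcons wk; split=> //; rewrite sew_rcons.
    have [W1 [A1 [B1 [g1 _ _ sB1 _]]]] := sgood_siso (siso_sym wM) g'.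
    apply: siso_trans iM; rewrite -(sew_faceE j g' iB).
    by apply: (siso_move (mv := MoveFace i j)) wM g1 _; rewrite /= sB1.
  rewrite path_in_quadrant_rcons end_point_rcons wP wE add_int_pair /in_quadrant /=.
  split; first by apply/andP; split; lia.
  by congr (_, _); lia.
rewrite negb_and negbK => h.
case: (eqVneq (flip (active N)) (south N)) h => [us _|us].
  have [A0 W0 B0 all2] := good_single g us.
  have : #|edge N| <= 1.
    rewrite -(cards1 (active N).1) -cardsT; apply/subset_leq_card/subsetP => e _.
    rewrite inE; case: (all2 (e, true)) => [|<- //]; rewrite -us => -[->] //.
  by lia.
rewrite orbF => ru.
have [M [W' [A' [B' [g' iM sB [sA sW] cE']]]]] := unsew_edge g ru us.
have [||w [wk wM] [wP wE]] := IH _ _ _ _ g'; [lia | lia |].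
exists (rcons w MoveEdge).
  rewrite size_rcons wk; split=> //; rewrite sew_rcons.
  have [W1 [A1 [B1 [g1 _ _ sB1 _]]]] := sgood_siso (siso_sym wM) g'.
  apply: siso_trans iM.
  exact: (siso_move (mv := MoveEdge)) wM g1 _.
rewrite path_in_quadrant_rcons end_point_rcons wP wE add_int_pair /in_quadrant /=.
split; first by lia.
by congr (_, _); lia.
Qed.

(** * Unmarked maps and their boundaries *)

Section Boundaries.
Variables (M : sewing) (W A B : seq (dart M)).
Hypothesis g : sgood W A B.

Lemma sgood_bipolar : bipolar_map M.
Proof.
apply/core_bipolar; split; first exact: good_core g.
rewrite /outer_face /face (good_outer g) in_cons !mem_cat (good_north g).
by case: (A) => [|x A'] /=; rewrite mem_head ?orbT.
Qed.

Lemma size_west_boundary : size (west_boundary M) = (size W).+1.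
Proof.
rewrite size_traject; have [pW lW _ _] := good_paths g.
have nE : north M = iter (size W).+1 (@next M) (south M).
  by rewrite -lW (fpath_last pW).
rewrite {1}nE findex_iter //.
have c : fcycle (@next M) (south M :: W ++ A ++ active M :: B) := good_path g.
by rewrite (order_cycle c (good_uniq g)) ?mem_head //= !size_cat /= !addnS !ltnS leq_addr.
Qed.

Lemma size_east_boundary : A = [::] -> size (east_boundary M) = (size B).+1.
Proof.
move=> A0; have := good_north g; rewrite A0 /= => nE.
by rewrite size_traject nE; apply: (good_findex g).
Qed.

End Boundaries.

(** The corner at the north pole is an up-down turn of the outer face and the one at the south pole
    a down-up turn. By uniqueness there are no others, so the walk ascends up to the north pole and
    descends after it. *)
Lemma bipolar_sgood (M : omap) : bipolar_map M -> exists W B,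
  sgood (M := @Sewing M (south M) (north M) [::]) W [::] B.
Proof.
case/core_bipolar => c nO; have [p [cp up pE]] := fcycle_porbit (nx (rot M)) (south M).
have su : (south M).2 by apply: (core_src c); apply: porbit_id.
have nd : ~~ (north M).2 by apply: (core_snk c); apply: porbit_id.
have : north M \in p.
  move: nO; rewrite /outer_face /face pE in_cons => /orP[/eqP ns|//].
  by rewrite ns su in nd.
move=> np; case/splitPr: np cp up pE => W B cp up pE.
have pW : fpath (nx (rot M)) (south M) W /\ fpath (nx (rot M)) (north M) B.
  move: cp; rewrite /= rcons_cat cat_path /= rcons_path.
  by case/and4P => -> _ -> _.
case: pW => pW pB; exists W, B; split=> //=.
- rewrite -/(all_up (south M :: W)).
  apply: (@fpath_all _ (nx (rot M)) (fun d => d.2)) => // y yW yu.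
  apply: contraT => yd.
  have rn : ~~ (rot M (north M)).2.
    by apply: (core_snk c); rewrite mem_porbit_step porbit_id.
  have zE : nx (rot M) (flip (rot M (north M))) = north M.
    by apply/eqP; rewrite next_in_face_eq flipK.
  have : y = flip (rot M (north M)).
    apply: (face_up_down c) => //; last by rewrite zE.
    rewrite -mem_porbit_step -mem_porbit_stepr zE.
    apply: porbit_trans (_ : south M \in _); last first.
      by rewrite porbit_sym pE in_cons mem_cat mem_head !orbT.
    by rewrite pE in_cons mem_cat yW orbT.
  move=> yE; move: yW up; rewrite yE zE /= cat_uniq => nW /and3P[_ _].
  by rewrite /= nW.
apply: (@fpath_all _ (nx (rot M)) (fun d => ~~ d.2)) => // y yB yd.
apply/negP => yu.
have ru : (rot M (south M)).2.
  by apply: (core_src c); rewrite mem_porbit_step porbit_id.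
have zE : nx (rot M) (flip (rot M (south M))) = south M.
  by apply/eqP; rewrite next_in_face_eq flipK.
have : y = flip (rot M (south M)).
  apply: (face_down_up c) => //; rewrite ?zE //= ?ru //.
  rewrite -mem_porbit_step -mem_porbit_stepr zE pE in_cons mem_cat in_cons yB.
  by rewrite !orbT.
move=> yE; move: yB up; rewrite yE zE /= mem_cat in_cons => ->.
by rewrite !orbT.
Qed.

Theorem theorem2 (l m n : nat) (hl : 1 <= l) :
  let is_path := quadrant_path (l - 1) (0%R, Posz m) (Posz n, 0%R) in
  let is_map := bipolar_map_with l (m + 1) (n + 1) in
  [/\ (* the construction maps paths to (unmarked) bipolar-oriented maps *)
      forall w, is_path w ->
        [/\ marked_bipolar_map (sew w), unmarked (sew w) & is_map (sew w)],
      (* it is injective up to isomorphism *)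
      forall w w', is_path w -> is_path w' ->
        isomorphic (sew w) (sew w') -> w = w',
      (* it is surjective up to isomorphism *)
      forall M, is_map M -> exists2 w, is_path w & isomorphic (sew w) M
    & (* the faces sewn in by the steps (-i, j), in order, are exactly the
         interior faces, each once, and have degree i + j + 2 *)
      forall w, is_path w ->
        perm_eq [seq face d | d <- sewn_faces (sew w)]
                (enum (interior_faces (sew w))) /\
        [seq #|face d| | d <- sewn_faces (sew w)] = pmap face_degree w].
Proof.
move=> is_path is_map.
have final w : is_path w -> exists W B, [/\ sewn_inv (M := sew w) W [::] B,
    size W = m, size B = n, active (sew w) = north (sew w) &
    [seq #|face d| | d <- sewn_faces (sew w)] = pmap face_degree w].
  case/quadrant_pathP => sw pw ew; have [W [A [B [inv eE Wm cE fE]]]] := sew_inv pw.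
  move: eE; rewrite ew => -[nB mW].
  (* Ordinate zero together with [size W <= m] leaves [size A = 0] and [size W = m]. *)
  have A0 : A = [::] by apply/size0nil; lia.
  rewrite A0 in inv mW cE; exists W, B; split=> //; first by move: mW => /=; lia.
  by rewrite (good_north (inv_good inv)).
have card_edges w : is_path w -> #|edge (sew w)| = l.
  case/quadrant_pathP => sw pw ew; have [W [A [B [inv eE Wm cE fE]]]] := sew_inv pw.
  by move: eE; rewrite ew cE sw => -[nB mW]; lia.
split.
- move=> w pw; have [W [B [[g st f] sW sB aN _]]] := final w pw.
  have bm := sgood_bipolar g.
  have ws := size_west_boundary g; have es := size_east_boundary g (erefl _).
  have wE : west_boundary (sew w) = south (sew w) :: behead (west_boundary (sew w)).
    by move: ws; rewrite /west_boundary size_traject => ->.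
  have eE : east_boundary (sew w) = north (sew w) :: behead (east_boundary (sew w)).
    by move: es; rewrite /east_boundary size_traject => ->.
  have mw : missing_west (sew w) = [::] by rewrite /missing_west wE st /= eqxx.
  have me : missing_east (sew w) = [::] by rewrite /missing_east eE aN /= eqxx.
  split; last first.
  + by split=> //; rewrite ?card_edges ?ws ?es ?sW ?sB ?addn1.
  + by split.
  split; rewrite ?mw ?me //.
  + by rewrite st wE mem_head.
  + by rewrite aN eE mem_head.
  + move=> d; rewrite mem_seq1 => /eqP->; rewrite st eq_card0 // => x.
    by rewrite !inE; apply/negP => /andP[/(core_src (good_core g)) ->].
  move=> d; rewrite mem_seq1 => /eqP->; rewrite aN eq_card0 // => x.
  by rewrite !inE; apply/negP => /andP[/(core_snk (good_core g)) /negPf->].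
- move=> w w' pw pw' [f fb [f1 f2 f3]].
  have [W [B [_ _ _ aN _]]] := final w pw; have [W' [B' [_ _ _ aN' _]]] := final w' pw'.
  have [sw qw _] := pw; have [sw' qw' _] := pw'.
  apply: (sew_inj (m := m)) qw qw' _; first by rewrite sw sw'.
  by exists f => //; split=> //; rewrite aN aN'.
- move=> M [bm cE ws es]; have [W [B g]] := bipolar_sgood bm.
  have := size_west_boundary g; rewrite [size _]ws => sW.
  have := size_east_boundary g (erefl _); rewrite [size _]es => sB.
  (* An unmarked map has no missing edge, so [l] edges amount to [l - 1] moves. *)
  have [||w [wk [f fb [f1 f2 f3 _]]] [wP wE]] := @sew_surj m (l - 1) _ _ _ _ g.
  + by rewrite /= cE; lia.
  + by lia.
  exists w; last by exists f.
  split=> //; rewrite -/(end_point _ _) wE; move: sW sB; rewrite !addn1 /= add0n.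
  by move=> [<-] [<-]; rewrite GRing.subrr.
move=> w pw; have [W [B [[g st f] sW sB aN fE]]] := final w pw; split=> //.
apply: uniq_perm; [exact: (faces_uniq f) | exact: enum_uniq |].
have sub : {subset [seq face d | d <- sewn_faces (sew w)]
    <= enum (interior_faces (sew w))}.
  move=> _ /mapP[d dd ->]; rewrite mem_enum !inE imset_f // andbT.
  by rewrite eq_porbit_mem (faces_inner f).
(* The listed faces are distinct and interior, so it is enough to compare numbers, which
   [faces_count] settles. *)
suff sz : size (enum (interior_faces (sew w)))
    <= size [seq face d | d <- sewn_faces (sew w)].
  by case: (uniq_min_size (faces_uniq f) sub sz).
rewrite -cardE size_map.
have := faces_count f; rewrite -[porbits _]/(faces (sew w)).
rewrite (cardsD1 (outer_face (sew w))) imset_f // => -[->].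
by [].
Qed.
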